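(* Let $n\geq 2$, let $p\geq 0$, and let $a$ be an integer. For an $n$-tuple $\lambda=(\lambda^1,\dots,\lambda^n)$ of partitions of $p$, let $m_\lambda$ denote the multiplicity of $S_{\lambda^1}V_1\otimes\cdots\otimes S_{\lambda^n}V_n$ inside $\bigwedge^p(V_1\otimes\cdots\otimes V_n)$ (as functors of finite dimensional vector spaces $V_1,\dots,V_n$). Let $K_{p,0}(a)$ be the functor sending $(V_1,\dots,V_n)$ to the Koszul cohomology group $K_{p,0}(X,\mathcal{B}_a;\mathcal{L})$, where $X=\mathbb{P}V_1\times\cdots\times\mathbb{P}V_n$, $\mathcal{L}=\mathcal{O}(1,1,\dots,1)$ and $\mathcal{B}_a=\mathcal{O}(a,0,\dots,0)$. Then $$K_{p,0}(a)=\bigoplus_{\lambda} \left(S_{\lambda^1[p+a]}\otimes S_{\lambda^2}\otimes\cdots\otimes S_{\lambda^n}\right)^{\oplus m_{\lambda}},$$ where the sum is over all $n$-tuples $\lambda=(\lambda^1,\dots,\lambda^n)$ of partitions of $p$, and the functor $S_{\lambda^1[p+a]}$ is identically zero when $\lambda^1_1>a$. (Thus for all $V_1,\dots,V_n$ this gives the decomposition of $K_{p,0}(X,\mathcal{B}_a;\mathcal{L})$ into irreducible $GL(V_1)\times\cdots\times GL(V_n)$-representations.)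
   Context: All vector spaces are finite dimensional over a field $\mathbb{K}$ of characteristic zero. $S_\delta$ denotes the Schur functor associated to the partition $\delta$, with $S_{(r)}=\mathrm{Sym}^r$. For a partition $\delta=(\delta_1,\delta_2,\dots)$ of $r$ and an integer $m$, $\delta[m]$ denotes $(m-r,\delta_1,\delta_2,\dots)$, which is a partition of $m$ when $m-r\geq\delta_1$ (with $\delta_1=0$ for the empty partition); by convention $S_{\delta[m]}$ is identically zero when $m-r<\delta_1$. Koszul cohomology: if $X\subset\mathbb{P}W$ is a projective variety embedded by the complete linear series of a line bundle $\mathcal{L}$ (so $W=H^0(X,\mathcal{L})$) and $\mathcal{B}$ is a sheaf on $X$, then $K_{p,q}(X,\mathcal{B};\mathcal{L})$ is the homology at the middle of the Koszul complex $$\bigwedge^{p+1}W\otimes H^0(X,\mathcal{B}\otimes\mathcal{L}^{q-1})\to\bigwedge^{p}W\otimes H^0(X,\mathcal{B}\otimes\mathcal{L}^{q})\to\bigwedge^{p-1}W\otimes H^0(X,\mathcal{B}\otimes\mathcal{L}^{q+1}).$$ The convention for projective space is $H^0(\mathbb{P}V,\mathcal{O}(d))=\mathrm{Sym}^dV$, so all constructions are functorial in $V_1,\dots,V_n$. *)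

(* Defs.v *)
From HB Require Import structures.
From mathcomp Require Import all_boot all_order all_algebra fingroup perm.
From mathcomp Require Import boolp classical_sets.

Set Implicit Arguments.
Unset Strict Implicit.
Unset Printing Implicit Defensive.

Import Order.TTheory GRing.Theory Num.Theory.
Local Open Scope ring_scope.

Section Tensors.
Variable K : fieldType.

Definition ebasis (A : vectType K) (k : 'I_(\dim {:A})) : A := (vbasis {:A})`_k.
Definition ecoord (A : vectType K) (k : 'I_(\dim {:A})) (a : A) : K :=
  coord (vbasis {:A}) k a.

Lemma ebasis_sum (A : vectType K) (a : A) :
  a = \sum_k ecoord k a *: ebasis k.
Proof. exact: coord_vbasis (memvf a). Qed.

Lemma ecoord_ebasis (A : vectType K) (k l : 'I_(\dim {:A})) :
  ecoord l (ebasis k) = (k == l)%:R.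
Proof.
by rewrite /ecoord coord_free 1?eq_sym // (basis_free (vbasisP _)).
Qed.

HB.instance Definition _ (A : vectType K) (k : 'I_(\dim {:A})) :=
  GRing.isLinear.Build K A K *%R (ecoord k) (linearP (coord (vbasis {:A}) k)).

(* Coordinates of the tensor product of a finite family of spaces, with respect
   to the product of the bases [ebasis]. *)
Definition tidx (I : finType) (V : I -> vectType K) : finType :=
  {dffun forall i, 'I_(\dim {:V i})}.

Definition tens (I : finType) (V : I -> vectType K) : vectType K :=
  {ffun tidx V -> K^o}.

Definition ptens (I : finType) (V : I -> vectType K) (v : forall i, V i) :
  tens V := [ffun J : tidx V => \prod_i ecoord (J i) (v i)].

Lemma distr_dffun (I : finType) (T : I -> finType) (F : forall i, T i -> K) :
  \prod_i \sum_(j : T i) F i j =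
  \sum_(t : {dffun forall i, T i}) \prod_i F i (t i).
Proof.
rewrite [RHS](reindex (@dffun_of_fprod _ T)) /=; last first.
  exact/onW_bij/dffun_of_fprod_bij.
under [RHS]eq_bigr => t _ do under eq_bigr => i _ do rewrite ffunE.
pose G i := [ffun j => F i j].
transitivity (\sum_(t : fprod T) \prod_(i in I) G i (t i)); last first.
  by apply: eq_bigr => t _; apply: eq_bigr => i _; rewrite ffunE.
rewrite big_fprod -(bigA_distr_big_dep _ (fun i => untag 0 (G i))).
apply: eq_bigr => i _; rewrite -(big_tag (fun i => G i)).
by apply: eq_bigr => j _; rewrite ffunE.
Qed.

Lemma ptens_sum (I : finType) (V : I -> vectType K) (T : I -> finType)
    (c : forall i, T i -> K) (u : forall i, T i -> V i) :
  ptens (fun i => \sum_(k : T i) c i k *: u i k) =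
  \sum_(t : {dffun forall i, T i})
    (\prod_i c i (t i)) *: ptens (fun i => u i (t i)).
Proof.
apply/ffunP => J; rewrite ffunE sum_ffunE.
under eq_bigr => i _ do rewrite linear_sum /=.
rewrite distr_dffun; apply: eq_bigr => t _.
rewrite !ffunE /= -[RHS]big_split /=.
by apply: eq_bigr => i _; rewrite linearZ.
Qed.

Lemma tens_sum (I : finType) (V : I -> vectType K) (t : tens V) :
  t = \sum_(J : tidx V) t J *: ptens (fun i => ebasis (J i)).
Proof.
apply/ffunP => L; rewrite sum_ffunE (bigD1 L) //= big1 ?addr0 => [|J neJL].
  rewrite !ffunE big1 ?mulr1 /= => [|i _]; last by rewrite ecoord_ebasis eqxx.
  by rewrite /GRing.scale /= mulr1.
have [i neJLi] : exists i, J i != L i.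
  apply/existsP; apply: contraNT neJL => /existsPn eqJL.
  by apply/eqP/ffunP => i; apply/eqP; rewrite -[_ == _]negbK eqJL.
by rewrite !ffunE (bigD1 i) //= ecoord_ebasis (negPf neJLi) mul0r scaler0.
Qed.

(* [text phi] is the linear map sending v_1 ⊗ ... ⊗ v_k to phi (v_1, ..., v_k)
   when phi is multilinear. *)
Section Text.
Variables (I : finType) (V : I -> vectType K) (U : vectType K).
Variable phi : (forall i, V i) -> U.
Definition text_fun (t : tens V) : U :=
  \sum_(J : tidx V) t J *: phi (fun i => ebasis (J i)).
Lemma text_fun_linear : linear text_fun.
Proof.
move=> a s t; rewrite /text_fun scaler_sumr -big_split /=.
by apply: eq_bigr => J _; rewrite !ffunE scalerDl scalerA.
Qed.
HB.instance Definition _ :=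
  GRing.isLinear.Build K (tens V) U *:%R text_fun text_fun_linear.
Definition text : 'Hom(tens V, U) := linfun text_fun.
Lemma textE t : text t = \sum_(J : tidx V) t J *: phi (fun i => ebasis (J i)).
Proof. by rewrite lfunE. Qed.
End Text.

Lemma tens_lfunP (I : finType) (V : I -> vectType K) (U : vectType K)
    (f g : 'Hom(tens V, U)) :
  (forall v, f (ptens v) = g (ptens v)) -> f = g.
Proof.
move=> fg; apply/lfunP => t; rewrite [t]tens_sum !linear_sum.
by apply: eq_bigr => J _; rewrite !linearZ /= fg.
Qed.

Definition tmap (I : finType) (V W : I -> vectType K)
  (f : forall i, 'Hom(V i, W i)) : 'Hom(tens V, tens W) :=
  text (fun v : forall i, V i => ptens (fun i => f i (v i))).

Lemma ptens_ext (I : finType) (V : I -> vectType K) (u v : forall i, V i) :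
  (forall i, u i = v i) -> ptens u = ptens v.
Proof.
by move=> uv; apply/ffunP => J; rewrite !ffunE; apply: eq_bigr => i _; rewrite uv.
Qed.

Lemma tmap_ptens (I : finType) (V W : I -> vectType K)
    (f : forall i, 'Hom(V i, W i)) (v : forall i, V i) :
  tmap f (ptens v) = ptens (fun i => f i (v i)).
Proof.
rewrite /tmap textE.
transitivity (ptens (fun i => \sum_k ecoord k (v i) *: f i (ebasis k))).
  by rewrite ptens_sum; apply: eq_bigr => J _; rewrite ffunE.
apply: ptens_ext => i; rewrite [in RHS](ebasis_sum (v i)) linear_sum.
by apply: eq_bigr => k _; rewrite linearZ.
Qed.

Lemma tmap_id (I : finType) (V : I -> vectType K) :
  tmap (fun i => \1%VF : 'End(V i)) = \1%VF.
Proof.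
apply: tens_lfunP => v; rewrite tmap_ptens id_lfunE.
by apply: ptens_ext => i; rewrite id_lfunE.
Qed.

Lemma tmap_comp (I : finType) (V W Z : I -> vectType K)
    (g : forall i, 'Hom(W i, Z i)) (f : forall i, 'Hom(V i, W i)) :
  tmap (fun i => (g i \o f i)%VF) = (tmap g \o tmap f)%VF.
Proof.
apply: tens_lfunP => v; rewrite comp_lfunE !tmap_ptens.
by apply: ptens_ext => i; rewrite comp_lfunE.
Qed.

Definition tens2 (A B : vectType K) : vectType K :=
  'M[K]_(\dim {:A}, \dim {:B}).

Definition ptens2 (A B : vectType K) (a : A) (b : B) : tens2 A B :=
  \matrix_(i, j) (ecoord i a * ecoord j b).

Lemma ptens2_linearl (A B : vectType K) (b : B) : linear (fun a : A => ptens2 a b).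
Proof. by move=> c a a'; apply/matrixP => i j; rewrite !mxE linearP mulrDl mulrA. Qed.
Lemma ptens2_linearr (A B : vectType K) (a : A) : linear (@ptens2 A B a).
Proof.
by move=> c b b'; apply/matrixP => i j; rewrite !mxE linearP mulrDr mulrCA.
Qed.

Lemma tens2_sum (A B : vectType K) (M : tens2 A B) :
  M = \sum_i \sum_j (M : 'M_(_, _)) i j *: ptens2 (ebasis i) (ebasis j).
Proof.
rewrite [LHS]matrix_sum_delta; apply: eq_bigr => i _; apply: eq_bigr => j _.
congr (_ *: _); apply/matrixP => k l.
by rewrite !mxE !ecoord_ebasis -natrM mulnb ![_ == k]eq_sym ![_ == l]eq_sym.
Qed.

Lemma linear_comb (A U : vectType K) (f : A -> U) (fl : linear f)
    (I : finType) (c : I -> K) (u : I -> A) :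
  f (\sum_i c i *: u i) = \sum_i c i *: f (u i).
Proof.
pose g : {linear A -> U} := HB.pack f (GRing.isLinear.Build K A U *:%R f fl).
rewrite -[f]/(g : A -> U) linear_sum.
by apply: eq_bigr => i _; rewrite linearZ.
Qed.

(* [text2 phi] is the linear map sending a ⊗ b to phi a b when phi is
   bilinear. *)
Section Text2.
Variables (A B U : vectType K) (phi : A -> B -> U).
Definition text2_fun (M : tens2 A B) : U :=
  \sum_i \sum_j (M : 'M_(_, _)) i j *: phi (ebasis i) (ebasis j).
Lemma text2_fun_linear : linear text2_fun.
Proof.
move=> a s t; rewrite /text2_fun scaler_sumr -big_split /=.
apply: eq_bigr => i _; rewrite scaler_sumr -big_split /=.
by apply: eq_bigr => j _; rewrite !mxE scalerDl scalerA.
Qed.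
HB.instance Definition _ :=
  GRing.isLinear.Build K (tens2 A B) U *:%R text2_fun text2_fun_linear.
Definition text2 : 'Hom(tens2 A B, U) := linfun text2_fun.
Lemma text2_ptens2 a b :
    (forall b, linear (phi^~ b)) -> (forall a, linear (phi a)) ->
  text2 (ptens2 a b) = phi a b.
Proof.
move=> pl pr; rewrite lfunE /= /text2_fun.
rewrite [in RHS](ebasis_sum a) (linear_comb (pl b)); apply: eq_bigr => i _.
rewrite [in RHS](ebasis_sum b) (linear_comb (pr _)) scaler_sumr.
by apply: eq_bigr => j _; rewrite mxE scalerA.
Qed.
End Text2.

Lemma tens2_lfunP (A B U : vectType K) (f g : 'Hom(tens2 A B, U)) :
  (forall a b, f (ptens2 a b) = g (ptens2 a b)) -> f = g.
Proof.
move=> fg; apply/lfunP => M; rewrite [M]tens2_sum !linear_sum.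
apply: eq_bigr => i _; rewrite !linear_sum.
by apply: eq_bigr => j _; rewrite !linearZ /= fg.
Qed.

Definition tmap2 (A B A' B' : vectType K) (f : 'Hom(A, A')) (g : 'Hom(B, B')) :
  'Hom(tens2 A B, tens2 A' B') := text2 (fun a b => ptens2 (f a) (g b)).

Lemma tmap2_ptens2 (A B A' B' : vectType K) (f : 'Hom(A, A')) (g : 'Hom(B, B'))
    a b : tmap2 f g (ptens2 a b) = ptens2 (f a) (g b).
Proof.
rewrite /tmap2 text2_ptens2 // => c u v w.
  by rewrite linearP ptens2_linearl.
by rewrite linearP ptens2_linearr.
Qed.

Lemma tmap2_id (A B : vectType K) :
  tmap2 (\1%VF : 'End(A)) (\1%VF : 'End(B)) = \1%VF.
Proof. by apply: tens2_lfunP => a b; rewrite tmap2_ptens2 !id_lfunE. Qed.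

Lemma tmap2_comp (A B A' B' A'' B'' : vectType K)
    (f' : 'Hom(A', A'')) (g' : 'Hom(B', B''))
    (f : 'Hom(A, A')) (g : 'Hom(B, B')) :
  tmap2 (f' \o f)%VF (g' \o g)%VF = (tmap2 f' g' \o tmap2 f g)%VF.
Proof.
by apply: tens2_lfunP => a b; rewrite comp_lfunE !tmap2_ptens2 !comp_lfunE.
Qed.

(* Tensor powers. The permutation s sends v_0 ⊗ ... ⊗ v_(r-1) to the tensor
   whose factor in position s i is v_i. As (s * t) i = t (s i) for [perm], this
   is a right action of 'S_r : permt (s * t) = permt t \o permt s. *)
Section Power.
Variables (r : nat) (A : vectType K).

Definition tpow : vectType K := tens (fun _ : 'I_r => A).

Definition perm_tidx (s : 'S_r) (J : tidx (fun _ : 'I_r => A)) :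
  tidx (fun _ : 'I_r => A) := [ffun i => J (s i)].

Definition permt (s : 'S_r) : 'End(tpow) :=
  text (fun v : 'I_r -> A => ptens (fun i => v (s^-1%g i)) : tpow).

Lemma permt_ptens s (v : 'I_r -> A) :
  permt s (ptens v) = ptens (fun i => v (s^-1%g i)).
Proof.
rewrite /permt textE (ptens_ext (fun i => ebasis_sum (v (s^-1%g i)))).
rewrite ptens_sum [RHS](reindex_inj (h := perm_tidx s^-1)) /=; last first.
  move=> J L /ffunP eqJL; apply/ffunP => i.
  by have := eqJL (s i); rewrite !ffunE permK.
apply: eq_bigr => J _; rewrite !ffunE; congr (_ *: _).
  rewrite [RHS](reindex_inj (@perm_inj _ s)) /=.
  by apply: eq_bigr => i _; rewrite ffunE permK.
by apply: ptens_ext => i; rewrite ffunE.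
Qed.

Lemma permtE s (t : tpow) J : permt s t J = t (perm_tidx s J).
Proof.
rewrite {1}[t]tens_sum linear_sum sum_ffunE /= [in RHS](tens_sum t) sum_ffunE.
apply: eq_bigr => L _; rewrite linearZ /= permt_ptens !ffunE.
congr (_ * _); rewrite (reindex_inj (@perm_inj _ s)) /=.
by apply: eq_bigr => i _; rewrite permK ffunE.
Qed.

Lemma permtM s t : permt (s * t)%g = (permt t \o permt s)%VF.
Proof.
apply/lfunP => x; apply/ffunP => J; rewrite comp_lfunE !permtE; congr (x _).
by apply/ffunP => i; rewrite !ffunE permM.
Qed.

Definition symt : 'End(tpow) := \sum_(s : 'S_r) permt s.
Definition asymt : 'End(tpow) := \sum_(s : 'S_r) (-1) ^+ s *: permt s.

(* The Young symmetrizer c = a b of the shape [sh] (a sequence of row lengths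
   with sum r), for the tableau filled row by row with 0, ..., r - 1: the box
   k : 'I_r lies in row [reshape_index sh k] and column [reshape_offset sh k]. *)
Definition rowstab (sh : seq nat) (s : 'S_r) : bool :=
  [forall k : 'I_r, reshape_index sh (s k) == reshape_index sh k].
Definition colstab (sh : seq nat) (s : 'S_r) : bool :=
  [forall k : 'I_r, reshape_offset sh (s k) == reshape_offset sh k].
Definition youngt (sh : seq nat) : 'End(tpow) :=
  \sum_(s | rowstab sh s) \sum_(t | colstab sh t) (-1) ^+ t *: permt (s * t)%g.

End Power.

Definition tpow_map r (A B : vectType K) (f : 'Hom(A, B)) :
  'Hom(tpow r A, tpow r B) := tmap (fun _ : 'I_r => f).

Lemma tpow_map_permt r (A B : vectType K) (f : 'Hom(A, B)) (s : 'S_r) x :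
  tpow_map r f (permt A s x) = permt B s (tpow_map r f x).
Proof.
rewrite -!comp_lfunE; congr (fun_of_lfun _ x); apply: tens_lfunP => v.
by rewrite !comp_lfunE permt_ptens /tpow_map !tmap_ptens permt_ptens.
Qed.

Lemma tpow_map_symt r (A B : vectType K) (f : 'Hom(A, B)) x :
  tpow_map r f (symt r A x) = symt r B (tpow_map r f x).
Proof.
rewrite !sum_lfunE linear_sum.
by apply: eq_bigr => s _ /=; rewrite tpow_map_permt.
Qed.

Lemma tpow_map_asymt r (A B : vectType K) (f : 'Hom(A, B)) x :
  tpow_map r f (asymt r A x) = asymt r B (tpow_map r f x).
Proof.
rewrite !sum_lfunE linear_sum.
by apply: eq_bigr => s _; rewrite !scale_lfunE linearZ /= tpow_map_permt.
Qed.

Lemma tpow_map_youngt r sh (A B : vectType K) (f : 'Hom(A, B)) x :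
  tpow_map r f (youngt r A sh x) = youngt r B sh (tpow_map r f x).
Proof.
rewrite !sum_lfunE linear_sum; apply: eq_bigr => s _.
rewrite !sum_lfunE linear_sum; apply: eq_bigr => t _.
by rewrite !scale_lfunE linearZ /= tpow_map_permt.
Qed.

(* Multiplication A ⊗ Sym^d A -> Sym^(d+1) A, where Sym^d A is the image of
   [symt] in A^⊗d and a product v_1 ... v_d is the average of the
   permutations of v_1 ⊗ ... ⊗ v_d. *)
Definition sym_space d (A : vectType K) : vectType K := subvs_of (limg (symt d A)).

Definition tcons d (A : vectType K) (v : A) (t : tpow d A) : tpow d.+1 A :=
  [ffun J : tidx (fun _ : 'I_d.+1 => A) =>
    ecoord (J ord0) v * t [ffun i => J (lift ord0 i)]].

Definition smul d (A : vectType K) (v : A) (f : sym_space d A) :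
    sym_space d.+1 A :=
  vsproj _ ((d.+1)`!%:R^-1 *: symt d.+1 A (tcons v (vsval f))).

(* The contraction of Λ^(p+1) A against the k-th element of the dual basis,
   where Λ^p A is the image of [asymt] in A^⊗p; it sends w_0 ∧ ... ∧ w_p to
   \sum_i (-1)^i ecoord k w_i (w_0 ∧ .. omit w_i .. ∧ w_p). *)
Definition ext_space p (A : vectType K) : vectType K := subvs_of (limg (asymt p A)).

Definition icons p (A : vectType K) (k : 'I_(\dim {:A}))
    (J : tidx (fun _ : 'I_p => A)) : tidx (fun _ : 'I_p.+1 => A) :=
  [ffun i => if unlift ord0 i is Some j then J j else k].

Definition tcontr p (A : vectType K) k (t : tpow p.+1 A) : tpow p A :=
  [ffun J => t (icons k J)].

Definition contr p (A : vectType K) k (x : ext_space p.+1 A) : ext_space p A :=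
  vsproj _ (tcontr k (vsval x)).

Lemma tcons_ptens d (A : vectType K) (v : A) (w : 'I_d -> A) :
  tcons v (ptens w) =
  ptens (fun i : 'I_d.+1 => if unlift ord0 i is Some j then w j else v).
Proof.
apply/ffunP => J; rewrite !ffunE big_ord_recl unlift_none; congr (_ * _).
by apply: eq_bigr => i _; rewrite ffunE liftK.
Qed.

Lemma tcons_linearl d (A : vectType K) (t : tpow d A) : linear (fun v => tcons v t).
Proof.
by move=> c u v; apply/ffunP => J; rewrite !ffunE linearP /= mulrDl -mulrA.
Qed.
Lemma tcons_linearr d (A : vectType K) (v : A) : linear (@tcons d A v).
Proof.
move=> c s t; apply/ffunP => J; rewrite !ffunE mulrDr.
by congr (_ + _); rewrite /GRing.scale /= mulrCA.
Qed.

Lemma tpow_map_tcons d (A B : vectType K) (f : 'Hom(A, B)) v (t : tpow d A) :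
  tpow_map d.+1 f (tcons v t) = tcons (f v) (tpow_map d f t).
Proof.
rewrite [t]tens_sum (linear_comb (tcons_linearr v)) linear_sum.
rewrite (linear_sum (tpow_map d f)) /=.
under [in RHS]eq_bigr => J _ do rewrite linearZ /=.
rewrite (linear_comb (tcons_linearr (f v))); apply: eq_bigr => J _.
rewrite linearZ /= !tcons_ptens /tpow_map !tmap_ptens tcons_ptens.
congr (_ *: _); apply: ptens_ext => i.
by case: unliftP.
Qed.

Lemma smul_linearl d (A : vectType K) (f : sym_space d A) : linear (fun v => smul v f).
Proof.
move=> c u v; rewrite /smul tcons_linearl linearP scalerDr scalerA mulrC -scalerA.
by rewrite linearP.
Qed.
Lemma smul_linearr d (A : vectType K) (v : A) : linear (@smul d A v).
Proof.
move=> c f g; rewrite /smul linearP tcons_linearr linearP scalerDr scalerA mulrC.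
by rewrite -scalerA linearP.
Qed.

Lemma smul_val d (A : vectType K) (v : A) (f : sym_space d A) :
  vsval (smul v f) = (d.+1)`!%:R^-1 *: symt d.+1 A (tcons v (vsval f)).
Proof. by rewrite vsprojK // memvZ // memv_img // memvf. Qed.

Lemma tens_linP (I : finType) (V : I -> vectType K) (U : vectType K)
    (f g : tens V -> U) (fl : linear f) (gl : linear g) :
  (forall v, f (ptens v) = g (ptens v)) -> f =1 g.
Proof.
move=> fg t; rewrite [t]tens_sum (linear_comb fl) (linear_comb gl).
by apply: eq_bigr => J _; rewrite fg.
Qed.

Lemma tcontr_linear p (A : vectType K) k : linear (@tcontr p A k).
Proof. by move=> c s t; apply/ffunP => J; rewrite !ffunE. Qed.

Lemma tcontr_ptens p (A : vectType K) k (w : 'I_p.+1 -> A) :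
  tcontr k (ptens w) = ecoord k (w ord0) *: ptens (fun i => w (lift ord0 i)).
Proof.
apply/ffunP => J; rewrite !ffunE big_ord_recl ffunE unlift_none.
by congr (_ * _); apply: eq_bigr => i _; rewrite ffunE liftK.
Qed.

Lemma tpow_map_tcontr p (A B : vectType K) (f : 'Hom(A, B)) (t : tpow p.+1 A) l :
  tcontr l (tpow_map p.+1 f t) =
  \sum_k ecoord l (f (ebasis k)) *: tpow_map p f (tcontr k t).
Proof.
move: t; apply: tens_linP => [c s t|c s t|v].
- by rewrite linearP tcontr_linear.
- rewrite scaler_sumr -big_split /=; apply: eq_bigr => k _.
  by rewrite tcontr_linear linearP scalerDr !scalerA [_ * c]mulrC.
rewrite /tpow_map tmap_ptens tcontr_ptens [in LHS](ebasis_sum (v ord0)).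
rewrite !linear_sum scaler_suml; apply: eq_bigr => k _.
rewrite tcontr_ptens !linearZ /= tmap_ptens scalerA; by [].
Qed.

Lemma sum_lift_perm p (j : 'I_p.+1) (U : vectType K) (F : 'S_p.+1 -> U) :
  \sum_(s : 'S_p.+1 | s ord0 == j) F s = \sum_(t : 'S_p) F (lift_perm ord0 j t).
Proof.
rewrite (reindex (lift_perm ord0 j)) /=; last first.
  pose ulsf i (s : 'S_p.+1) k := odflt k (unlift (s i) (s (lift i k))).
  have ulsfK i (s : 'S_p.+1) k: lift (s i) (ulsf i s k) = s (lift i k).
    rewrite /ulsf; have:= neq_lift i k.
    by rewrite -(can_eq (permK s)) => /unlift_some[] ? ? ->.
  have inj_ulsf: injective (ulsf ord0 _).
    move=> s; apply: can_inj (ulsf (s ord0) s^-1%g) _ => k'.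
    by rewrite {1}/ulsf ulsfK !permK liftK.
  exists (fun s => perm (inj_ulsf s)) => [s _ | s].
    by apply/permP=> k'; rewrite permE /ulsf lift_perm_lift lift_perm_id liftK.
  move/(s _ =P _) => si0; apply/permP=> k.
  case: (unliftP ord0 k) => [k'|] ->; rewrite ?lift_perm_id //.
  by rewrite lift_perm_lift -si0 permE ulsfK.
by apply: eq_bigl => t; rewrite lift_perm_id eqxx.
Qed.

Lemma asymt_ptens p (A : vectType K) (w : 'I_p -> A) :
  asymt p A (ptens w) = \sum_(s : 'S_p) (-1) ^+ s *: ptens (fun i => w (s i)).
Proof.
rewrite sum_lfunE (reindex_inj invg_inj) /=; apply: eq_bigr => s _.
by rewrite scale_lfunE permt_ptens odd_permV invgK.
Qed.

Lemma tcontr_asymt p (A : vectType K) k (w : 'I_p.+1 -> A) :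
  tcontr k (asymt p.+1 A (ptens w)) =
  \sum_(j < p.+1) ((-1) ^+ j * ecoord k (w j)) *:
    asymt p A (ptens (fun i => w (lift j i))).
Proof.
rewrite asymt_ptens (linear_comb (@tcontr_linear _ _ k)).
rewrite (partition_big (fun s : 'S_p.+1 => s ord0) predT) //=.
apply: eq_bigr => j _; rewrite sum_lift_perm asymt_ptens scaler_sumr.
apply: eq_bigr => s _; rewrite tcontr_ptens lift_perm_id !scalerA.
rewrite odd_lift_perm /= signr_addb signr_odd mulrAC; congr (_ *: _).
by apply: ptens_ext => i; rewrite lift_perm_lift.
Qed.

Lemma tcontr_ext p (A : vectType K) k (t : tpow p.+1 A) :
  t \in limg (asymt p.+1 A) -> tcontr k t \in limg (asymt p A).
Proof.
case/memv_imgP => u _ ->; rewrite [u]tens_sum linear_sum.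
under eq_bigr => J _ do rewrite linearZ /=.
rewrite (linear_comb (@tcontr_linear _ _ k)).
apply: memv_suml => J _; rewrite memvZ // tcontr_asymt.
by apply: memv_suml => j _; rewrite memvZ // memv_img // memvf.
Qed.

Lemma contr_val p (A : vectType K) k (x : ext_space p.+1 A) :
  vsval (contr k x) = tcontr k (vsval x).
Proof. by rewrite vsprojK // tcontr_ext // subvsP. Qed.

Lemma contr_linear p (A : vectType K) k : linear (@contr p A k).
Proof. by move=> c s t; rewrite /contr linearP tcontr_linear linearP. Qed.

(* The Koszul differential Λ^(p+1) A ⊗ M -> Λ^p A ⊗ M' of a bilinear product
   mu : A x M -> M'. *)
Definition kdiff p (A M M' : vectType K) (mu : A -> M -> M') :
    'Hom(tens2 (ext_space p.+1 A) M, tens2 (ext_space p A) M') :=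
  text2 (fun x m => \sum_k ptens2 (contr k x) (mu (ebasis k) m)).

Lemma kdiff_ptens2 p (A M M' : vectType K) (mu : A -> M -> M') x m :
    (forall a, linear (mu a)) ->
  kdiff p mu (ptens2 x m) = \sum_k ptens2 (contr k x) (mu (ebasis k) m).
Proof.
move=> mul; rewrite /kdiff text2_ptens2 // => y c u v.
  rewrite scaler_sumr -big_split; apply: eq_bigr => k _.
  by rewrite contr_linear ptens2_linearl.
rewrite scaler_sumr -big_split; apply: eq_bigr => k _.
by rewrite mul ptens2_linearr.
Qed.

Lemma kdiff_natural p (A B M M' N N' : vectType K)
    (mu : A -> M -> M') (nu : B -> N -> N')
    (f : 'Hom(A, B)) (e1 : 'Hom(ext_space p.+1 A, ext_space p.+1 B))
    (e0 : 'Hom(ext_space p A, ext_space p B)) (g : 'Hom(M, N)) (g' : 'Hom(M', N')) :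
    (forall a, linear (mu a)) -> (forall b, linear (nu b)) ->
    (forall n, linear (nu^~ n)) ->
    (forall x, vsval (e1 x) = tpow_map p.+1 f (vsval x)) ->
    (forall x, vsval (e0 x) = tpow_map p f (vsval x)) ->
    (forall a m, g' (mu a m) = nu (f a) (g m)) ->
  forall y, kdiff p nu (tmap2 e1 g y) = tmap2 e0 g' (kdiff p mu y).
Proof.
move=> mul nul nur He1 He0 Hg y; rewrite -!comp_lfunE.
congr (fun_of_lfun _ y); apply: tens2_lfunP => x m.
rewrite !comp_lfunE tmap2_ptens2 !kdiff_ptens2 // linear_sum /=.
have ctr l : contr l (e1 x) = \sum_k ecoord l (f (ebasis k)) *: e0 (contr k x).
  apply: val_inj; rewrite /= contr_val He1 tpow_map_tcontr linear_sum /=.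
  by apply: eq_bigr => k _; rewrite He0 contr_val.
under eq_bigr => l _ do rewrite ctr (linear_comb (ptens2_linearl _)).
rewrite exchange_big; apply: eq_bigr => k _ /=.
rewrite tmap2_ptens2 Hg [in RHS](ebasis_sum (f (ebasis k))).
rewrite (linear_comb (nur _)) (linear_comb (ptens2_linearr _)).
by [].
Qed.

(* The product of tensor products induced by bilinear maps mu i. *)
Definition tens_mul (I : finType) (A B C : I -> vectType K)
    (mu : forall i, A i -> B i -> C i) (s : tens A) (t : tens B) : tens C :=
  \sum_(J : tidx A) \sum_(L : tidx B)
    (s J * t L) *: ptens (fun i => mu i (ebasis (J i)) (ebasis (L i))).

Lemma tens_mul_linearl (I : finType) (A B C : I -> vectType K)
    (mu : forall i, A i -> B i -> C i) t : linear (fun s => tens_mul mu s t).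
Proof.
move=> c u v; rewrite scaler_sumr -big_split; apply: eq_bigr => J _ /=.
rewrite scaler_sumr -big_split; apply: eq_bigr => L _ /=.
by rewrite !ffunE mulrDl scalerDl scalerA mulrA.
Qed.
Lemma tens_mul_linearr (I : finType) (A B C : I -> vectType K)
    (mu : forall i, A i -> B i -> C i) s : linear (tens_mul mu s).
Proof.
move=> c u v; rewrite scaler_sumr -big_split; apply: eq_bigr => J _ /=.
rewrite scaler_sumr -big_split; apply: eq_bigr => L _ /=.
by rewrite !ffunE mulrDr scalerDl scalerA mulrCA.
Qed.

Lemma tens_mul_ptens (I : finType) (A B C : I -> vectType K)
    (mu : forall i, A i -> B i -> C i) (a : forall i, A i) (b : forall i, B i) :
    (forall i x, linear ((mu i)^~ x)) -> (forall i x, linear (mu i x)) ->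
  tens_mul mu (ptens a) (ptens b) = ptens (fun i => mu i (a i) (b i)).
Proof.
move=> mul mur; pose u i k := mu i (ebasis k) (b i).
transitivity (ptens (fun i => \sum_k ecoord k (a i) *: u i k)); last first.
  by apply: ptens_ext => i; rewrite [in RHS](ebasis_sum (a i)) (linear_comb (mul _ _)).
rewrite ptens_sum; apply: eq_bigr => J _; rewrite {}/u.
pose u i k := mu i (ebasis (J i)) (ebasis k).
transitivity ((\prod_i ecoord (J i) (a i)) *:
    ptens (fun i => \sum_k ecoord k (b i) *: u i k)); last first.
  congr (_ *: _); apply: ptens_ext => i.
  by rewrite [in RHS](ebasis_sum (b i)) (linear_comb (mur _ _)).
rewrite ptens_sum scaler_sumr; apply: eq_bigr => L _.
by rewrite !ffunE scalerA.
Qed.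

Lemma tens_mul_natural (I : finType) (A B C A' B' C' : I -> vectType K)
    (mu : forall i, A i -> B i -> C i) (mu' : forall i, A' i -> B' i -> C' i)
    (f : forall i, 'Hom(A i, A' i)) (g : forall i, 'Hom(B i, B' i))
    (h : forall i, 'Hom(C i, C' i)) :
    (forall i x, linear ((mu i)^~ x)) -> (forall i x, linear (mu i x)) ->
    (forall i x, linear ((mu' i)^~ x)) -> (forall i x, linear (mu' i x)) ->
    (forall i x y, h i (mu i x y) = mu' i (f i x) (g i y)) ->
  forall s t, tmap h (tens_mul mu s t) = tens_mul mu' (tmap f s) (tmap g t).
Proof.
move=> mul mur mul' mur' hE s t; move: s; apply: tens_linP => [c u v|c u v|a].
- by rewrite tens_mul_linearl linearP.
- by rewrite linearP tens_mul_linearl.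
move: t; apply: tens_linP => [c u v|c u v|b].
- by rewrite tens_mul_linearr linearP.
- by rewrite linearP tens_mul_linearr.
rewrite tens_mul_ptens // !tmap_ptens tens_mul_ptens //.
by apply: ptens_ext => i; rewrite hE.
Qed.

End Tensors.

Section PairMap.
Variables (K : fieldType) (A B A' B' : vectType K).
Variables (f : 'Hom(A, A')) (g : 'Hom(B, B')).
Definition pair_map (x : A * B) : A' * B' := (f x.1, g x.2).
Lemma pair_map_linear : linear pair_map.
Proof. by move=> c x y; rewrite /pair_map !linearP. Qed.
HB.instance Definition _ :=
  GRing.isLinear.Build K (A * B)%type (A' * B')%type *:%R pair_map pair_map_linear.
Definition pair_lfun : 'Hom((A * B)%type, (A' * B')%type) := linfun pair_map.
Lemma pair_lfunE x : pair_lfun x = (f x.1, g x.2).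
Proof. by rewrite lfunE. Qed.
End PairMap.

(* Functors of n finite dimensional vector spaces (V_0, ..., V_(n-1)), covariant
   in each variable. *)
Record mfunctor (K : fieldType) (n : nat) := MFunctor {
  fobj :> ('I_n -> vectType K) -> vectType K;
  fmap : forall V W : 'I_n -> vectType K,
    (forall i, 'Hom(V i, W i)) -> 'Hom(fobj V, fobj W);
  fmap_id : forall V : 'I_n -> vectType K,
    @fmap V V (fun i => \1%VF) = \1%VF;
  fmap_comp : forall (V W Z : 'I_n -> vectType K)
    (g : forall i, 'Hom(W i, Z i)) (f : forall i, 'Hom(V i, W i)),
    @fmap V Z (fun i => (g i \o f i)%VF) = (@fmap W Z g \o @fmap V W f)%VF
}.
Arguments fmap {K n} F {V W} f : rename.

Section Functors.
Variables (K : fieldType) (n : nat).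
Local Notation spaces := ('I_n -> vectType K).
Local Notation functor := (mfunctor K n).

Definition natural (F G : functor) (phi : forall V : spaces, 'Hom(F V, G V)) :=
  forall (V W : spaces) (f : forall i, 'Hom(V i, W i)) (x : F V),
    phi W (fmap F f x) = fmap G f (phi V x).

Definition nat_iso (F G : functor) : Prop :=
  exists phi : forall V : spaces, 'Hom(F V, G V),
    natural phi /\ forall V, bijective (phi V).

Definition nat_embed (F G : functor) : Prop :=
  exists phi : forall V : spaces, 'Hom(F V, G V),
    natural phi /\ forall V, injective (phi V).

Definition ProjF (j : 'I_n) : functor :=
  @MFunctor K n (fun V => V j) (fun V W f => f j)
    (fun V => erefl) (fun V W Z g f => erefl).

Section Zero.
Let zobj (V : spaces) : vectType K := 'rV[K]_0.
Lemma zero_uniq (x y : 'rV[K]_0) : x = y.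
Proof. by rewrite [x]thinmx0 [y]thinmx0. Qed.
Definition ZeroF : functor.
Proof.
refine (@MFunctor K n zobj (fun V W f => 0) _ _) => *;
  by apply/lfunP => x; apply: zero_uniq.
Defined.
End Zero.

Definition DSumF (F G : functor) : functor.
Proof.
refine (@MFunctor K n (fun V => (F V * G V)%type : vectType K)
  (fun V W f => pair_lfun (fmap F f) (fmap G f)) _ _).
- move=> V; apply/lfunP => -[x y].
  by rewrite pair_lfunE !fmap_id !id_lfunE.
move=> V W Z g f; apply/lfunP => -[x y].
by rewrite comp_lfunE !pair_lfunE !fmap_comp !comp_lfunE.
Defined.

Definition TensF (I : finType) (F : I -> functor) : functor.
Proof.
refine (@MFunctor K n (fun V => tens (fun i => F i V))
  (fun V W f => tmap (fun i => fmap (F i) f)) _ _).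
- move=> V; rewrite -tmap_id; congr tmap.
  by apply: functional_extensionality_dep => i; apply: fmap_id.
move=> V W Z g f; rewrite -tmap_comp; congr tmap.
by apply: functional_extensionality_dep => i; apply: fmap_comp.
Defined.

Definition Tens2F (F G : functor) : functor.
Proof.
refine (@MFunctor K n (fun V => tens2 (F V) (G V))
  (fun V W f => tmap2 (fmap F f) (fmap G f)) _ _).
- by move=> V; rewrite !fmap_id tmap2_id.
by move=> V W Z g f; rewrite !fmap_comp tmap2_comp.
Defined.

Definition TPowF (r : nat) (F : functor) : functor := TensF (fun _ : 'I_r => F).

Definition sub_stable (F : functor) (U : forall V : spaces, {vspace F V}) :=
  forall (V W : spaces) (f : forall i, 'Hom(V i, W i)) (x : F V),
    x \in U V -> fmap F f x \in U W.

(* The subfunctor V |-> U V of F. *)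
Definition SubF (F : functor) (U : forall V : spaces, {vspace F V})
  (stU : sub_stable U) : functor.
Proof.
refine (@MFunctor K n (fun V => subvs_of (U V))
  (fun V W f => (linfun (vsproj (U W)) \o fmap F f \o linfun vsval)%VF) _ _).
- move=> V; apply/lfunP => x.
  by rewrite !comp_lfunE !lfunE /= fmap_id id_lfunE vsvalK.
move=> V W Z g f; apply/lfunP => x; rewrite !comp_lfunE !lfunE /= fmap_comp.
by rewrite comp_lfunE vsprojK // stU // subvsP.
Defined.

Lemma SubF_val F U (stU : @sub_stable F U) (V W : spaces)
    (f : forall i, 'Hom(V i, W i)) (x : SubF stU V) :
  vsval (fmap (SubF stU) f x) = fmap F f (vsval x).
Proof. by rewrite /= !comp_lfunE !lfunE /= vsprojK // stU // subvsP. Qed.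

(* The subquotient V |-> Z V / B V of F. The quotient is realized on the
   complement Z V :\: B V of B V in Z V: the class of z is its component
   [addv_pi1 (Z V) (B V) z] along B V. *)
Definition quo_class (A : vectType K) (Z B : {vspace A}) :
    'Hom(A, subvs_of (Z :\: B)%VS) :=
  (linfun (vsproj (Z :\: B)%VS) \o addv_pi1 Z B)%VF.

Lemma quo_classB (A : vectType K) (Z B : {vspace A}) b :
  b \in B -> quo_class Z B b = 0.
Proof.
move=> Bb; rewrite comp_lfunE lfunE /=.
have : addv_pi1 Z B b + addv_pi2 Z B b = b.
  by apply: addv_pi1_pi2; rewrite -[b]add0r memv_add ?mem0v.
rewrite addv_pi2_id // => /(canRL (addrK _)); rewrite subrr => ->.
by rewrite linear0.
Qed.

Lemma quo_class_rep (A : vectType K) (Z B : {vspace A}) z :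
  z \in Z -> z - vsval (quo_class Z B z) \in B.
Proof.
move=> Zz; rewrite comp_lfunE lfunE /= vsprojK; last exact: memv_pi.
have e : addv_pi1 Z B z + addv_pi2 Z B z = z.
  by apply: addv_pi1_pi2; rewrite -[z]addr0 memv_add ?mem0v.
by rewrite -[X in X - _]e addrAC subrr add0r; apply: memv_pi.
Qed.

Definition QuoF (F : functor) (Z B : forall V : spaces, {vspace F V})
  (stZ : sub_stable Z) (stB : sub_stable B) : functor.
Proof.
refine (@MFunctor K n (fun V => subvs_of (Z V :\: B V)%VS)
  (fun V W f => (quo_class (Z W) (B W) \o fmap F f \o linfun vsval)%VF) _ _).
- move=> V; apply/lfunP => x.
  rewrite !comp_lfunE [linfun vsval x]lfunE /= fmap_id !id_lfunE lfunE /=.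
  by rewrite daddv_pi_id ?capv_diff ?subvsP // vsvalK.
move=> V W Y g f; apply/lfunP => x.
have mapE (V' W' : spaces) (h : forall i, 'Hom(V' i, W' i)) y :
    (quo_class (Z W') (B W') \o fmap F h \o linfun vsval)%VF y =
    quo_class (Z W') (B W') (fmap F h (vsval (y : subvs_of (Z V' :\: B V')%VS))).
  rewrite comp_lfunE [linfun _ _]lfunE /=.
  exact: comp_lfunE.
rewrite [RHS]comp_lfunE !mapE fmap_comp comp_lfunE.
have Zx : vsval x \in Z V by apply: subvP (subvsP x); apply: diffvSl.
have := quo_class_rep (B W) (stZ _ _ f _ Zx).
move/(stB _ _ g)/(quo_classB (Z Y)).
by rewrite !linearB /= => /eqP; rewrite subr_eq0 => /eqP ->.
Defined.

Lemma symt_stable d (F : functor) :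
  @sub_stable (TPowF d F) (fun V => limg (symt d (F V))).
Proof.
move=> V W f x /memv_imgP [y _ ->].
by rewrite [fmap _ _ _]tpow_map_symt memv_img ?memvf.
Qed.
Lemma asymt_stable p (F : functor) :
  @sub_stable (TPowF p F) (fun V => limg (asymt p (F V))).
Proof.
move=> V W f x /memv_imgP [y _ ->].
by rewrite [fmap _ _ _]tpow_map_asymt memv_img ?memvf.
Qed.
Lemma youngt_stable r sh (F : functor) :
  @sub_stable (TPowF r F) (fun V => limg (youngt r (F V) sh)).
Proof.
move=> V W f x /memv_imgP [y _ ->].
by rewrite [fmap _ _ _]tpow_map_youngt memv_img ?memvf.
Qed.

Definition SymF d (F : functor) : functor := SubF (@symt_stable d F).
Definition ExtF p (F : functor) : functor := SubF (@asymt_stable p F).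

Lemma Sym_val d (F : functor) (V W : spaces) (f : forall i, 'Hom(V i, W i))
    (x : SymF d F V) :
  vsval (fmap (SymF d F) f x) = tpow_map d (fmap F f) (vsval x).
Proof. have H := @SubF_val (TPowF d F) _ (@symt_stable d F) V W f x; exact H. Qed.
Lemma Ext_val p (F : functor) (V W : spaces) (f : forall i, 'Hom(V i, W i))
    (x : ExtF p F V) :
  vsval (fmap (ExtF p F) f x) = tpow_map p (fmap F f) (vsval x).
Proof. have H := @SubF_val (TPowF p F) _ (@asymt_stable p F) V W f x; exact H. Qed.

(* S_sh F for a partition sh of r, possibly padded with zeros. *)
Definition SchurF r (sh : seq nat) (F : functor) : functor :=
  SubF (@youngt_stable r sh F).

(* S_(sh[m]) F for a partition sh of r, where sh[m] = (m - r, sh_1, sh_2, ...);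
   it is zero when m - r < sh_1. *)
Definition SchurPadF r (sh : seq nat) (m : int) (F : functor) : functor :=
  if (head 0%N sh)%:Z <= m - r%:Z then SchurF `|m| (`|m - r%:Z|%N :: sh) F
  else ZeroF.

(* Sym^d F for d in int, zero for d < 0; this is H^0(P F, O(d)), also when F V
   has dimension at most 1, so that it is functorial. *)
Definition ZSymF (d : int) (F : functor) : functor :=
  match d with Posz k => SymF k F | Negz _ => ZeroF end.

Definition zmul (d : int) (F : functor) (V : spaces) :
    F V -> ZSymF d F V -> ZSymF (1 + d) F V :=
  match d return F V -> ZSymF d F V -> ZSymF (1 + d) F V with
  | Posz k => fun v f => smul v f
  | Negz _ => fun _ _ => 0
  end.

Lemma zmul_linearl d (F : functor) V (f : ZSymF d F V) : linear (fun v : F V => zmul v f).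
Proof.
case: d f => k f; first exact: smul_linearl.
by move=> c u v; rewrite /= scaler0 addr0.
Qed.
Lemma zmul_linearr d (F : functor) V (v : F V) : linear (@zmul d F V v).
Proof.
case: d => k; first exact: smul_linearr.
by move=> c f g; rewrite /= scaler0 addr0.
Qed.
Lemma zmul_natural d (F : functor) (V W : spaces) (f : forall i, 'Hom(V i, W i))
    (v : F V) (t : ZSymF d F V) :
  fmap (ZSymF (1 + d) F) f (zmul v t) = zmul (fmap F f v) (fmap (ZSymF d F) f t).
Proof.
case: d t => k t; last by rewrite /= linear0.
apply: val_inj; rewrite [LHS]SubF_val [RHS]smul_val smul_val linearZ /=.
congr (_ *: _).
transitivity (symt _ _ (tpow_map _ (fmap F f) (tcons v (vsval t)))).
  exact: tpow_map_symt.
rewrite tpow_map_tcons; congr (symt _ _ (tcons _ _)).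
by symmetry; apply: Sym_val.
Qed.

(* X = P V_0 x ... x P V_(n-1), L = O(1, ..., 1), W = H^0(X, L) = ⊗ V_i
   (TensV), and
   H^0(X, O(d_0, ..., d_(n-1))) = ⊗ Sym^(d_i) V_i. *)
Definition TensV : functor := TensF ProjF.
Definition H0 (d : 'I_n -> int) : functor := TensF (fun i => ZSymF (d i) (ProjF i)).

(* O(d) ⊗ L = O(twist d) *)
Definition twist (d : 'I_n -> int) : 'I_n -> int := fun i => 1 + d i.

Definition H0_mul (d : 'I_n -> int) (V : spaces) :
    TensV V -> H0 d V -> H0 (twist d) V :=
  tens_mul (fun i => @zmul (d i) (ProjF i) V).

(* The term Λ^p W ⊗ H^0(X, O(d)) of a Koszul complex, and its differential to
   Λ^(p-1) W ⊗ H^0(X, O(d) ⊗ L), for p replaced by p.+1. *)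
Definition KTerm (p : nat) (d : 'I_n -> int) : functor := Tens2F (ExtF p TensV) (H0 d).

Definition Kdiff (p : nat) (d : 'I_n -> int) (V : spaces) :
    'Hom(KTerm p.+1 d V, KTerm p (twist d) V) :=
  kdiff p (@H0_mul d V).

Lemma Kdiff_natural p d : natural (Kdiff p d).
Proof.
move=> V U f x; apply: (kdiff_natural (f := fmap TensV f)) => [a|b|m|y|y|a m].
- exact: tens_mul_linearr.
- exact: tens_mul_linearr.
- exact: tens_mul_linearl.
- exact: Ext_val.
- exact: Ext_val.
apply: tens_mul_natural => *; try exact: zmul_linearl; try exact: zmul_linearr.
exact: zmul_natural.
Qed.

(* Λ^(-1) W = 0, so everything is a cycle for p = 0. *)
Definition Kcycles (p : nat) (d : 'I_n -> int) (V : spaces) : {vspace KTerm p d V} :=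
  match p with
  | 0 => fullv
  | p'.+1 => lker (Kdiff p' d V)
  end.
Definition Kboundaries (p : nat) (d : 'I_n -> int) (V : spaces) :
  {vspace KTerm p (twist d) V} := limg (Kdiff p d V).

Lemma Kcycles_stable p d : sub_stable (Kcycles p d).
Proof.
case: p => [|p] V U f x; first by rewrite !memvf.
by rewrite !memv_ker Kdiff_natural => /eqP ->; rewrite linear0.
Qed.
Lemma Kboundaries_stable p d : sub_stable (Kboundaries p d).
Proof.
move=> V U f x /memv_imgP [y _ ->].
by rewrite -Kdiff_natural memv_img ?memvf.
Qed.

(* K_(p,q)(X, O(b); L). The middle term of the Koszul complex, whose H^0 factor
   is that of O(b) ⊗ L^q, is written as the twist by L of O(b) ⊗ L^(q-1). *)
Definition Koszul (p : nat) (q : int) (b : 'I_n -> int) : functor :=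
  let e i := b i + (q - 1) in
  QuoF (@Kcycles_stable p (twist e)) (@Kboundaries_stable p e).

Definition copies (m : nat) (F : functor) : functor := iter m (DSumF F) ZeroF.

Definition big_dsum (I : finType) (F : I -> functor) : functor :=
  \big[DSumF/ZeroF]_(i : I) F i.

Definition is_multiplicity (S F : functor) (m : nat) : Prop :=
  nat_embed (copies m S) F /\ ~ nat_embed (copies m.+1 S) F.
(* The multiplicity of a simple functor S in a semisimple functor F: the largest
   m such that m copies of S embed in F (0 if there is none). *)
Definition multiplicity (S F : functor) : nat := xget 0%N [set m | is_multiplicity S F m]%classic.

(* Every subspace of F V stable under GL(V_0) x ... x GL(V_(n-1)) is trivial,
   i.e., F V is irreducible or zero. *)
Definition gl_irreducible (F : functor) (V : spaces) : Prop :=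
  forall U : {vspace F V},
    (forall g : forall i, 'End(V i), (forall i, bijective (g i)) ->
       (fmap F g @: U <= U)%VS) ->
  U = 0%VS \/ U = fullv.

End Functors.

(* Partitions of r, as weakly decreasing r-tuples padded with zeros. *)
Definition is_intpart r (t : r.-tuple 'I_r.+1) : bool :=
  let s := [seq val i | i <- t] in sorted geq s && (sumn s == r).
Definition intpart (r : nat) : finType := {t : r.-tuple 'I_r.+1 | is_intpart t}.
Definition parts r (t : intpart r) : seq nat := [seq val i | i <- val t].

(* Main.v *)
(* As H^0(X, O(b)) = 0 as soon as some b_i < 0, no boundary reaches the complex at
   q = 0 (this uses n >= 2), so K_(p,0) is the kernel of the outgoing differential.
   Inside V_1^⊗(a+p) ⊗ V_2^⊗p ⊗ ... ⊗ V_n^⊗p this kernel consists of the tensors that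
   are antisymmetric under the diagonal S_p, symmetric in the first a factors V_1, and
   killed by the multiplication of any further factor V_1 into Sym^a V_1.

   In the group algebra of S_(a+p), with c_la the Young symmetrizer of a partition la
   of p, the last two conditions force T c_la = 0 if la_1 > a, and make T c_la
   isomorphic to T c_(a,la) otherwise: among the constituents of Sym^a ⊗ S_la given by
   Pieri's rule, only S_(a,la) is killed by these multiplications.

   The antisymmetric tensors are the image of the sign idempotent e of the diagonal S_p
   in the group algebra A of S_p^n. Splitting e along the symmetrizers
   c_lam = c_(lam^1) ⊗ ... ⊗ c_(lam^n) gives dim (c_lam A e) summands for each lam, and
   this dimension is the multiplicity m_lam, since the natural endomorphisms of a tensor
   product of tensor powers are the elements of the group algebra. *)

Require Import Defs.
From HB Require Import structures.
From mathcomp Require Import all_boot all_order all_algebra fingroup perm gproduct.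
From mathcomp Require Import zify ring boolp.
From mathcomp Require classical_sets.

Set Implicit Arguments.
Unset Strict Implicit.
Unset Printing Implicit Defensive.

Import Order.TTheory GRing.Theory Num.Theory.
Local Open Scope ring_scope.

(** * Group algebras *)

(** Pieri's rule takes the form of a vanishing: for x in the kernel, c_mu x c_la is zero unless mu =
    (a,la). Column antisymmetry for mu against row symmetry for (a,la) shows that mu dominates
    (a,la). If the first row of mu has more than a boxes, the relations end in one that sums a+1
    equal coefficients to zero. If it has exactly a, the element is determined by its coefficients
    on S_p, and row symmetry against column antisymmetry there gives the reverse inequality. The
    surviving line is spanned by an explicit element, and right multiplication by it exchanges the
    two functors.

    Young symmetrizers stay unnormalized: c c = kappa c, where kappa is the product of the hook
    lengths. It is nonzero because an element of square zero has coefficient 0 at the identity.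
    Completeness of the family comes from counting conjugacy classes.

    The group algebra acts on the right. Matrix coefficients thus turn conditions on tensors into
    right conditions on group algebra elements, stable under left multiplication, and the Koszul
    differential becomes a sum of transpositions. *)

Definition galg (K : fieldType) (gT : finGroupType) := {ffun gT -> K^o}.
HB.instance Definition _ (K : fieldType) (gT : finGroupType) :=
  Vector.copy (galg K gT) {ffun gT -> K^o}.

Section GroupAlgebra.
Variables (K : fieldType) (gT : finGroupType).
Local Notation A := (galg K gT).
Implicit Types (x y z : A) (g h : gT).

Definition gdelta g : A := [ffun h => (h == g)%:R].
Definition gmul x y : A := [ffun g => \sum_h x h * y (h^-1 * g)%g].

Lemma galg_sum x : x = \sum_g x g *: gdelta g.
Proof.
apply/ffunP => h; rewrite sum_ffunE (bigD1 h) //= big1 => [|g neq].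
  by rewrite !ffunE eqxx addr0 /GRing.scale /= mulr1.
by rewrite !ffunE eq_sym (negPf neq) scaler0.
Qed.

Lemma gmulA : associative gmul.
Proof.
move=> x y z; apply/ffunP => g; rewrite !ffunE.
under eq_bigr => h _ do rewrite ffunE mulr_sumr.
under [RHS]eq_bigr => h _ do rewrite ffunE mulr_suml.
rewrite [RHS]exchange_big; apply: eq_bigr => h _ /=.
rewrite [RHS](reindex_inj (mulgI h)) /=; apply: eq_bigr => k _.
by rewrite mulKg invMg mulgA mulrA.
Qed.

Lemma gmul1 : left_id (gdelta 1) gmul.
Proof.
move=> x; apply/ffunP => g; rewrite ffunE (bigD1 1%g) //= big1 => [|h neq].
  by rewrite ffunE eqxx mul1r invg1 mul1g addr0.
by rewrite ffunE (negPf neq) mul0r.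
Qed.

Lemma gmulr1 : right_id (gdelta 1) gmul.
Proof.
move=> x; apply/ffunP => g; rewrite ffunE (bigD1 g) //= big1 => [|h neq].
  by rewrite ffunE mulVg eqxx mulr1 addr0.
by rewrite ffunE -eq_mulVg1 (negPf neq) mulr0.
Qed.

Lemma gmulDl : left_distributive gmul +%R.
Proof.
move=> x y z; apply/ffunP => g; rewrite !ffunE -big_split /=.
by apply: eq_bigr => h _; rewrite ffunE mulrDl.
Qed.

Lemma gmulDr : right_distributive gmul +%R.
Proof.
move=> x y z; apply/ffunP => g; rewrite !ffunE -big_split /=.
by apply: eq_bigr => h _; rewrite ffunE mulrDr.
Qed.

Lemma gdelta1_neq0 : gdelta 1 != 0.
Proof. by apply/eqP => /ffunP /(_ 1%g) /eqP; rewrite !ffunE eqxx oner_eq0. Qed.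

HB.instance Definition _ :=
  GRing.Zmodule_isNzRing.Build A gmulA gmul1 gmulr1 gmulDl gmulDr gdelta1_neq0.

Lemma gscaleAl (k : K) x y : k *: (x * y) = (k *: x) * y.
Proof.
apply/ffunP => g; rewrite !ffunE scaler_sumr; apply: eq_bigr => h _.
by rewrite ffunE scalerAl.
Qed.
HB.instance Definition _ := GRing.Lmodule_isLalgebra.Build K A gscaleAl.
Lemma gscaleAr (k : K) x y : k *: (x * y) = x * (k *: y).
Proof.
apply/ffunP => g; rewrite !ffunE scaler_sumr; apply: eq_bigr => h _.
by rewrite ffunE scalerAr.
Qed.
HB.instance Definition _ := GRing.Lalgebra_isAlgebra.Build K A gscaleAr.

Lemma galg1E : 1 = gdelta 1. Proof. by []. Qed.
Lemma gmulE x y g : (x * y) g = \sum_h x h * y (h^-1 * g)%g.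
Proof. by rewrite ffunE. Qed.

Lemma gdelta_mulE h x g : (gdelta h * x) g = x (h^-1 * g)%g.
Proof.
rewrite gmulE (bigD1 h) //= big1 => [|k neq]; last first.
  by rewrite ffunE (negPf neq) mul0r.
by rewrite ffunE eqxx mul1r addr0.
Qed.

Lemma gmul_deltaE h x g : (x * gdelta h) g = x (g * h^-1)%g.
Proof.
rewrite gmulE (bigD1 (g * h^-1)%g) //= big1 => [|k neq]; last first.
  rewrite ffunE; case: eqP => [e|_]; last by rewrite mulr0.
  by rewrite -e invMg invgK mulKVg eqxx in neq.
by rewrite ffunE invMg invgK mulgKV eqxx mulr1 addr0.
Qed.

Lemma gdeltaM g h : gdelta g * gdelta h = gdelta (g * h).
Proof.
apply/ffunP => k; rewrite gdelta_mulE !ffunE; congr (_%:R : K).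
by rewrite (can2_eq (mulKVg g) (mulKg g)).
Qed.

End GroupAlgebra.

(** * Young symmetrizers *)

Section Boxes.
Local Open Scope nat_scope.
Variable r : nat.
Implicit Types (sh : seq nat) (i : 'I_r).

Definition trow sh i := reshape_index sh i.
Definition tcol sh i := reshape_offset sh i.

(* The number of boxes in the columns of index at least c (truncated subtraction). *)
Definition boxes_from sh c := \sum_(x <- sh) (x - c).

Lemma box_inj sh i j : trow sh i = trow sh j -> tcol sh i = tcol sh j -> i = j.
Proof.
move=> er ec; apply: ord_inj.
rewrite -[LHS](reshape_indexK sh) -[RHS](reshape_indexK sh).
by rewrite -/(trow sh i) er -/(tcol sh i) ec.
Qed.

Variable sh : seq nat.
Hypothesis shr : sumn sh = r.

Lemma trow_lt i : trow sh i < size sh.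
Proof. by apply: reshape_indexP; rewrite shr. Qed.

Lemma tcol_lt i : tcol sh i < nth 0 sh (trow sh i).
Proof. by apply: reshape_offsetP; rewrite shr. Qed.

Lemma box_ex k c : k < size sh -> c < nth 0 sh k ->
  exists2 i, trow sh i = k & tcol sh i = c.
Proof.
move=> ks cs; have lt : flatten_index sh k c < r by rewrite -shr flatten_indexP.
exists (Ordinal lt); first exact: flatten_indexKl.
exact: flatten_indexKr.
Qed.

Lemma trow_cols k : k < size sh ->
  perm_eq [seq tcol sh i | i <- enum [pred i | trow sh i == k]] (iota 0 (nth 0 sh k)).
Proof.
move=> ks; apply: uniq_perm; rewrite ?iota_uniq //.
  rewrite map_inj_in_uniq ?enum_uniq // => i j.
  rewrite !mem_enum !inE => /eqP ei /eqP ej; apply: box_inj; by rewrite ei ej.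
move=> c; rewrite mem_iota /= add0n; apply/mapP/idP => [[i]|cs].
  by rewrite mem_enum inE => /eqP <- ->; apply: tcol_lt.
by have [i ei ec] := box_ex ks cs; exists i; rewrite ?mem_enum ?inE ?ei.
Qed.

Lemma count_ge_iota c n : count (leq c) (iota 0 n) = n - c.
Proof.
elim: n => // n IHn; rewrite -[n.+1]addn1 iotaD count_cat IHn /= add0n addn0.
by case: leqP => h /=; lia.
Qed.

Lemma card_row_from k c : k < size sh ->
  #|[pred i | (trow sh i == k) && (c <= tcol sh i)]| = nth 0 sh k - c.
Proof.
move=> ks; rewrite -(count_ge_iota c) -(seq.permP (trow_cols ks)) count_map -size_filter.
rewrite cardE /enum_mem -filter_predI; congr size; apply: eq_filter => i.
by rewrite /= !inE andbC.
Qed.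

(** [f] takes distinct values on a row, so at most [c] of them lie below [c]. *)
Lemma card_row_ge k c (f : 'I_r -> nat) : k < size sh ->
    (forall i j, trow sh i = trow sh j -> f i = f j -> i = j) ->
  nth 0 sh k - c <= #|[pred i | (trow sh i == k) && (c <= f i)]|.
Proof.
move=> ks fI; set s := [seq f i | i <- enum [pred i | trow sh i == k]].
have us : uniq s.
  rewrite map_inj_in_uniq ?enum_uniq // => i j.
  rewrite !mem_enum !inE => /eqP ei /eqP ej; apply: fI; by rewrite ei ej.
have -> : #|[pred i | (trow sh i == k) && (c <= f i)]| = count (leq c) s.
  rewrite count_map -size_filter cardE /enum_mem -filter_predI; congr size.
  by apply: eq_filter => i; rewrite /= !inE andbC.
have <- : size s = nth 0 sh k.
  rewrite -[RHS](size_iota 0) -(perm_size (trow_cols ks)) !size_map //.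
have lec : size [seq x <- s | x < c] <= c.
  rewrite -[X in _ <= X](size_iota 0); apply: uniq_leq_size => [|x].
    exact: filter_uniq.
  by rewrite mem_filter mem_iota => /andP [].
rewrite -(count_predC (leq c)) leq_subLR addnC leq_add2r -size_filter.
apply: leq_trans lec; apply: eq_leq; congr size; apply: eq_filter => x /=.
by rewrite -ltnNge.
Qed.

Lemma sum_rows (P : pred 'I_r) :
  #|P| = \sum_(k < size sh) #|[pred i | (trow sh i == k) && P i]|.
Proof.
rewrite -sum1_card (partition_big (fun i => Ordinal (trow_lt i)) predT) //=.
apply: eq_bigr => k _; rewrite -sum1_card; apply: eq_bigl => i.
by rewrite !inE andbC.
Qed.

Lemma boxes_fromE c : boxes_from sh c = #|[pred i | c <= tcol sh i]|.
Proof.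
rewrite /boxes_from (big_nth 0) big_mkord sum_rows; apply: eq_bigr => k _.
by rewrite -card_row_from.
Qed.

End Boxes.

(** * Dominance from permutations without a row-column collision *)

Section Unobstructed.
Local Open Scope nat_scope.
Variables (r : nat) (la mu : seq nat) (g : 'S_r).
Hypotheses (lar : sumn la = r) (mur : sumn mu = r).
Hypothesis gI : forall i j,
  trow la i = trow la j -> tcol mu (g i) = tcol mu (g j) -> i = j.

Lemma card_tcol_perm c :
  #|[pred i : 'I_r | c <= tcol mu (g i)]| = boxes_from mu c.
Proof.
rewrite (boxes_fromE mur) -!sum1_card [RHS](reindex_inj (@perm_inj _ g)) /=.
by apply: eq_bigl => i; rewrite !inE.
Qed.

(** Summing the row estimate over the rows of [la] counts all boxes of [mu] in the columns from [c]
    on. For partitions these inequalities, taken for all [c], say that [mu] dominates [la]. *)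
Lemma unobstructed_dom c : boxes_from la c <= boxes_from mu c.
Proof.
rewrite -card_tcol_perm (sum_rows lar) /boxes_from (big_nth 0) big_mkord.
by apply: leq_sum => k _; apply: card_row_ge.
Qed.

(** Equal totals force equality in every row. If [g i] sat in a column [c] beyond the end of the row
    of [i], that row would contribute nothing to the count for [la], but at least [i] to the count
    for [mu]. *)
Lemma unobstructed_tcol :
    (forall c, boxes_from la c = boxes_from mu c) ->
  forall i, tcol mu (g i) < nth 0 la (trow la i).
Proof.
move=> eqD i; rewrite ltnNge; apply/negP => le.
set c := tcol mu (g i) in le; pose k0 := Ordinal (trow_lt lar i).
have := eqD c; rewrite -card_tcol_perm (sum_rows lar) /boxes_from (big_nth 0).
rewrite big_mkord (bigD1 k0) //= [X in _ = X -> _](bigD1 k0) //=.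
move: le; rewrite -subn_eq0 => /eqP -> /eqP; rewrite add0n; apply/negP.
rewrite neq_ltn; apply/orP; left; rewrite -[X in X < _]add0n -addSn leq_add //.
  by apply/card_gt0P; exists i; rewrite !inE eqxx leqnn.
by apply: leq_sum => k _; apply: card_row_ge.
Qed.

End Unobstructed.

(** Each [i] moves along its row to the column of [g i]; this is injective because [g] has no
    collision, and the remaining factor preserves columns. Products of permutations apply the left
    factor first, so the row permutation stands on the left. *)
Lemma unobstructed_factor r (sh : seq nat) (g : 'S_r) : sumn sh = r ->
    (forall i j, trow sh i = trow sh j -> tcol sh (g i) = tcol sh (g j) -> i = j) ->
  exists s t, [/\ rowstab sh s, colstab sh t & g = (s * t)%g].
Proof.
move=> shr gI.
have box i : {k : 'I_r | (trow sh k == trow sh i) && (tcol sh k == tcol sh (g i))}.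
  apply: sigW; have [||k er ec] := @box_ex r sh shr (trow sh i) (tcol sh (g i)).
  - exact: trow_lt.
  - exact: (unobstructed_tcol shr shr).
  by exists k; rewrite er ec !eqxx.
pose f i := sval (box i).
have fr i : trow sh (f i) = trow sh i by rewrite /f; case: (box i) => k /= /andP [/eqP].
have fc i : tcol sh (f i) = tcol sh (g i).
  by rewrite /f; case: (box i) => k /= /andP [_ /eqP].
have fI : injective f.
  by move=> i j e; apply: gI; [rewrite -(fr i) e fr | rewrite -(fc i) e fc].
exists (perm fI), ((perm fI)^-1 * g)%g; split; last by rewrite mulKVg.
  by apply/forallP => i; rewrite permE -/(trow _ _) fr.
apply/forallP => k; rewrite permM -!/(tcol _ _) -fc; apply/eqP.
by rewrite -(permE fI) permKV.
Qed.

(** * Row and column symmetrizers in the group algebra *)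

Section Young.
Variables (K : fieldType) (charK : [pchar K] =i pred0) (r : nat).
Local Notation A := (galg K 'S_r).
Implicit Types (sh la mu : seq nat) (g s t : 'S_r) (x y z : A).

Lemma natK_eq0 n : (n%:R == 0 :> K) = (n == 0%N).
Proof. by rewrite (pcharf0P _).1. Qed.

Lemma eq_oppK (V : lmodType K) (v : V) : v = - v -> v = 0.
Proof.
move/eqP; rewrite -addr_eq0 -mulr2n -scaler_nat scaler_eq0 natK_eq0 /=.
by move/eqP.
Qed.

Definition yrow sh : A := \sum_(s | rowstab sh s) gdelta K s.
Definition ycol sh : A := \sum_(t | colstab sh t) (-1) ^+ t *: gdelta K t.
Definition young sh : A := yrow sh * ycol sh.

Lemma rowstabP sh s : reflect (forall i, trow sh (s i) = trow sh i) (rowstab sh s).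
Proof. exact: 'forall_eqP. Qed.
Lemma colstabP sh s : reflect (forall i, tcol sh (s i) = tcol sh i) (colstab sh s).
Proof. exact: 'forall_eqP. Qed.

Lemma rowstabM sh s t : rowstab sh s -> rowstab sh (s * t)%g = rowstab sh t.
Proof.
move/rowstabP => hs; apply/rowstabP/rowstabP => h i.
  by have := h ((s^-1)%g i); rewrite permM permKV => ->; rewrite -hs permKV.
by rewrite permM h hs.
Qed.
Lemma colstabM sh s t : colstab sh s -> colstab sh (s * t)%g = colstab sh t.
Proof.
move/colstabP => hs; apply/colstabP/colstabP => h i.
  by have := h ((s^-1)%g i); rewrite permM permKV => ->; rewrite -hs permKV.
by rewrite permM h hs.
Qed.
Lemma rowstab1 sh : rowstab sh (1%g : 'S_r).
Proof. by apply/rowstabP => i; rewrite perm1. Qed.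
Lemma colstab1 sh : colstab sh (1%g : 'S_r).
Proof. by apply/colstabP => i; rewrite perm1. Qed.
Lemma rowstabMr sh s t : rowstab sh s -> rowstab sh (t * s)%g = rowstab sh t.
Proof.
move/rowstabP => hs; apply/rowstabP/rowstabP => h i.
  by rewrite -hs -permM h.
by rewrite permM hs h.
Qed.
Lemma colstabMr sh s t : colstab sh s -> colstab sh (t * s)%g = colstab sh t.
Proof.
move/colstabP => hs; apply/colstabP/colstabP => h i.
  by rewrite -hs -permM h.
by rewrite permM hs h.
Qed.

Lemma rowstab_tperm sh i j : trow sh i = trow sh j -> rowstab sh (tperm i j : 'S_r).
Proof. by move=> e; apply/rowstabP => k; case: tpermP => // ->. Qed.
Lemma colstab_tperm sh i j : tcol sh i = tcol sh j -> colstab sh (tperm i j : 'S_r).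
Proof. by move=> e; apply/colstabP => k; case: tpermP => // ->. Qed.

Lemma rowstab_yrow sh s : rowstab sh s -> gdelta K s * yrow sh = yrow sh.
Proof.
move=> hs; rewrite /yrow mulr_sumr [RHS](reindex_inj (mulgI s)) /=.
by apply: eq_big => [t|t _]; rewrite ?gdeltaM ?rowstabM.
Qed.
Lemma yrow_rowstab sh s : rowstab sh s -> yrow sh * gdelta K s = yrow sh.
Proof.
move=> hs; rewrite /yrow mulr_suml [RHS](reindex_inj (mulIg s)) /=.
by apply: eq_big => [t|t _]; rewrite ?gdeltaM ?rowstabMr.
Qed.
Lemma colstab_ycol sh s : colstab sh s -> gdelta K s * ycol sh = (-1) ^+ s *: ycol sh.
Proof.
move=> hs; rewrite /ycol mulr_sumr scaler_sumr [RHS](reindex_inj (mulgI s)) /=.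
apply: eq_big => [t|t _]; rewrite ?colstabM // -scalerAr gdeltaM scalerA.
by rewrite odd_permM signr_addb mulrA -expr2 sqrr_sign mul1r.
Qed.
Lemma ycol_colstab sh s : colstab sh s -> ycol sh * gdelta K s = (-1) ^+ s *: ycol sh.
Proof.
move=> hs; rewrite /ycol mulr_suml scaler_sumr [RHS](reindex_inj (mulIg s)) /=.
apply: eq_big => [t|t _]; rewrite ?colstabMr // -scalerAl gdeltaM scalerA.
by rewrite odd_permM signr_addb mulrC -mulrA -expr2 sqrr_sign mulr1.
Qed.

Definition nrow sh : K := #|[pred s : 'S_r | rowstab sh s]|%:R.
Definition ncol sh : K := #|[pred s : 'S_r | colstab sh s]|%:R.

Lemma nrow_neq0 sh : nrow sh != 0.
Proof.
rewrite natK_eq0 -lt0n; apply/card_gt0P; exists 1%g; exact: rowstab1.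
Qed.
Lemma ncol_neq0 sh : ncol sh != 0.
Proof.
rewrite natK_eq0 -lt0n; apply/card_gt0P; exists 1%g; exact: colstab1.
Qed.

(* A transposition of i and j on the left of g is the transposition of g i and
   g j on its right. *)
Lemma obstruction z g i j :
    gdelta K (tperm i j) * z = z ->
    z * gdelta K (tperm (g i) (g j)) = - z -> z g = 0.
Proof.
move=> hl hr; apply: (@eq_oppK K^o).
rewrite -[in LHS]hl gdelta_mulE tpermV.
have -> : (tperm i j * g)%g = (g * tperm (g i) (g j))%g.
  by rewrite -tpermJ conjgE !mulgA mulgV mul1g.
transitivity ((- z : A) g); last by rewrite ffunE.
by rewrite -hr gmul_deltaE tpermV.
Qed.

Lemma row_col_eq0 la mu z g i j :
    (forall i j, trow la i = trow la j -> gdelta K (tperm i j) * z = z) ->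
    (forall i j, i != j -> tcol mu i = tcol mu j -> z * gdelta K (tperm i j) = - z) ->
  i != j -> trow la i = trow la j -> tcol mu (g i) = tcol mu (g j) -> z g = 0.
Proof.
move=> hl hr ij er ec; apply: (@obstruction _ _ i j); first exact: hl.
by apply: hr; rewrite ?(inj_eq perm_inj).
Qed.

(** A permutation with nonzero coefficient has no collision: two entries of one row of [la] sent to
    one column of [mu] would make the coefficient its own negative. *)
Lemma row_col_dom la mu z : sumn la = r -> sumn mu = r ->
    (forall i j, trow la i = trow la j -> gdelta K (tperm i j) * z = z) ->
    (forall i j, i != j -> tcol mu i = tcol mu j -> z * gdelta K (tperm i j) = - z) ->
  z != 0 -> forall c, (boxes_from la c <= boxes_from mu c)%N.
Proof.
move=> lar mur hl hr nz c; rewrite leqNgt; apply: contra nz => ltD.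
apply/eqP/ffunP => g; rewrite [RHS]ffunE.
have [/existsP [i /existsP [j]]|nex] := boolP [exists i, exists j,
    [&& i != j, trow la i == trow la j & tcol mu (g i) == tcol mu (g j)]].
  by case/and3P => ij /eqP er /eqP ec; apply: (row_col_eq0 hl hr ij er ec).
suff : (boxes_from la c <= boxes_from mu c)%N by rewrite leqNgt ltD.
apply: (@unobstructed_dom r la mu g) => // i j er ec; apply/eqP.
move/existsPn: nex => /(_ i) /existsPn /(_ j).
by rewrite er ec !eqxx !andbT negbK.
Qed.

(** The anti-automorphism that inverts group elements. It exchanges left and right conditions, so
    [col_row_dom] follows from [row_col_dom]. *)
Definition ginv z : A := [ffun g => z (g^-1)%g].
Lemma ginvM x y : ginv (x * y) = ginv y * ginv x.
Proof.
apply/ffunP => g; rewrite [LHS]ffunE !gmulE (reindex_inj (mulgI (g^-1)%g)) /=.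
apply: eq_bigr => h _; rewrite !ffunE !invMg !invgK mulrC.
by rewrite mulgK.
Qed.

Lemma col_row_dom la mu z : sumn la = r -> sumn mu = r ->
    (forall i j, i != j -> tcol la i = tcol la j -> gdelta K (tperm i j) * z = - z) ->
    (forall i j, trow mu i = trow mu j -> z * gdelta K (tperm i j) = z) ->
  z != 0 -> forall c, (boxes_from mu c <= boxes_from la c)%N.
Proof.
move=> lar mur hl hr nz.
have dK i j : ginv (gdelta K (tperm i j)) = gdelta K (tperm i j).
  by apply/ffunP => g; rewrite !ffunE (can2_eq invgK invgK) tpermV.
apply: (@row_col_dom mu la (ginv z)) => // [i j er|i j ij ec|].
- by rewrite -dK -ginvM hr.
- by rewrite -dK -ginvM hl //; apply/ffunP => g; rewrite !ffunE.
apply: contra nz => /eqP/ffunP z0; apply/eqP/ffunP => g.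
by have := z0 (g^-1)%g; rewrite !ffunE invgK.
Qed.

Lemma yrow_ycol_dom la mu x : sumn la = r -> sumn mu = r ->
  yrow la * x * ycol mu != 0 -> forall c, (boxes_from la c <= boxes_from mu c)%N.
Proof.
move=> lar mur; apply: row_col_dom => // [i j er|i j ij ec].
  by rewrite !mulrA rowstab_yrow ?rowstab_tperm.
rewrite -!mulrA ycol_colstab ?colstab_tperm //.
by rewrite odd_tperm ij expr1 scaleN1r !mulrN.
Qed.

Lemma ycol_yrow_dom la mu x : sumn la = r -> sumn mu = r ->
  ycol la * x * yrow mu != 0 -> forall c, (boxes_from mu c <= boxes_from la c)%N.
Proof.
move=> lar mur; apply: col_row_dom => // [i j ij ec|i j er].
  rewrite !mulrA colstab_ycol ?colstab_tperm //.
  by rewrite odd_tperm ij expr1 scaleN1r !mulNr.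
by rewrite -!mulrA yrow_rowstab ?rowstab_tperm.
Qed.

(** Only the identity preserves all rows and all columns, so s t = 1 forces s = t = 1. *)
Lemma young1 sh : sumn sh = r -> young sh 1%g = 1.
Proof.
move=> shr; rewrite /young mulr_suml sum_ffunE (bigD1 1%g) ?rowstab1 //=.
rewrite big1 ?addr0 => [|s /andP [hs s1]].
  rewrite gdelta_mulE mulg1 invg1 sum_ffunE (bigD1 1%g) ?colstab1 //= big1 ?addr0.
    by rewrite !ffunE eqxx odd_perm1 expr0 scale1r.
  by move=> t /andP [_ neq]; rewrite !ffunE eq_sym (negPf neq) scaler0.
rewrite gdelta_mulE mulg1 sum_ffunE big1 // => t ht; rewrite !ffunE.
case: eqP => [e|_]; last by rewrite scaler0.
case/eqP: s1; apply/permP => i; rewrite perm1; apply: (@box_inj r sh).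
  exact/rowstabP.
by have /colstabP /(_ (s i)) := ht; rewrite -e permK.
Qed.

(** Both sides vanish at a permutation with a collision. Any other one is s t with s a row and t a
    column permutation, and there each side is the sign of t times its coefficient at 1. *)
Lemma young_sandwich sh x : sumn sh = r ->
  yrow sh * x * ycol sh = (yrow sh * x * ycol sh) 1%g *: young sh.
Proof.
move=> shr; set z : A := yrow sh * x * ycol sh; apply/ffunP => g.
have e1 : young sh = yrow sh * 1 * ycol sh by rewrite mulr1.
have [/existsP [i /existsP [j]]|nex] := boolP [exists i, exists j,
    [&& i != j, trow sh i == trow sh j & tcol sh (g i) == tcol sh (g j)]].
  case/and3P => ij /eqP er /eqP ec.
  have z0 y : (yrow sh * y * ycol sh) g = 0.
    apply: (row_col_eq0 (la := sh) (mu := sh) _ _ ij er ec) => k l; last first.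
      move=> kl ekl; rewrite -!mulrA ycol_colstab ?colstab_tperm //.
      by rewrite odd_tperm kl expr1 scaleN1r !mulrN.
    by move=> ekl; rewrite !mulrA rowstab_yrow ?rowstab_tperm.
  by rewrite [RHS]ffunE /z z0 [in RHS]e1 z0 scaler0.
have [|s [t [hs ht ->]]] := unobstructed_factor shr (g := g).
  move=> i j er ec; apply/eqP; move/existsPn: nex => /(_ i) /existsPn /(_ j).
  by rewrite er ec !eqxx !andbT negbK.
have inv (y : A) : (yrow sh * y * ycol sh) (s * t)%g =
    (-1) ^+ t * (yrow sh * y * ycol sh) 1%g.
  rewrite -[in LHS](rowstab_yrow hs) -!mulrA gdelta_mulE mulKg !mulrA.
  have -> : (yrow sh * y * ycol sh) t = (yrow sh * y * ycol sh * gdelta K t^-1) 1%g.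
    by rewrite gmul_deltaE invgK mul1g.
  rewrite -mulrA ycol_colstab; last first.
    by rewrite -(colstabM _ ht) mulgV colstab1.
  by rewrite -scalerAr ffunE odd_permV.
rewrite [RHS]ffunE e1 /z !inv -e1 young1 //.
by rewrite mulr1 /GRing.scale /= mulrC.
Qed.
End Young.

(** * Primitive elements and complete families *)

(** In the rank factorization [M] = C R, the vanishing of the square gives R C = 0, and C R and R C
    have the same trace. *)
Lemma mxtrace_sq0 (K : fieldType) n (M : 'M[K]_n) : M *m M = 0 -> \tr M = 0.
Proof.
move=> M2; have := mulmx_base M; set C := col_base M; set R := row_base M => e.
have RC : R *m C = 0.
  apply: (row_full_inj (col_base_full M)); rewrite mulmx0 -/C.
  apply: (row_free_inj (row_base_free M)); rewrite mul0mx -/R.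
  by rewrite mulmxA -mulmxA e.
by rewrite -e mxtrace_mulC RC mxtrace0.
Qed.

Section Primitive.
Variables (K : fieldType) (charK : [pchar K] =i pred0) (gT : finGroupType).
Local Notation A := (galg K gT).
Implicit Types (c x y z : A) (g : gT).

Lemma galg_trace x y : (x * y) 1%g = (y * x) 1%g.
Proof.
rewrite !gmulE [RHS](reindex_inj invg_inj) /=.
by apply: eq_bigr => g _; rewrite !mulg1 invgK mulrC.
Qed.

(** Right multiplication by [x] has trace |G| x(1) and squares to zero; |G| is invertible in
    characteristic zero. *)
Lemma galg_sq0 x : x * x = 0 -> x 1%g = 0.
Proof.
move=> x2; pose N := #|gT|; pose e (i : 'I_N) : gT := enum_val i.
pose M : 'M[K]_N := \matrix_(i, j) x ((e i)^-1 * e j)%g.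
have : \tr M = 0.
  apply: mxtrace_sq0; apply/matrixP => i j; rewrite !mxE.
  under eq_bigr => k _ do rewrite !mxE.
  transitivity ((x * x) ((e i)^-1 * e j)%g); last by rewrite x2 ffunE.
  rewrite gmulE [RHS](reindex_inj (mulgI (e i)^-1%g)) /=.
  rewrite [RHS](reindex e) /=; last first.
    by exists enum_rank => k _; [apply: enum_valK | apply: enum_rankK].
  apply: eq_bigr => k _; congr (_ * x _).
  by rewrite invMg invgK -mulgA mulKVg.
rewrite /mxtrace (eq_bigr (fun=> x 1%g)) => [|i _]; last by rewrite mxE mulVg.
rewrite sumr_const -mulr_natr => /eqP; rewrite mulf_eq0 => /orP [/eqP //|].
rewrite (pcharf0P _).1 // card_ord => /eqP N0.
by have := card0_eq N0 1%g.
Qed.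

(** A primitive idempotent up to the scalar [kappa], with cAc one-dimensional. Normalizing the
    coefficient at 1 instead of the square admits Young symmetrizers as they are. *)
Definition primitive c := c 1%g = 1 /\ forall x, exists k : K, c * x * c = k *: c.
Definition kappa c : K := (c * c) 1%g.

Variable c : A.
Hypothesis cP : primitive c.

Lemma primitive_sq : c * c = kappa c *: c.
Proof.
have [c1 /(_ 1) [k]] := cP; rewrite mulr1 => e.
by rewrite /kappa e ffunE c1 /GRing.scale /= mulr1.
Qed.

Lemma primitive_neq0 : c != 0.
Proof. by apply/eqP => c0; have [/eqP] := cP; rewrite c0 ffunE eq_sym oner_eq0. Qed.

Lemma kappa_neq0 : kappa c != 0.
Proof.
apply/eqP => k0; have /galg_sq0 : c * c = 0 by rewrite primitive_sq k0 scale0r.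
by have [-> _] := cP => /eqP; rewrite oner_eq0.
Qed.

(** The scalar is read off at 1, where cyclicity brings the two factors c together into c c = kappa
    c. *)
Lemma primitive_sandwich x : c * x * c = (kappa c * (x * c) 1%g) *: c.
Proof.
have [c1 /(_ x) [k e]] := cP; rewrite e; congr (_ *: _).
have : (c * x * c) 1%g = k by rewrite e ffunE c1 /GRing.scale /= mulr1.
by rewrite -mulrA galg_trace -mulrA primitive_sq -scalerAr ffunE => <-.
Qed.

Definition gavg x : A := \sum_g gdelta K g * x * gdelta K g^-1.

Lemma gavg_central x y : gavg x * y = y * gavg x.
Proof.
rewrite [y]galg_sum mulr_sumr mulr_suml; apply: eq_bigr => h _.
rewrite -scalerAr -scalerAl; congr (_ *: _).
rewrite /gavg mulr_suml mulr_sumr [LHS](reindex_inj (mulgI h)) /=.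
apply: eq_bigr => g _; rewrite -!mulrA !gdeltaM invMg -mulgA mulVg mulg1.
by rewrite !mulrA gdeltaM.
Qed.

(** Multiplied by [kappa], the left side is the sum of c g c g^-1 c. Two sandwiches turn each term
    into kappa^2 c(g) c(g^-1) c, and the sum of c(g) c(g^-1) is the coefficient of c c at 1, again
    [kappa]. *)
Lemma gavg_mul : gavg c * c = kappa c ^+ 2 *: c.
Proof.
apply: (scalerI kappa_neq0); rewrite scalerAr -primitive_sq mulrA scalerA.
have -> : gavg c * c * c = c * gavg c * c by rewrite gavg_central.
rewrite /gavg mulr_sumr mulr_suml.
pose F g := kappa c ^+ 2 * (c g * c (g^-1)%g).
transitivity (\sum_g F g *: c).
  apply: eq_bigr => g _; rewrite !mulrA.
  rewrite primitive_sandwich -!scalerAl.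
  rewrite primitive_sandwich scalerA; congr (_ *: _); rewrite /F expr2.
  rewrite -!mulrA; congr (_ * _); rewrite mulrCA; congr (_ * _).
  by rewrite !gdelta_mulE invgK !mulg1 mulrC.
rewrite -scaler_suml -mulr_sumr; congr (_ *: _).
rewrite mulrC; congr (_ * _).
rewrite -[RHS]/(kappa c) /kappa gmulE.
by apply: eq_bigr => g _; rewrite mulg1.
Qed.

End Primitive.

Section Families.
Variables (K : fieldType) (charK : [pchar K] =i pred0) (gT : finGroupType).
Local Notation A := (galg K gT).
Variables (I : finType) (c : I -> A).

Definition primitive_family :=
  (forall l, primitive (c l)) /\ (forall l m x, l != m -> c l * x * c m = 0).

Hypothesis cP : primitive_family.
Let cprim l : primitive (c l) := cP.1 l.

(** The central idempotent of the two-sided ideal generated by [c l]; the scalar is the one by which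
    [gavg (c l)] multiplies [c l]. *)
Definition gidem l : A := (kappa (c l) ^+ 2)^-1 *: gavg (c l).

Lemma gidem_central l x : gidem l * x = x * gidem l.
Proof. by rewrite -scalerAl gavg_central scalerAr. Qed.

Lemma gidem_mul l : gidem l * c l = c l.
Proof.
rewrite -scalerAl gavg_mul // scalerA mulVf ?scale1r //.
by rewrite expf_neq0 // kappa_neq0.
Qed.

Lemma gavg_mulr (x e : A) : (forall y, e * y = y * e) -> e * gavg x = gavg (e * x).
Proof.
move=> eC; rewrite mulr_sumr; apply: eq_bigr => g _.
by rewrite !mulrA eC -!mulrA.
Qed.

Lemma gidem_mul0 l m : l != m -> gidem l * c m = 0.
Proof.
move=> lm; rewrite /gidem -scalerAl /gavg mulr_suml big1 ?scaler0 // => g _.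
by rewrite -!mulrA [c l * (_ * _)]mulrA cP.2 // mulr0.
Qed.

Lemma gidemM l m : gidem l * gidem m = if l == m then gidem l else 0.
Proof.
rewrite {2}/gidem -scalerAr gavg_mulr; last exact: gidem_central.
case: eqVneq => [<-|lm]; first by rewrite gidem_mul.
rewrite gidem_mul0 //; apply/eqP; rewrite scaler_eq0; apply/orP; right.
by apply/eqP; rewrite /gavg big1 // => g _; rewrite mulr0 mul0r.
Qed.

Lemma gidem_neq0 l : gidem l != 0.
Proof.
apply/eqP => e0; have := gidem_mul l; rewrite e0 mul0r => /esym/eqP.
exact/negP/primitive_neq0.
Qed.

Lemma central_class (x : A) (g h : gT) : (forall y, x * y = y * x) -> x (g ^ h)%g = x g.
Proof.
move=> xC; have := congr1 (fun y : A => y (g * h)%g) (xC (gdelta K h)).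
by rewrite gmul_deltaE gdelta_mulE mulgK conjgE mulgA.
Qed.

Variable ct : gT -> I.
Hypothesis ctP : forall g h, ct g = ct h -> exists k, h = (g ^ k)%g.

(** Nonzero orthogonal central idempotents are linearly independent class functions, and there are
    at most |I| classes since [ct] separates them. So the idempotents span the class functions, and
    multiplying the expansion of 1 by each of them shows that all coefficients are 1. *)
Lemma gidem_sum : \sum_l gidem l = 1.
Proof.
(* A label taken by no element gets the representative 1. Combinations are only evaluated at labels
   [ct g], so the extra columns do no harm. *)
pose rep t : gT := odflt 1%g [pick g | ct g == t].
have repP g : exists k, rep (ct g) = (g ^ k)%g.
  rewrite /rep; case: pickP => [h /eqP e|/(_ g)]; last by rewrite eqxx.
  by apply: ctP; rewrite e.
pose M := \matrix_(i < #|I|, j < #|I|) gidem (enum_val i) (rep (enum_val j)).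
have combE (u : 'rV[K]_#|I|) g :
    (\sum_i u 0 i *: gidem (enum_val i)) g = (u *m M) 0 (enum_rank (ct g)).
  rewrite sum_ffunE mxE; apply: eq_bigr => i _; rewrite ffunE mxE enum_rankK.
  have [k ->] := repP g; rewrite central_class //.
  exact: gidem_central.
have combM (u : 'rV[K]_#|I|) m : (\sum_i u 0 i *: gidem (enum_val i)) * gidem m =
    u 0 (enum_rank m) *: gidem m.
  rewrite mulr_suml (bigD1 (enum_rank m)) //= big1 ?addr0 => [|i neq].
    by rewrite -scalerAl gidemM enum_rankK eqxx.
  rewrite -scalerAl gidemM; case: eqP => [e|_]; last by rewrite scaler0.
  by rewrite -e enum_valK eqxx in neq.
have Mfree : row_free M.
  apply: inj_row_free => u uM; apply/rowP => i; rewrite mxE.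
  have := combM u (enum_val i).
  have -> : \sum_i u 0 i *: gidem (enum_val i) = 0.
    by apply/ffunP => g; rewrite combE uM mxE ffunE.
  rewrite mul0r enum_valK => /esym /eqP; rewrite scaler_eq0 => /orP [/eqP //|].
  by rewrite (negPf (gidem_neq0 _)).
pose w : 'rV[K]_#|I| := \row_j (1 : A) (rep (enum_val j)).
have Mu : M \in unitmx by rewrite -row_free_unit.
have one : 1 = \sum_i (w *m invmx M) 0 i *: gidem (enum_val i).
  apply/ffunP => g; rewrite combE mulmxKV // mxE enum_rankK.
  have [k ->] := repP g; rewrite central_class // => y.
  by rewrite mul1r mulr1.
rewrite one [LHS](reindex (@enum_val I predT)) /=; last first.
  by exists enum_rank => k _; [apply: enum_valK | apply: enum_rankK].
apply: eq_bigr => i _; rewrite -[LHS]mul1r [in LHS]one combM enum_valK //.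
Qed.

End Families.

Section Resolution.
Variables (K : fieldType) (charK : [pchar K] =i pred0) (gT : finGroupType).
Local Notation A := (galg K gT).

Definition complete_family (I : finType) (c : I -> A) :=
  primitive_family c /\ \sum_l gidem c l = 1.

(** With the central idempotents expanded, a claim on [x] that is linear and stable under left
    multiplication can be checked on the products [c l * (gdelta K g^-1 * x)]. *)
Lemma complete_sum (I : finType) (c : I -> A) x : complete_family c ->
  x = \sum_l \sum_g (kappa (c l) ^+ 2)^-1 *: (gdelta K g * c l * (gdelta K g^-1 * x)).
Proof.
case=> _ e; rewrite -[LHS]mul1r -e mulr_suml; apply: eq_bigr => l _.
rewrite -scalerAl -scaler_sumr; congr (_ *: _); rewrite mulr_suml.
by apply: eq_bigr => g _; rewrite !mulrA.
Qed.
End Resolution.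

(** * Group algebras of products of groups *)

Section Product.
Variables (K : fieldType) (charK : [pchar K] =i pred0) (J : finType).
Variable gT : J -> finGroupType.
Local Notation G := {dffun forall j, gT j}.

Definition gtens (x : forall j, galg K (gT j)) : galg K G :=
  [ffun g : G => \prod_j x j (g j)].

Lemma gtensM x y : gtens x * gtens y = gtens (fun j => x j * y j).
Proof.
apply/ffunP => g; rewrite gmulE [RHS]ffunE.
under [RHS]eq_bigr => j _ do rewrite gmulE.
rewrite (distr_dffun (fun j h => x j h * y j (h^-1 * g j)%g)).
apply: eq_bigr => h _; rewrite !ffunE -big_split; apply: eq_bigr => j _ /=.
by rewrite !ffunE.
Qed.

Lemma gtens_delta (g : G) : gtens (fun j => gdelta K (g j)) = gdelta K g.
Proof.
apply/ffunP => h; rewrite !ffunE; under eq_bigr => j _ do rewrite ffunE.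
rewrite -natr_prod; congr (_%:R); case: eqP => [->|neq].
  by rewrite big1 // => j _; rewrite eqxx.
have [j nej] : exists j, h j != g j.
  apply/existsP; apply: contra_notT neq => /existsPn eqh.
  by apply/ffunP => j; apply/eqP; rewrite -[_ == _]negbK eqh.
by rewrite (bigD1 j) //= (negPf nej).
Qed.

Lemma gtensZ (k : J -> K) x : gtens (fun j => k j *: x j) = (\prod_j k j) *: gtens x.
Proof.
apply/ffunP => g; rewrite !ffunE /GRing.scale /= -big_split /=.
by apply: eq_bigr => j _; rewrite ffunE.
Qed.

Lemma gtens_sum (I : J -> finType) (x : forall j, I j -> galg K (gT j)) :
  gtens (fun j => \sum_i x j i) =
  \sum_(t : {dffun forall j, I j}) gtens (fun j => x j (t j)).
Proof.
apply/ffunP => g; rewrite ffunE sum_ffunE.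
under eq_bigr => j _ do rewrite sum_ffunE.
by rewrite distr_dffun; apply: eq_bigr => t _; rewrite ffunE.
Qed.

Lemma gtens_ext x y : (forall j, x j = y j) -> gtens x = gtens y.
Proof. by move=> e; apply/ffunP => g; rewrite !ffunE; apply: eq_bigr => j _; rewrite e. Qed.

(** By linearity it suffices to sandwich a group element; it is a pure tensor, so this happens
    factor by factor. *)
Lemma gtens_primitive x : (forall j, primitive (x j)) -> primitive (gtens x).
Proof.
move=> xP; split=> [|y].
  by rewrite ffunE big1 // => j _; rewrite ffunE; have [] := xP j.
exists (\sum_g y g * \prod_j (kappa (x j) * (gdelta K (g j) * x j) 1%g)).
rewrite {1}[y]galg_sum mulr_sumr mulr_suml scaler_suml; apply: eq_bigr => g _.
rewrite -scalerAr -scalerAl -scalerA; congr (_ *: _).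
rewrite -gtens_delta !gtensM -gtensZ; apply: gtens_ext => j.
exact: primitive_sandwich.
Qed.

Lemma gtens_kappa x : kappa (gtens x) = \prod_j kappa (x j).
Proof.
rewrite /kappa gtensM ffunE; apply: eq_bigr => j _.
by congr (fun_of_fin _ _); rewrite ffunE.
Qed.

Lemma gtens_gavg x : gavg (gtens x) = gtens (fun j => gavg (x j)).
Proof.
rewrite /gavg gtens_sum; apply: eq_bigr => g _; rewrite -!gtens_delta !gtensM.
by apply: gtens_ext => j; rewrite ffunE.
Qed.

End Product.

Section Power.
Variables (K : fieldType) (charK : [pchar K] =i pred0) (J : finType).
Variables (gT : finGroupType) (I : finType) (c : I -> galg K gT).
Local Notation G := {dffun forall j : J, gT}.

Lemma gtens_complete : complete_family c ->
  complete_family (fun l : {ffun J -> I} => gtens (gT := fun _ : J => gT) (fun j => c (l j))).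
Proof.
case=> -[cprim corth] csum; split; first split=> [l|l m x lm].
- by apply: gtens_primitive => j; apply: cprim.
- rewrite [x]galg_sum mulr_sumr mulr_suml big1 // => g _.
  rewrite -scalerAr -scalerAl -gtens_delta !gtensM.
  have [j nej] : exists j, l j != m j.
    apply/existsP; apply: contraNT lm => /existsPn eqh.
    by apply/eqP/ffunP => j; apply/eqP; rewrite -[_ == _]negbK eqh.
  apply/eqP; rewrite scaler_eq0; apply/orP; right; apply/eqP/ffunP => h.
  by rewrite !ffunE (bigD1 j) //= corth // ffunE mul0r.
transitivity (gtens (gT := fun _ : J => gT) (K := K) (fun j => \sum_i gidem c i)).
  rewrite gtens_sum; apply: eq_bigr => l _.
  rewrite /gidem gtens_kappa gtens_gavg -prodrXl -prodfV -gtensZ.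
  exact: gtens_ext.
rewrite csum -[RHS](@gtens_delta K J (fun _ => gT)); apply: gtens_ext => j.
by rewrite ffunE.
Qed.
End Power.

(** * Completeness of the Young symmetrizers *)

Section Shapes.
Local Open Scope nat_scope.
Implicit Types (s sh la mu : seq nat).

Lemma sorted_geq_nth s i j : sorted geq s -> i <= j -> nth 0 s j <= nth 0 s i.
Proof.
move=> ss ij; have [js|sj] := ltnP j (size s); last by rewrite [X in X <= _]nth_default.
have tr : transitive geq by move=> x y z /= xy yz; apply: leq_trans yz xy.
apply: (sorted_leq_nth tr _ 0 ss) => //; first by move=> x /=.
by rewrite inE (leq_ltn_trans ij).
Qed.

Lemma nth_geq_sorted (f : nat -> nat) n : (forall i j, i <= j -> f j <= f i) ->
  sorted geq (mkseq f n).
Proof.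
move=> fmono; apply/(sortedP 0) => i; rewrite size_mkseq => lt.
by rewrite !nth_mkseq //; [apply: fmono | apply: ltnW].
Qed.

Lemma sumn_nth s n : size s <= n -> sumn s = \sum_(k < n) nth 0 s k.
Proof.
move=> sn; rewrite sumnE (big_nth 0) -(big_mkord xpredT (nth 0 s)).
rewrite [RHS](big_cat_nat (n := size s)) //= [X in _ = _ + X]big_nat.
by rewrite [X in _ = _ + X]big1 ?addn0 // => k /andP [le _]; rewrite nth_default.
Qed.

(** A positive entry at position k would make the first k + 1 entries positive, and their sum would
    exceed k. *)
Lemma sorted_nth_out s k : sorted geq s -> sumn s <= k -> nth 0 s k = 0.
Proof.
move=> ss le; apply/eqP; rewrite -leqn0 leqNgt; apply/negP => pos.
have ks : k < size s by rewrite ltnNge; apply/negP => /(nth_default 0) e; rewrite e in pos.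
suff : k.+1 <= sumn s by rewrite ltnNge le.
rewrite (sumn_nth (leqnn _)) -(big_mkord xpredT (nth 0 s)).
rewrite (big_cat_nat (n := k.+1)) //= -[X in X <= _]addn0 leq_add //.
rewrite big_mkord -[X in X <= _]card_ord -sum1_card leq_sum // => i _.
by apply: leq_trans pos _; apply: sorted_geq_nth => //; rewrite -ltnS.
Qed.

Lemma nth_le_sumn s k : nth 0 s k <= sumn s.
Proof.
elim: s k => [|x s IHs] [|k] //=; first exact: leq_addr.
exact: leq_trans (IHs k) (leq_addl _ _).
Qed.

(** The two lists differ by trailing zeros, which is why shapes are compared through [nth] with
    default 0. *)
Lemma intpart_of s r : sorted geq s -> sumn s = r ->
  {l : intpart r | forall k, nth 0 (parts l) k = nth 0 s k}.
Proof.
move=> ss sr; pose t : r.-tuple 'I_r.+1 := [tuple inord (nth 0 s (val k)) | k < r].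
have tE : [seq val i | i <- t] = mkseq (nth 0 s) r.
  apply: (@eq_from_nth _ 0); rewrite size_map size_tuple ?size_mkseq // => k kr.
  rewrite (nth_map ord0) ?size_tuple // nth_mkseq //.
  rewrite -[k]/(nat_of_ord (Ordinal kr)) -tnth_nth tnth_mktuple /= inordK //.
  by rewrite ltnS -[X in _ <= X]sr nth_le_sumn.
have out k : r <= k -> nth 0 s k = 0 by rewrite -sr; apply: sorted_nth_out.
have tP : is_intpart t.
  rewrite /is_intpart tE nth_geq_sorted => [|i j]; last exact: sorted_geq_nth.
  rewrite /= -[X in _ == X]sr (sumn_nth (n := r)) ?size_mkseq //.
  rewrite (sumn_nth (n := r + size s)) ?leq_addl // big_split_ord /=.
  rewrite [X in _ == _ + X]big1 ?addn0 => [|k _]; last by rewrite out ?leq_addr.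
  by apply/eqP; apply: eq_bigr => k _; rewrite nth_mkseq.
exists (Sub t tP) => k; rewrite /parts SubK tE.
have [kr|rk] := ltnP k r; first by rewrite nth_mkseq.
by rewrite out // nth_default // size_mkseq.
Qed.

Lemma parts_sorted r (l : intpart r) : sorted geq (parts l).
Proof. by case/andP: (valP l). Qed.
Lemma parts_sumn r (l : intpart r) : sumn (parts l) = r.
Proof. by case/andP: (valP l) => _ /eqP. Qed.

Lemma parts_inj r (l m : intpart r) :
  (forall k, nth 0 (parts l) k = nth 0 (parts m) k) -> l = m.
Proof.
move=> e; apply: val_inj; apply: eq_from_tnth => i; apply: val_inj.
have := e i; rewrite !(nth_map (tnth (val l) i)) ?size_tuple //.
by rewrite -!tnth_nth.
Qed.

Lemma count_sorted s c k : sorted geq s -> (k < count (ltn c) s) = (c < nth 0 s k).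
Proof.
elim: s k => [|x s IHs] k ss /=; first by rewrite nth_nil.
have ss' := path_sorted ss.
have [xc|cx] := leqP x c; [rewrite add0n | rewrite add1n].
  have -> : count (ltn c) s = 0.
    apply/eqP; rewrite -leqn0 leqNgt IHs // -leqNgt.
    by apply: leq_trans xc; apply: (@sorted_geq_nth (x :: s) 0 1 ss).
  apply/esym/negbTE; rewrite -leqNgt.
  by apply: leq_trans xc; apply: (@sorted_geq_nth (x :: s) 0 k ss).
by case: k => [|k]; rewrite /= ?cx // ltnS IHs.
Qed.

Lemma boxes_fromB s c : boxes_from s c = boxes_from s c.+1 + count (ltn c) s.
Proof.
rewrite /boxes_from -sum1_count [X in _ + X]big_mkcond -big_split /=.
by apply: eq_bigr => x _; case: ltnP; lia.
Qed.

(** Consecutive differences of [boxes_from] are the column lengths, and column c is longer than k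
    exactly when row k is longer than c. *)
Lemma boxes_from_inj la mu : sorted geq la -> sorted geq mu ->
  (forall c, boxes_from la c = boxes_from mu c) ->
  forall k, nth 0 la k = nth 0 mu k.
Proof.
move=> sla smu eD k.
have e c : (c < nth 0 la k) = (c < nth 0 mu k).
  rewrite -!count_sorted //; have := boxes_fromB la c; have := boxes_fromB mu c.
  by rewrite !eD => -> /addnI ->.
by apply/eqP; rewrite eqn_leq leqNgt e -leqNgt leqnn leqNgt -e ltnn.
Qed.

(** Padding with zeros does not change the partial sums of row lengths, hence not the filling by
    rows. *)
Lemma eq_shape_box r la mu (i : 'I_r) : sumn la = r ->
    (forall k, nth 0 la k = nth 0 mu k) ->
  trow la i = trow mu i /\ tcol la i = tcol mu i.
Proof.
move=> lar e; have := tcol_lt lar i; have := reshape_indexK la i.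
rewrite -/(trow la i) -/(tcol la i); set k := trow la i; set c := tcol la i.
rewrite e => ei lt; have {ei} : flatten_index mu k c = i.
  rewrite -[RHS]ei /flatten_index; congr (_ + _).
  elim: {lt ei c} k => [|k IHk]; first by rewrite !take0.
  have st s : sumn (take k.+1 s) = sumn (take k s) + nth 0 s k.
    have [ks|sk] := ltnP k (size s).
      by rewrite (take_nth 0) // sumn_rcons.
    by rewrite nth_default // addn0 !take_oversize // ltnW.
  by rewrite !st IHk e.
by rewrite /trow /tcol => <-; rewrite flatten_indexKl // flatten_indexKr.
Qed.

End Shapes.

Lemma eq_shape_young (K : fieldType) r la mu : sumn la = r ->
    (forall k, nth 0%N la k = nth 0%N mu k) ->
  young K r la = young K r mu.
Proof.
move=> lar e; have box i := @eq_shape_box r la mu i lar e.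
congr (_ * _); apply: eq_bigl => s; apply: eq_forallb => i.
  by rewrite -!/(trow _ _) (box i).1 (box (s i)).1.
by rewrite -!/(tcol _ _) (box i).2 (box (s i)).2.
Qed.

(** * Conjugacy classes of the symmetric group *)

Section CycleType.
Variable r : nat.
Implicit Types g h : 'S_r.
Local Open Scope nat_scope.

Definition cycle_reps g : seq 'I_r :=
  sort (fun x y => fingraph.order g y <= fingraph.order g x) (enum (froots g)).
Definition cycle_type g : seq nat := [seq fingraph.order g x | x <- cycle_reps g].

Lemma mem_cycle_reps g x : (x \in cycle_reps g) = froots g x.
Proof. by rewrite mem_sort mem_enum. Qed.

Lemma cycle_type_sorted g : sorted geq (cycle_type g).
Proof. by rewrite sorted_map; apply: sort_sorted => x y; apply: leq_total. Qed.

Lemma cycle_type_sumn g : sumn (cycle_type g) = r.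
Proof.
have pg : perm_eq (cycle_type g) [seq fingraph.order g x | x <- enum (froots g)].
  by apply: perm_map; rewrite perm_sort.
rewrite (perm_sumn pg) sumnE big_map big_enum /=.
transitivity (\sum_(x : 'I_r) 1); last by rewrite sum1_card card_ord.
have gS : connect_sym (frel g) by apply: fconnect_sym; apply: perm_inj.
rewrite [RHS](partition_big (froot g) (froots g)) => [|x _]; last exact: roots_root.
apply: eq_bigr => x rx; rewrite sum1_card /fingraph.order; apply: eq_card => y.
by rewrite !inE -root_connect // (eqP rx) eq_sym.
Qed.

(* Matching the orbits of g with orbits of h of the same size conjugates g to h. *)
Lemma conj_of_reps g h (sg sh : seq 'I_r) :
    sg =i froots g -> sh =i froots h -> uniq sh ->
    [seq fingraph.order g x | x <- sg] = [seq fingraph.order h x | x <- sh] ->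
  exists k, h = (g ^ k)%g.
Proof.
move=> gP hP uh e; have gI := @perm_inj _ g; have hI := @perm_inj _ h.
have gS : connect_sym (frel g) := fconnect_sym gI.
have hS : connect_sym (frel h) := fconnect_sym hI.
have sz : size sg = size sh.
  by have := congr1 size e; rewrite !size_map.
have inr x : froot g x \in sg by rewrite gP; apply: roots_root.
pose y x := nth x sh (index (froot g x) sg).
have lt x : index (froot g x) sg < size sh by rewrite -sz index_mem.
have yr x : froot h (y x) = y x.
  by apply/eqP; rewrite -[_ == _]/(y x \in froots h) -hP mem_nth.
have yo x : fingraph.order h (y x) = fingraph.order g (froot g x).
  have := congr1 (nth 0 ^~ (index (froot g x) sg)) e.
  have ltg : index (froot g x) sg < size sg by rewrite sz.
  by rewrite (nth_map x _ _ ltg) (nth_map x _ _ (lt x)) nth_index.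
(* A point i steps of [g] away from its representative goes to the point i steps of [h] away from
   the matching representative. *)
pose k x := iter (findex g (froot g x) x) h (y x).
have con x : fconnect g (froot g x) x by rewrite gS connect_root.
have klt x : findex g (froot g x) x < fingraph.order h (y x) by rewrite yo findex_max.
have kroot x : froot h (k x) = y x.
  rewrite -[RHS]yr; apply/eqP; rewrite root_connect // hS; exact: fconnect_iter.
have kI : injective k.
  move=> x x' ek; have ey : y x = y x' by rewrite -!kroot ek.
  have er : froot g x = froot g x'.
    rewrite -(nth_index x (inr x)) -(nth_index x (inr x')); congr nth.
    apply/eqP; move: ey.
    by rewrite /y (set_nth_default x') // => /eqP; rewrite nth_uniq.
  move: ek; rewrite /k -ey => /(congr1 (findex h (y x))).
  rewrite !findex_iter //; last by rewrite ey.
  by move=> ef; rewrite -(iter_findex (con x)) ef er iter_findex.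
exists (perm kI); apply/permP => z; rewrite conjgE !permM.
set x := ((perm kI)^-1)%g z; have -> : z = k x by rewrite -(permE kI) permKV.
rewrite permE; have er : froot g (g x) = froot g x.
  by apply/eqP; rewrite root_connect // gS fconnect1.
have ey : y (g x) = y x by rewrite /y er (set_nth_default x).
rewrite /k ey er -iterS; have := findex_max (con x); set i := findex _ _ _ => io.
have gx : g x = iter i.+1 g (froot g x) by rewrite iterS iter_findex.
(* At the end of an orbit one more step returns to the representative, for [g] and [h] alike since
   the orbits have equal size. *)
have := io; rewrite leq_eqVlt => /orP [/eqP io'|io']; last by rewrite gx findex_iter.
by rewrite gx io' iter_order // findex0 -yo iter_order.
Qed.

Lemma cycle_type_conj g h : cycle_type g = cycle_type h -> exists k, h = (g ^ k)%g.
Proof.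
apply: conj_of_reps; last by rewrite sort_uniq enum_uniq.
- exact: mem_cycle_reps.
exact: mem_cycle_reps.
Qed.

Definition cycle_part g : intpart r := sval (intpart_of (cycle_type_sorted g) (cycle_type_sumn g)).

(** Orbit sizes are positive, so the padded list determines the unpadded one. *)
Lemma cycle_part_conj g h : cycle_part g = cycle_part h -> exists k, h = (g ^ k)%g.
Proof.
move=> e; apply: cycle_type_conj.
have enth k : nth 0 (cycle_type g) k = nth 0 (cycle_type h) k.
  move: e; rewrite /cycle_part; case: intpart_of => l le; case: intpart_of => m me /= e.
  by rewrite -le -me e.
have pos f : all (leq 1) (cycle_type f).
  by rewrite all_map; apply/allP => x _; apply: fingraph.order_gt0.
have szle (s t : seq nat) : all (leq 1) s -> (forall k, nth 0 s k = nth 0 t k) ->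
    size s <= size t.
  move=> sp et; rewrite leqNgt; apply/negP => lt.
  by have /allP/(_ _ (mem_nth 0 lt)) := sp; rewrite et nth_default.
apply: (@eq_from_nth _ 0) => [|k _]; last exact: enth.
by apply/eqP; rewrite eqn_leq !szle.
Qed.

End CycleType.

Section YoungFamily.
Variables (K : fieldType) (charK : [pchar K] =i pred0) (r : nat).

Lemma young_primitive sh : sumn sh = r -> primitive (young K r sh).
Proof.
move=> shr; split=> [|x]; first exact: young1.
exists ((yrow K r sh * (ycol K r sh * x * yrow K r sh) * ycol K r sh) 1%g).
rewrite -young_sandwich //.
by rewrite /young !mulrA.
Qed.

(** In a_la b_la x a_mu b_mu, the outer pair a_la, b_mu and the inner pair b_la, a_mu both enclose a
    nonzero element; they give opposite dominance inequalities. *)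
Lemma young_orth la mu x : sumn la = r -> sumn mu = r ->
  young K r la * x * young K r mu != 0 -> forall c, boxes_from la c = boxes_from mu c.
Proof.
move=> lar mur nz c; apply/eqP; rewrite eqn_leq; apply/andP; split.
  apply: (@yrow_ycol_dom _ charK r la mu (ycol K r la * x * yrow K r mu)) => //.
  by move: nz; rewrite /young !mulrA.
apply: (@ycol_yrow_dom _ charK r la mu x) => //.
apply: contra nz => /eqP e; rewrite /young.
by rewrite -!mulrA [ycol _ _ _ * _]mulrA [_ * (yrow _ _ _ * _)]mulrA e mul0r mulr0.
Qed.

Lemma young_complete : complete_family (fun l : intpart r => young K r (parts l)).
Proof.
have fam : primitive_family (fun l : intpart r => young K r (parts l)).
  split=> [l|l m x]; first by apply: young_primitive; apply: parts_sumn.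
  move=> lm; apply/eqP; apply: contraNT lm => /young_orth eD.
  apply/eqP; apply: parts_inj; apply: boxes_from_inj; rewrite ?parts_sorted //.
  by apply: eD; apply: parts_sumn.
split=> //; exact: (gidem_sum charK fam (@cycle_part_conj r)).
Qed.
End YoungFamily.

(** * The Koszul relations in the group algebra *)

Section GroupAlgebraMap.
Variables (K : fieldType) (H G : finGroupType) (f : H -> G).
Hypothesis fM : {morph f : x y / (x * y)%g}.

Definition gmap (x : galg K H) : galg K G := \sum_h x h *: gdelta K (f h).

Lemma gmap_linear : linear gmap.
Proof.
move=> k x y; rewrite scaler_sumr -big_split; apply: eq_bigr => h _ /=.
by rewrite !ffunE scalerDl scalerA.
Qed.
HB.instance Definition _ := GRing.isLinear.Build K (galg K H) (galg K G) *:%R gmap gmap_linear.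

Lemma gmap_delta h : gmap (gdelta K h) = gdelta K (f h).
Proof.
rewrite /gmap (bigD1 h) //= big1 ?addr0 => [|k neq].
  by rewrite ffunE eqxx scale1r.
by rewrite ffunE (negPf neq) scale0r.
Qed.

Lemma gmapM x y : gmap (x * y) = gmap x * gmap y.
Proof.
rewrite [x]galg_sum [y]galg_sum mulr_suml !linear_sum mulr_suml.
apply: eq_bigr => h _; rewrite mulr_sumr !linear_sum mulr_sumr.
apply: eq_bigr => k _; rewrite -scalerAl -scalerAr !linearZ /= gdeltaM !gmap_delta.
by rewrite -scalerAl -scalerAr gdeltaM fM.
Qed.
End GroupAlgebraMap.

(** * Permutations of the last p of a + p points *)

Section Shift.
Variables (a p : nat).
Implicit Types s t : 'S_p.

Definition shift_fun s (i : 'I_(a + p)) : 'I_(a + p) :=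
  match split i with inl j => lshift p j | inr j => rshift a (s j) end.
Lemma shift_funK s : cancel (shift_fun s) (shift_fun s^-1).
Proof.
move=> i; rewrite /shift_fun -[in RHS](splitK i); case: (split i) => j /=.
  by rewrite (unsplitK (inl j)).
by rewrite (unsplitK (inr (s j))) permK.
Qed.
Definition pshift s : 'S_(a + p) := perm (can_inj (shift_funK s)).

Lemma pshiftl s i : pshift s (lshift p i) = lshift p i.
Proof. by rewrite permE /shift_fun (unsplitK (inl i)). Qed.
Lemma pshiftr s i : pshift s (rshift a i) = rshift a (s i).
Proof. by rewrite permE /shift_fun (unsplitK (inr i)). Qed.

Lemma eq_shift_perm (u v : 'S_(a + p)) :
    (forall i, u (lshift p i) = v (lshift p i)) ->
    (forall i, u (rshift a i) = v (rshift a i)) -> u = v.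
Proof.
by move=> el er; apply/permP => i; rewrite -(splitK i); case: (split i) => j /=.
Qed.

Lemma pshiftM : {morph pshift : s t / (s * t)%g}.
Proof.
by move=> s t; apply: eq_shift_perm => i; rewrite permM !(pshiftl, pshiftr) ?permM.
Qed.
Lemma pshift1 : pshift 1 = 1%g.
Proof. by apply: eq_shift_perm => i; rewrite !(pshiftl, pshiftr) !perm1. Qed.
Lemma pshiftV s : pshift s^-1 = ((pshift s)^-1)%g.
Proof. by apply: (mulgI (pshift s)); rewrite -pshiftM !mulgV pshift1. Qed.

Lemma pshift_tperm i j : pshift (tperm i j) = tperm (rshift a i) (rshift a j).
Proof.
have rI := @rshift_inj a p.
apply: eq_shift_perm => k; rewrite !(pshiftl, pshiftr).
  by rewrite tpermD // eq_rlshift.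
by rewrite inj_tperm.
Qed.

Lemma odd_pshift s : pshift s = s :> bool.
Proof.
have [ts -> _] := prod_tpermP s.
elim: ts => [|[i j] ts IHts]; first by rewrite !big_nil pshift1 !odd_perm1.
rewrite !big_cons pshiftM !odd_permM IHts pshift_tperm !odd_tperm.
by rewrite (inj_eq (@rshift_inj a p)).
Qed.

Variable sh : seq nat.
(** Filling by rows makes [pshift] compatible with shapes: in [a :: sh] the first [a] points occupy
    the first row, and the shifted points fill [sh] below it in unchanged columns. *)
Lemma trow_lshift (i : 'I_a) : trow (a :: sh) (lshift p i) = 0%N.
Proof.
rewrite /trow /reshape_index /= subn_eq0 ltn_ord //.
Qed.
Lemma trow_rshift (i : 'I_p) : trow (a :: sh) (rshift a i) = (trow sh i).+1.
Proof.
rewrite /trow /reshape_index /= subn_eq0 ltnNge leq_addr /=.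
by rewrite -addnS addKn.
Qed.
Lemma tcol_rshift (i : 'I_p) : tcol (a :: sh) (rshift a i) = tcol sh i.
Proof.
rewrite /tcol /reshape_offset -/(trow _ (rshift a i)) trow_rshift /=.
by rewrite subnDl.
Qed.

Lemma rowstab_pshift s : rowstab sh s -> rowstab (a :: sh) (pshift s).
Proof.
move=> /rowstabP hs; apply/rowstabP => i; rewrite -(splitK i).
by case: (split i) => j /=; rewrite ?pshiftl // pshiftr !trow_rshift hs.
Qed.
Lemma colstab_pshift s : colstab sh s -> colstab (a :: sh) (pshift s).
Proof.
move=> /colstabP hs; apply/colstabP => i; rewrite -(splitK i).
by case: (split i) => j /=; rewrite ?pshiftl // pshiftr !tcol_rshift hs.
Qed.

End Shift.

Section Koszul_ideal.
Variables (K : fieldType) (charK : [pchar K] =i pred0) (a p : nat).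
Local Notation A := (galg K 'S_(a + p)).
Local Notation lsh := (lshift p).
Local Notation rsh := (@rshift a p).
Local Notation gsh := (gmap (@pshift a p)).
Implicit Types (x y z T : A) (h : 'S_(a + p)).

(* In V^⊗(a+p): symmetry in the first a factors, and vanishing of the multiplication
   of any other factor into Sym^a V. *)
Definition kos (x : A) :=
  (forall i i', x * gdelta K (tperm (lsh i) (lsh i')) = x) /\
  (forall j, x + \sum_i x * gdelta K (tperm (lsh i) (rsh j)) = 0).

Lemma kos_mull x y : kos x -> kos (y * x).
Proof.
move=> [h1 h2]; split=> [i i'|j]; first by rewrite -mulrA h1.
rewrite -[0 in RHS](mulr0 y) -[0 in RHS](h2 j) mulrDr mulr_sumr; congr (_ + _).
by apply: eq_bigr => i _; rewrite mulrA.
Qed.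

Lemma kosZ k x : kos x -> kos (k *: x).
Proof. by move=> kx; rewrite -[x]mul1r scalerAl; apply: kos_mull. Qed.

Lemma kos_sum (I : finType) (f : I -> A) : (forall i, kos (f i)) -> kos (\sum_i f i).
Proof.
move=> kf; split=> [i i'|j].
  by rewrite mulr_suml; apply: eq_bigr => k _; apply: (kf k).1.
under [X in _ + X]eq_bigr => i _ do rewrite mulr_suml.
rewrite exchange_big -big_split big1 //= => k _.
exact: (kf k).2.
Qed.

Lemma delta_tpermC h u v : gdelta K h * gdelta K (tperm (h u) (h v)) =
  gdelta K (tperm u v) * gdelta K h.
Proof. by rewrite !gdeltaM -tpermJ conjgE !mulgA mulgV mul1g. Qed.

(** Conjugation by a permutation of the last p points fixes the first [a] and only permutes the
    relations indexed by [j]. *)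
Lemma kos_shift x (z : galg K 'S_p) : kos x -> kos (x * gsh z).
Proof.
move=> [h1 h2]; rewrite /gmap mulr_sumr; apply: kos_sum => s.
rewrite -scalerAr; apply: kosZ; set h := pshift a s.
have hl i : lsh i = h (lsh i) by rewrite pshiftl.
split=> [i i'|j].
  by rewrite -mulrA (hl i) (hl i') delta_tpermC mulrA h1.
have hr : rsh j = h (rsh ((s^-1)%g j)) by rewrite pshiftr permKV.
rewrite -[0 in RHS](mul0r (gdelta K h)) -[0 in RHS](h2 ((s^-1)%g j)) mulrDl mulr_suml; congr (_ + _).
apply: eq_bigr => i _.
by rewrite -mulrA hr [in tperm (lsh i) (h _)](hl i) delta_tpermC mulrA.
Qed.

Lemma perm_mul_tperm h u v : (h * tperm u v)%g = (tperm (h^-1 u) (h^-1 v) * h)%g.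
Proof. by rewrite -tpermJ conjgE invgK !mulgA mulgKV. Qed.

Lemma kosE T h j : kos T ->
  T h + \sum_i T (h * tperm (lsh i) (rsh j))%g = 0.
Proof.
move=> [_ /(_ j) /ffunP /(_ h)]; rewrite !ffunE sum_ffunE => e; rewrite -[RHS]e.
by congr (_ + _); apply: eq_bigr => i _; rewrite gmul_deltaE tpermV.
Qed.

Section LeftInvariant.
Variables (T : A) (R : pred 'I_(a + p)).
Hypothesis kT : kos T.
Hypothesis TR : forall u v, R u -> R v -> gdelta K (tperm u v) * T = T.

Definition inside h := forall i : 'I_a, R ((h^-1)%g (lsh i)).

Lemma left_invE h u v : R ((h^-1)%g u) -> R ((h^-1)%g v) -> T (h * tperm u v)%g = T h.
Proof.
by move=> hu hv; rewrite perm_mul_tperm -[in RHS](TR hu hv) gdelta_mulE tpermV.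
Qed.

Lemma sum_inside h : (#|R| = \sum_i R ((h^-1)%g (lsh i)) + \sum_j R ((h^-1)%g (rsh j)))%N.
Proof.
transitivity (\sum_(u : 'I_(a + p)) R ((h^-1)%g u))%N; last by rewrite big_split_ord.
rewrite -sum1_card big_mkcond (reindex_inj (@perm_inj _ (h^-1)%g)) /=.
by apply: eq_bigr => u _; rewrite unfold_in; case: (R _).
Qed.

(** Induction on the number of first slots whose preimage lies outside [R]. When it is positive, |R|
    >= a leaves a later slot j with preimage in [R]. In the relation at j, an exchange with a slot
    inside [R] keeps the coefficient, and one with a slot outside lowers the number and gives zero;
    so a positive multiple of T h vanishes. *)
Lemma kos_outside : (a <= #|R|)%N -> (forall h, inside h -> T h = 0) -> T = 0.
Proof.
move=> aR T0; apply/ffunP => h; rewrite [RHS]ffunE.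
pose out h := (\sum_i ~~ R ((h^-1)%g (lsh i)))%N.
move: {2}(out h) (leqnn (out h)) => n.
elim: n h => [|n IHn] h hn.
  apply: T0 => i; move: hn; rewrite leqn0 sum_nat_eq0 => /forallP /(_ i) /=.
  by case: (R _).
have [o0|opos] := posnP (out h).
  by apply: IHn; rewrite o0.
have inout : (\sum_i R ((h^-1)%g (lsh i)) + out h = a)%N.
  rewrite -[RHS]card_ord -sum1_card -big_split /=; apply: eq_bigr => i _.
  by case: (R _).
have [j jR] : exists j, R ((h^-1)%g (rsh j)).
  apply/existsP; apply: contraLR aR => /existsPn nR; rewrite -ltnNge (sum_inside h).
  rewrite [X in (_ + X < _)%N]big1 => [|j _]; last by rewrite (negPf (nR j)).
  by rewrite addn0 -[X in (_ < X)%N]inout -[X in (X < _)%N]addn0 ltn_add2l.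
have step i : T (h * tperm (lsh i) (rsh j))%g = (R ((h^-1)%g (lsh i)) : nat)%:R * T h.
  have [iR|niR] := boolP (R _); first by rewrite left_invE ?mul1r.
  rewrite mul0r; apply: IHn; rewrite -ltnS; apply: leq_trans hn.
  rewrite /out (bigD1 i) //= [X in (_ < X)%N](bigD1 i) //= niR.
  rewrite invMg permM tpermV tpermL jR add0n add1n ltnS leq_sum // => k ki.
  by rewrite permM tpermD ?eq_rlshift // (inj_eq (@lshift_inj a p)) eq_sym.
have := kosE h j kT; under eq_bigr => i _ do rewrite step.
rewrite -mulr_suml -natr_sum -[X in X + _]mul1r -mulrDl addrC natr1.
by move/eqP; rewrite mulf_eq0 natK_eq0 //= => /eqP.
Qed.

(** Even when all first slots have their preimage in [R], so has some later one, and its relation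
    reads (a + 1) T h = 0. *)
Lemma kos_many : (a < #|R|)%N -> T = 0.
Proof.
move=> aR; apply: kos_outside => [|h hin]; first exact: ltnW.
have [j jR] : exists j, R ((h^-1)%g (rsh j)).
  apply/existsP; apply: contraLR aR => /existsPn nR; rewrite -leqNgt (sum_inside h).
  rewrite [X in (_ + X <= _)%N]big1 => [|j _]; last by rewrite (negPf (nR j)).
  rewrite addn0 -[X in (_ <= X)%N]card_ord -sum1_card leq_sum // => i _.
  by case: (R _).
have := kosE h j kT; under eq_bigr => i _ do rewrite left_invE //.
rewrite sumr_const card_ord -mulrS => /eqP; rewrite -mulr_natr mulf_eq0 natK_eq0 //.
by rewrite orbF => /eqP.
Qed.
End LeftInvariant.

(** [kos_outside] leaves the permutations that preserve the set of the first [a] points. Left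
    transpositions reduce the number of moved points among them without changing the coefficient,
    until a permutation [pshift s] is reached. *)
Lemma kos_fixed T : kos T ->
    (forall i i', gdelta K (tperm (lsh i) (lsh i')) * T = T) ->
    (forall s, T (pshift a s) = 0) -> T = 0.
Proof.
move=> kT TR T0; pose R := [pred u : 'I_(a + p) | (u < a)%N].
have RE u : R u -> exists i, u = lsh i.
  by move=> ua; exists (Ordinal ua); apply: val_inj.
have Rl i : R (lsh i) by rewrite /= ltn_ord.
apply: (@kos_outside T R kT) => [u v /RE [i ->] /RE [j ->]||h] //.
  rewrite -[X in (X <= _)%N](card_ord a) -(card_image (@lshift_inj a p)).
  by apply: subset_leq_card; apply/subsetP => u /imageP [i _ ->]; apply: Rl.
pose mv h := (\sum_i ((h^-1)%g (lsh i) != lsh i))%N.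
move: {2}(mv h) (leqnn (mv h)) => n.
elim: n h => [|n IHn] h hn hin.
  have fixl i : h (lsh i) = lsh i.
    apply: (@perm_inj _ (h^-1)%g); rewrite permK.
    move: hn; rewrite leqn0 sum_nat_eq0 => /forallP /(_ i) /=.
    by case: ((h^-1)%g (lsh i) =P lsh i).
  pose f j := if split (h (rsh j)) is inr k then k else j.
  have fE j : h (rsh j) = rsh (f j).
    rewrite /f; case: splitP => [k e|k e]; last exact: val_inj.
    have /perm_inj /eqP : h (rsh j) = h (lsh k) by rewrite fixl; apply: val_inj.
    by rewrite eq_rlshift.
  have fI : injective f.
    by move=> j k e; apply: (@rshift_inj a p); apply: (@perm_inj _ h); rewrite !fE e.
  rewrite (_ : h = pshift a (perm fI)) //; apply: eq_shift_perm => j.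
    by rewrite pshiftl.
  by rewrite pshiftr permE.
have [/forallP fx|/forallPn [i nei]] := boolP [forall i, (h^-1)%g (lsh i) == lsh i].
  by apply: IHn => //; rewrite /mv big1 // => i _; rewrite fx.
have [i' ei] := RE _ (hin i); set t := tperm (lsh i) (lsh i').
have thE u : ((t * h)^-1)%g u = t ((h^-1)%g u) by rewrite invMg permM tpermV.
rewrite -(TR i i') gdelta_mulE tpermV; apply: IHn => [|k]; last first.
  by rewrite thE; have [k' ->] := RE _ (hin k); rewrite /t; case: tpermP => // _; apply: Rl.
rewrite -ltnS; apply: leq_trans hn; rewrite /mv (bigD1 i) //= [X in (_ < X)%N](bigD1 i) //=.
rewrite nei thE ei tpermR eqxx add0n add1n ltnS leq_sum // => k ki; rewrite thE.
have [e|ne] := eqVneq ((h^-1)%g (lsh k)) (lsh k); last by rewrite leq_b1.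
rewrite e /t tpermD ?eqxx // (inj_eq (@lshift_inj a p)) 1?eq_sym //.
apply: contra_neq ki => ki; apply: (@lshift_inj a p); apply: (@perm_inj _ (h^-1)%g).
by rewrite e ei ki.
Qed.

Lemma delta_gsh_tperm (i i' : 'I_a) (z : galg K 'S_p) :
  gsh z * gdelta K (tperm (lsh i) (lsh i')) = gdelta K (tperm (lsh i) (lsh i')) * gsh z.
Proof.
rewrite /gmap mulr_suml mulr_sumr; apply: eq_bigr => s _.
rewrite -scalerAl -scalerAr; congr (_ *: _).
by rewrite -delta_tpermC !pshiftl.
Qed.

(** Restriction of coefficients to S_p, compatible with multiplication by S_p on both sides. By
    [kos_fixed] it is injective on Koszul elements that are left symmetric in the first [a]
    points. *)
Definition top_part T : galg K 'S_p := [ffun s => T (pshift a s)].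

Lemma top_part_mulr T (z : galg K 'S_p) : top_part (T * gsh z) = top_part T * z.
Proof.
apply/ffunP => s; rewrite ffunE [RHS]gmulE.
rewrite /gmap mulr_sumr sum_ffunE [RHS](reindex_inj (mulgI s)) /=.
rewrite [RHS](reindex_inj invg_inj) /=; apply: eq_bigr => t _.
rewrite -scalerAr [LHS]ffunE gmul_deltaE !ffunE /GRing.scale /= mulrC pshiftM pshiftV.
by rewrite invMg invgK mulgKV.
Qed.

Lemma top_part_mull T s : top_part (gdelta K (pshift a s) * T) = gdelta K s * top_part T.
Proof. by apply/ffunP => t; rewrite ffunE !gdelta_mulE ffunE pshiftM pshiftV. Qed.

Lemma gshM (x y : galg K 'S_p) : gsh (x * y) = gsh x * gsh y.
Proof. exact: gmapM (@pshiftM a p) x y. Qed.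

Section Key.
Variable la : seq nat.
Hypothesis lap : sumn la = p.
Local Notation nu := (a :: la).
Local Notation yl := (gsh (young K p la)).

Let nur : sumn nu = (a + p)%N. Proof. by rewrite /= lap. Qed.

Lemma row_nu_cases u v : trow nu u = trow nu v ->
  (exists i i', u = lsh i /\ v = lsh i') \/
  (exists j j', [/\ u = rsh j, v = rsh j' & trow la j = trow la j']).
Proof.
move: (splitK u) (splitK v).
case: (split u) => i; case: (split v) => j /= <- <-; rewrite ?trow_lshift ?trow_rshift //.
  by left; exists i, j.
by case=> e; right; exists i, j.
Qed.

(** Row symmetry for (a, la) on the right has two sources: the kernel condition in the first [a]
    slots, and the row symmetrizer of [la] in the others. *)
Lemma kos_dom mu x : sumn mu = (a + p)%N -> kos x ->
  young K (a + p) mu * x * yl != 0 -> forall c, (boxes_from nu c <= boxes_from mu c)%N.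
Proof.
move=> mur [kx _] nz; rewrite /young gshM in nz.
have {nz} : ycol K (a + p) mu * (x * gsh (yrow K p la)) != 0.
  apply: contraNneq nz => e.
  by rewrite -!mulrA [x * _]mulrA [ycol _ _ _ * _]mulrA e mul0r mulr0.
apply: col_row_dom => // [i j ij ec|u v /row_nu_cases].
  rewrite mulrA colstab_ycol ?colstab_tperm //.
  by rewrite odd_tperm ij expr1 scaleN1r !mulNr.
case=> [[i [i' [-> ->]]]|[j [j' [-> -> er]]]].
  by rewrite -!mulrA delta_gsh_tperm [x * _]mulrA kx.
rewrite -pshift_tperm -(gmap_delta K (@pshift a p)) -!mulrA -gshM yrow_rowstab //.
exact: rowstab_tperm.
Qed.

Lemma young_nu_left x i i' :
  gdelta K (tperm (lsh i) (lsh i')) * (young K (a + p) nu * x) = young K (a + p) nu * x.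
Proof.
by rewrite !mulrA rowstab_yrow //; apply: rowstab_tperm; rewrite !trow_lshift.
Qed.

Lemma kos_top_neq0 x : kos (young K (a + p) nu * x) -> young K (a + p) nu * x != 0 ->
  top_part (young K (a + p) nu * x) != 0.
Proof.
move=> kx; apply: contraNneq => /ffunP top0; apply/eqP.
apply: kos_fixed => [//||s].
  by move=> i i'; apply: young_nu_left.
by have := top0 s; rewrite !ffunE.
Qed.

Lemma top_left x j j' : trow la j = trow la j' ->
  gdelta K (tperm j j') * top_part (young K (a + p) nu * x) =
  top_part (young K (a + p) nu * x).
Proof.
move=> er; rewrite -top_part_mull !mulrA rowstab_yrow //.
by rewrite pshift_tperm; apply: rowstab_tperm; rewrite !trow_rshift er.
Qed.
End Key.

(** A first row shorter than [a] contradicts dominance, and a longer one gives zero by [kos_many].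
    If its length is [a], the other rows of [mu] dominate [la] by [kos_dom]. The nonzero [top_part],
    row symmetric for these rows and column antisymmetric for [la], gives the reverse. *)
Lemma kos_shape (la : seq nat) (mu : intpart (a + p)) x :
    sumn la = p -> sorted geq la -> kos x ->
    young K (a + p) (parts mu) * x * gsh (young K p la) != 0 ->
  forall k, nth 0%N (parts mu) k = nth 0%N (a :: la) k.
Proof.
move=> lap las kx nz; set m := nth 0%N (parts mu) 0.
have mur := parts_sumn mu; have mus := parts_sorted mu.
have dom c := kos_dom lap mur kx nz c.
have [ma|am|ma] := ltngtP m a.
- have : boxes_from (parts mu) m = 0%N.
    apply: big1_seq => y /andP [_ /(nthP 0%N) [i _ <-]].
    by apply/eqP; rewrite subn_eq0; apply: sorted_geq_nth.
  have := dom m; rewrite {1}/boxes_from big_cons => le e.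
  by move: le; rewrite e leqn0 addn_eq0 subn_eq0 leqNgt ma.
- have mpos : (0 < size (parts mu))%N.
    by rewrite lt0n; apply: contraTneq am => /size0nil e; rewrite /m e.
  have R0 : #|[pred u : 'I_(a + p) | trow (parts mu) u == 0%N]| = m.
    rewrite -[m]subn0 -(card_row_from mur 0 mpos); apply: eq_card => u.
    by rewrite !inE leq0n andbT.
  case/eqP: nz; apply: (kos_many (R := [pred u : 'I_(a + p) | trow (parts mu) u == 0%N])).
  + exact/kos_shift/kos_mull.
  + move=> u v /eqP eu /eqP ev; rewrite !mulrA rowstab_yrow //.
    by apply: rowstab_tperm; rewrite eu ev.
  by rewrite R0.
pose bar := behead (parts mu).
have muE k : nth 0%N (parts mu) k = nth 0%N (a :: bar) k.
  by case: k => [|k] //=; rewrite nth_behead.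
have barp : sumn bar = p.
  by move: mur ma; rewrite /m /bar; case: (parts mu) => [|y s] /=; lia.
have e := eq_shape_young K mur muE.
have domb c : (boxes_from la c <= boxes_from bar c)%N.
  have := dom c; rewrite [X in (_ <= X)%N](_ : _ = boxes_from (a :: bar) c).
    by rewrite /boxes_from !big_cons leq_add2l.
  move: ma; rewrite /m /bar /boxes_from; case: (parts mu) => [|y s] /= <- //.
  by rewrite big_cons big_nil.
have eqD c : boxes_from bar c = boxes_from la c.
  apply/eqP; rewrite eqn_leq domb andbT; move: c.
  apply: (@row_col_dom _ charK p bar la (top_part (young K (a + p) (parts mu) * x * gsh (young K p la)))) => //.
  - by move=> i j er; rewrite e -mulrA top_left.
  - move=> i j ij ec; rewrite top_part_mulr -!mulrA ycol_colstab ?colstab_tperm //.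
    by rewrite odd_tperm ij expr1 scaleN1r !mulrN.
  rewrite e -mulrA; apply: kos_top_neq0; first exact/kos_mull/kos_shift.
  by rewrite mulrA -e.
move=> k; rewrite muE; case: k => [|k] //=; apply: boxes_from_inj => //.
by rewrite /bar; case: (parts mu) mus => //= y s /path_sorted.
Qed.

(** * The element linking S_la and S_(a,la) *)

Section KeyLine.
Variable la : seq nat.
Hypotheses (lap : sumn la = p) (laa : forall k, (nth 0%N la k <= a)%N).
Local Notation nu := (a :: la).
Local Notation cnu := (young K (a + p) nu).
Local Notation yl := (gsh (young K p la)).
Let nur : sumn nu = (a + p)%N. Proof. by rewrite /= lap. Qed.

(** The middle factor gives symmetry in the first [a] slots. Since row permutations of [la] are
    absorbed by it, the right factor stands for the whole [young] of [la] up to a scalar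
    ([kkeyE]). *)
Definition kkey : A := cnu * yrow K (a + p) nu * gsh (ycol K p la).

Lemma tcol_nu (u : 'I_(a + p)) : (tcol nu u < a)%N.
Proof.
apply: leq_trans (tcol_lt nur u) _.
by case: (trow nu u) => [|k] /=.
Qed.

(** The left side of the relation at [j] is symmetric in the a + 1 slots formed by [j] and the first
    [a], and column antisymmetric for (a, la) on the left. As no row is longer than [a], there are
    at most [a] columns: two of these slots come from one column, and each coefficient is its own
    negative. *)
Lemma kos_kkey : kos kkey.
Proof.
rewrite /kkey /young -!mulrA; apply: kos_mull.
set X := yrow K (a + p) nu * gsh (ycol K p la); set z : A := ycol K (a + p) nu * X.
have zl i i' : z * gdelta K (tperm (lsh i) (lsh i')) = z.
  rewrite /z /X -!mulrA delta_gsh_tperm [yrow _ _ _ * _]mulrA yrow_rowstab //.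
  by apply: rowstab_tperm; rewrite !trow_lshift.
(* [None] stands for the slot of [j], [Some i] for the first [a] slots. *)
split=> // j; pose e (o : option 'I_a) := if o is Some i then lsh i else rsh j.
have eI : injective e.
  by move=> [i|] [i'|] //= /eqP; rewrite ?eq_lshift ?eq_lrshift ?eq_rlshift // => /eqP ->.
pose z' : A := \sum_o z * gdelta K (tperm (e o) (e None)).
have -> : z + \sum_i z * gdelta K (tperm (lsh i) (rsh j)) = z'.
  rewrite /z' (bigD1 None) //= tperm1 -galg1E mulr1; congr (_ + _).
  rewrite [RHS](reindex_omap Some id) => [|[i|]] //=.
  by apply: eq_bigl => i; rewrite eqxx.
(* The multiplication permutes the summands up to transpositions of the first [a] slots, under which
   [z] is invariant. *)
have z'N o : z' * gdelta K (tperm (e o) (e None)) = z'.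
  rewrite /z' mulr_suml [RHS](reindex_inj (@perm_inj _ (tperm o None))) /=.
  apply: eq_bigr => o' _; rewrite -mulrA gdeltaM; case: tpermP => [->|->|].
  - by rewrite tperm2 tperm1.
  - by rewrite tperm1 mul1g.
  case: o => [i|]; case: o' => [i'|] // /eqP ne _; last by rewrite tperm1 mulg1.
  have -> : (tperm (e (Some i')) (e None) * tperm (e (Some i)) (e None) =
      tperm (e (Some i)) (e (Some i')) * tperm (e (Some i')) (e None))%g.
    rewrite perm_mul_tperm tpermV tpermR; congr (tperm _ _ * _)%g.
    by rewrite tpermD // (inj_eq eI) // eq_sym.
  by rewrite -gdeltaM mulrA zl.
have z'e o o' : z' * gdelta K (tperm (e o) (e o')) = z'.
  case: o' => [k'|]; last exact: z'N.
  case: o => [k|]; last by rewrite tpermC z'N.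
  have [->|ne] := eqVneq k k'; first by rewrite tperm1 -galg1E mulr1.
  have -> : tperm (e (Some k)) (e (Some k')) =
     (tperm (e (Some k)) (e None) * tperm (e (Some k')) (e None) * tperm (e (Some k)) (e None))%g.
    rewrite -{1}[tperm (e (Some k)) (e None)]tpermV -mulgA -conjgE tpermJ tpermR tpermC.
    by rewrite tpermD // (inj_eq eI) // eq_sym.
  by rewrite -!gdeltaM !mulrA !z'N.
apply/ffunP => h; rewrite [RHS]ffunE; apply: (@eq_oppK _ charK K^o).
have /injectivePn [o [o' neo eo]] : ~~ injectiveb (fun o => Ordinal (tcol_nu ((h^-1)%g (e o)))).
  apply/negP => /injectiveP /leq_card; rewrite card_option !card_ord; lia.
have {}eo : tcol nu ((h^-1)%g (e o)) = tcol nu ((h^-1)%g (e o')) by case: eo.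
rewrite -{1}(z'e o o') gmul_deltaE tpermV perm_mul_tperm.
transitivity ((gdelta K (tperm ((h^-1)%g (e o)) ((h^-1)%g (e o'))) * z') h).
  by rewrite gdelta_mulE tpermV.
have -> : gdelta K (tperm ((h^-1)%g (e o)) ((h^-1)%g (e o'))) * z' = - z'; last by rewrite ffunE.
rewrite /z' mulr_sumr -sumrN; apply: eq_bigr => k _; rewrite /z !mulrA colstab_ycol.
  rewrite odd_tperm (inj_eq perm_inj) (inj_eq eI) neo expr1 scaleN1r.
  by rewrite !mulNr.
exact: colstab_tperm.
Qed.

(** Column permutations of [la] are column permutations of (a, la), so the two column symmetrizers
    merge with the factor [ncol]; what remains is [cnu * cnu]. The product is nonzero, hence so is
    [kkey]. *)
Lemma kkey_ycol : kkey * ycol K (a + p) nu = (ncol K p la * kappa cnu) *: cnu.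
Proof.
have e : gsh (ycol K p la) * ycol K (a + p) nu = ncol K p la *: ycol K (a + p) nu.
  rewrite linear_sum mulr_suml (eq_bigr (fun=> ycol K (a + p) nu)) => [|t ht].
    by rewrite sumr_const -scaler_nat.
  rewrite linearZ /= gmap_delta -scalerAl colstab_ycol ?odd_pshift; last exact: colstab_pshift.
  by rewrite scalerA -expr2 sqrr_sign scale1r.
rewrite /kkey -mulrA e -scalerAr -mulrA -/(young K (a + p) nu) primitive_sq.
  by rewrite scalerA.
exact: young_primitive.
Qed.

Lemma kkey_neq0 : kkey != 0.
Proof.
apply/eqP => k0; have := kkey_ycol; rewrite k0 mul0r => /esym/eqP.
have cP := young_primitive charK nur.
rewrite scaler_eq0 (negPf (primitive_neq0 cP)) orbF mulf_eq0.
by rewrite (negPf (ncol_neq0 charK _ _)) (negPf (kappa_neq0 charK cP)).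
Qed.

(** The left factor makes the restriction row symmetric for [la], and the right factor ends in the
    column symmetrizer, so [young_sandwich] applies. *)
Lemma top_line y : exists k, top_part (cnu * y * yl) = k *: young K p la.
Proof.
set z := top_part _.
have e1 : yrow K p la * z = nrow K p la *: z.
  rewrite mulr_suml (eq_bigr (fun=> z)) => [|s hs].
    by rewrite sumr_const -scaler_nat.
  rewrite /z -top_part_mull !mulrA rowstab_yrow //; exact: rowstab_pshift.
set w := (yrow K p la * (top_part (cnu * y) * yrow K p la) * ycol K p la) 1%g.
exists ((nrow K p la)^-1 * w); apply: (scalerI (nrow_neq0 charK p la)).
rewrite -e1 scalerA mulVKf ?nrow_neq0 // -young_sandwich //.
by rewrite /z top_part_mulr /young !mulrA.
Qed.

Lemma kkeyE : nrow K p la *: kkey = cnu * yrow K (a + p) nu * yl.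
Proof.
rewrite /young gshM /kkey mulrA scalerAl; congr (_ * _).
rewrite -mulrA scalerAr; congr (_ * _).
rewrite [gsh (yrow _ _ _)]linear_sum mulr_sumr.
rewrite [RHS](eq_bigr (fun=> yrow K (a + p) nu)) => [|s hs].
  by rewrite sumr_const -scaler_nat.
by rewrite /= gmap_delta yrow_rowstab //; apply: rowstab_pshift.
Qed.

Lemma top_part_lin k T T' : top_part (k *: T - T') = k *: top_part T - top_part T'.
Proof. by apply/ffunP => s; rewrite !ffunE. Qed.

(** By [top_line] some multiple of [kkey] has the same restriction to S_p. The difference is Koszul
    and a right multiple of [cnu], so its vanishing [top_part] makes it zero. *)
Lemma kos_line x : kos x -> exists k, cnu * x * yl = k *: kkey.
Proof.
move=> kx; have [k ke] := top_line x; have [k' ke'] := top_line (yrow K (a + p) nu).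
have topk : nrow K p la *: top_part kkey = k' *: young K p la.
  by rewrite -ke' -kkeyE; apply/ffunP => s; rewrite !ffunE.
have tk0 : top_part kkey != 0.
  rewrite /kkey -mulrA; apply: (kos_top_neq0 (la := la)); rewrite mulrA.
    exact: kos_kkey.
  exact: kkey_neq0.
have k'0 : k' != 0.
  apply: contraNneq tk0 => k0; move/eqP: topk; rewrite k0 scale0r scaler_eq0.
  by rewrite (negPf (nrow_neq0 charK _ _)).
pose c := k / k' * nrow K p la; exists c; apply/eqP; rewrite eq_sym -subr_eq0.
have e : c *: kkey - cnu * x * yl =
    cnu * (c *: (yrow K (a + p) nu * gsh (ycol K p la)) - x * yl).
  by rewrite mulrBr -scalerAr !mulrA.
have kz : kos (c *: kkey - cnu * x * yl).
  rewrite -scaleN1r -[cnu * x * yl]mulrA.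
  pose F (b : bool) : A := if b then c *: kkey else (-1) *: (cnu * (x * yl)).
  have := @kos_sum _ F; rewrite big_bool; apply=> -[]; apply: kosZ.
    exact: kos_kkey.
  exact/kos_mull/kos_shift.
apply: contraTT isT => nz.
have := @kos_top_neq0 la (c *: (yrow K (a + p) nu * gsh (ycol K p la)) - x * yl).
rewrite -e => /(_ kz nz); rewrite top_part_lin ke /c -scalerA topk scalerA divfK //.
by rewrite subrr eqxx.
Qed.

(* The two maps between T c_la, for T a Koszul submodule, and the Schur functor
   of (a, la) : right multiplication by [kinv] and by [kkey]. *)
Definition kinv : A := ycol K (a + p) nu * cnu.
Definition kscale : K := ncol K p la * kappa cnu ^+ 2.

Lemma kscale_neq0 : kscale != 0.
Proof.
rewrite mulf_neq0 ?ncol_neq0 // expf_neq0 // kappa_neq0 //.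
exact: young_primitive.
Qed.

Lemma kkey_kinv : kkey * kinv = kscale *: cnu.
Proof.
rewrite /kinv mulrA kkey_ycol -scalerAl primitive_sq; last exact: young_primitive.
by rewrite scalerA /kscale expr2 mulrA.
Qed.

Lemma young_kkey : cnu * kkey = kappa cnu *: kkey.
Proof.
rewrite /kkey -[cnu * _ * gsh _]mulrA [LHS]mulrA primitive_sq -?scalerAl //.
exact: young_primitive.
Qed.

(** When [x * yl] is split over all shapes, only (a, la) survives by [kos_shape], and [kos_line]
    makes each piece a left multiple of [kkey]. There [kinv] followed by [kkey] is a scalar. *)
Lemma kos_kinv_kkey x : sorted geq la -> kos x ->
  x * yl * kinv * kkey = (kscale * kappa cnu) *: (x * yl).
Proof.
move=> las kx; suff [W ->] : exists W, x * yl = W * kkey.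
  rewrite -[W * kkey * kinv]mulrA kkey_kinv -scalerAr -scalerAl -[W * _ * _]mulrA.
  by rewrite young_kkey -scalerAr scalerA.
pose P v := exists W, v = W * kkey.
have P0 : P 0 by exists 0; rewrite mul0r.
have PD v w : P v -> P w -> P (v + w).
  by move=> [V ->] [W ->]; exists (V + W); rewrite mulrDl.
rewrite (complete_sum (x * yl) (young_complete charK (a + p))).
apply: (big_ind P) => // mu _; apply: (big_ind P) => // g _.
set d := gdelta K g; set d' := gdelta K g^-1.
have -> : d * young K (a + p) (parts mu) * (d' * (x * yl)) =
    d * (young K (a + p) (parts mu) * (d' * x) * yl) by rewrite !mulrA.
have [->|nz] := eqVneq (young K (a + p) (parts mu) * (d' * x) * yl) 0.
  by exists 0; rewrite mul0r mulr0 scaler0.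
have kdx : kos (d' * x) := kos_mull d' kx.
rewrite (eq_shape_young K (parts_sumn mu) (kos_shape lap las kdx nz)).
have [k ->] := kos_line kdx; exists ((kappa cnu ^+ 2)^-1 *: (k *: d)).
by rewrite -scalerAr -!scalerAl.
Qed.

Lemma kkey_shift : kkey * yl = kappa (young K p la) *: kkey.
Proof.
apply: (scalerI (nrow_neq0 charK p la)); rewrite scalerAl kkeyE.
rewrite -[_ * yl * yl]mulrA -gshM primitive_sq; last exact: young_primitive.
by rewrite linearZ -scalerAr -kkeyE scalerA mulrC -scalerA.
Qed.

End KeyLine.

(** A surviving component would have shape (a, la), which is not decreasing when an entry of [la]
    exceeds [a]. *)
Lemma kos_zero la k x : sumn la = p -> sorted geq la -> kos x ->
  (a < nth 0%N la k)%N -> x * gsh (young K p la) = 0.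
Proof.
move=> lap las kx lak.
rewrite (complete_sum (x * _) (young_complete charK (a + p))).
apply: big1 => mu _; apply: big1 => g _.
set d := gdelta K g; set d' := gdelta K g^-1; set yl := gsh _.
have -> : d * young K (a + p) (parts mu) * (d' * (x * yl)) =
    d * (young K (a + p) (parts mu) * (d' * x) * yl) by rewrite !mulrA.
have [->|nz] := eqVneq (young K (a + p) (parts mu) * (d' * x) * yl) 0.
  by rewrite mulr0 scaler0.
have e := kos_shape lap las (kos_mull d' kx) nz.
have := sorted_geq_nth (parts_sorted mu) (leq0n k.+1).
by rewrite !e /= leqNgt lak.
Qed.
End Koszul_ideal.

(** * Symmetric groups acting on tensor powers *)

Section Action.
Variables (K : fieldType) (gT : finGroupType) (M : vectType K) (rho : gT -> 'End(M)).

Definition gact (x : galg K gT) : 'End(M) := \sum_g x g *: rho g.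

Lemma gactE x t : gact x t = \sum_g x g *: rho g t.
Proof. by rewrite sum_lfunE; apply: eq_bigr => g _; rewrite scale_lfunE. Qed.

Lemma gact_linear : linear gact.
Proof.
move=> k x y; rewrite scaler_sumr -big_split; apply: eq_bigr => g _ /=.
by rewrite !ffunE scalerDl scalerA.
Qed.
HB.instance Definition _ := GRing.isLinear.Build K (galg K gT) 'End(M) *:%R gact gact_linear.

Lemma gact_delta g : gact (gdelta K g) = rho g.
Proof.
rewrite /gact (bigD1 g) //= big1 ?addr0 => [|k neq].
  by rewrite ffunE eqxx scale1r.
by rewrite ffunE (negPf neq) scale0r.
Qed.

Hypothesis rhoM : forall g h, rho (g * h)%g = (rho h \o rho g)%VF.

Lemma gactME x y t : gact (x * y) t = gact y (gact x t).
Proof.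
have -> : x * y = \sum_g \sum_h (x g * y h) *: gdelta K (g * h).
  rewrite {1}[x]galg_sum mulr_suml; apply: eq_bigr => g _.
  rewrite {1}[y]galg_sum mulr_sumr; apply: eq_bigr => h _.
  by rewrite -scalerAl -scalerAr scalerA gdeltaM.
rewrite (gactE x) (linear_sum (gact y)) (linear_sum gact) sum_lfunE; apply: eq_bigr => g _.
rewrite linearZ /= (gactE y) scaler_sumr (linear_sum gact) sum_lfunE; apply: eq_bigr => h _.
by rewrite linearZ /= gact_delta rhoM scale_lfunE comp_lfunE scalerA.
Qed.

Hypothesis rho1 : rho 1%g = \1%VF.
(* Matrix coefficients embed a right module into copies of the group algebra. *)
Definition mcoef (l : M -> K) (t : M) : galg K gT := [ffun g => l (rho g^-1 t)].

Lemma mcoef_delta l t g : mcoef l (rho g t) = mcoef l t * gdelta K g.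
Proof.
apply/ffunP => h; rewrite gmul_deltaE !ffunE; congr l.
by rewrite invMg invgK rhoM comp_lfunE.
Qed.

Lemma mcoef_linear (l : {linear M -> K^o}) : linear (mcoef l).
Proof. by move=> k s t; apply/ffunP => g; rewrite !ffunE !linearP. Qed.

Lemma mcoefM (l : {linear M -> K^o}) t x : mcoef l (gact x t) = mcoef l t * x.
Proof.
rewrite gactE (linear_comb (mcoef_linear l)) [in RHS](galg_sum x) mulr_sumr.
by apply: eq_bigr => g _; rewrite mcoef_delta -scalerAr.
Qed.

Lemma mcoef_eq0 t :
  (forall l : {linear M -> K^o}, mcoef l t = 0) -> t = 0.
Proof.
move=> h; rewrite (coord_vbasis (memvf t)) big1 // => i _.
have /ffunP /(_ 1%g) := h (coord (vbasis {:M}) i).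
by rewrite !ffunE invg1 rho1 id_lfunE => ->; rewrite scale0r.
Qed.
End Action.

Section KoszulModule.
Variables (K : fieldType) (charK : [pchar K] =i pred0) (a p : nat).
Variables (M : vectType K) (rho : 'S_(a + p) -> 'End(M)).
Hypothesis rhoM : forall g h, rho (g * h)%g = (rho h \o rho g)%VF.
Hypothesis rho1 : rho 1%g = \1%VF.

(** The relations of [kos] for a vector of a right module. Matrix coefficients carry them to the
    group algebra, where the identities for [kkey] and [kinv] hold. *)
Definition kosm (t : M) :=
  (forall i i', rho (tperm (lshift p i) (lshift p i')) t = t) /\
  (forall j, t + \sum_i rho (tperm (lshift p i) (rshift a j)) t = 0).

Lemma kosm_mcoef (l : {linear M -> K^o}) t : kosm t -> kos (mcoef rho l t).
Proof.
move=> [h1 h2]; split=> [i i'|j]; first by rewrite -mcoef_delta // h1.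
under eq_bigr => i _ do rewrite -mcoef_delta //.
have := mcoef_linear rho l; set f := mcoef rho l => fl.
pose F : {linear M -> galg K _} := HB.pack f (GRing.isLinear.Build _ _ _ _ f fl).
by rewrite -[f]/(F : M -> _) -linear_sum -linearD h2 linear0.
Qed.

Variable la : seq nat.
Hypotheses (lap : sumn la = p) (las : sorted geq la).
Local Notation yl := (gmap (@pshift a p) (young K p la)).

Lemma kosm_kinv_kkey t : (forall k, (nth 0%N la k <= a)%N) -> kosm t ->
  gact rho (kkey K a p la) (gact rho (kinv K a p la) (gact rho yl t)) =
  (kscale K a p la * kappa (young K (a + p) (a :: la))) *: gact rho yl t.
Proof.
move=> laa kt; apply/eqP; rewrite -subr_eq0; apply/eqP.
apply: (mcoef_eq0 rho1) => l; have fl := mcoef_linear rho l.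
set f := mcoef rho l in fl *.
pose F : {linear M -> galg K _} := HB.pack f (GRing.isLinear.Build _ _ _ _ f fl).
rewrite -[f]/(F : M -> _) linearB linearZ /= /f !mcoefM //.
by rewrite (kos_kinv_kkey charK lap laa las (kosm_mcoef l kt)) subrr.
Qed.

Lemma kosm_zero k t : (a < nth 0%N la k)%N -> kosm t -> gact rho yl t = 0.
Proof.
move=> lak kt; apply: (mcoef_eq0 rho1) => l; rewrite mcoefM //.
exact: (kos_zero charK lap las (kosm_mcoef l kt) lak).
Qed.

End KoszulModule.

Section TensorPowers.
Variables (K : fieldType).

Lemma tmap_sum (I : finType) (V W : I -> vectType K) (T : I -> finType)
    (c : forall i, T i -> K) (f : forall i, T i -> 'Hom(V i, W i)) :
  tmap (fun i => \sum_(k : T i) c i k *: f i k) =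
  \sum_(t : {dffun forall i, T i}) (\prod_i c i (t i)) *: tmap (fun i => f i (t i)).
Proof.
apply: tens_lfunP => v; rewrite tmap_ptens sum_lfunE.
under eq_bigr => t _ do rewrite scale_lfunE tmap_ptens.
rewrite -(ptens_sum c (fun i k => f i k (v i))); apply: ptens_ext => i.
by rewrite sum_lfunE; apply: eq_bigr => k _; rewrite scale_lfunE.
Qed.

Lemma tmap_ext (I : finType) (V W : I -> vectType K) (f g : forall i, 'Hom(V i, W i)) :
  (forall i, f i = g i) -> tmap f = tmap g.
Proof.
by move=> e; apply: tens_lfunP => v; rewrite !tmap_ptens; apply: ptens_ext => i; rewrite e.
Qed.

Variables (n : nat) (R : 'I_n -> nat).
Local Notation spaces := ('I_n -> vectType K).

Local Notation TV V := (tens (fun i => tpow (R i) (V i))).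

(* V |-> ⊗_i V_i^⊗(R i) *)
Definition TR : mfunctor K n.
Proof.
refine (@MFunctor K n (fun V => TV V) (fun V W f => tmap (fun i => tpow_map (R i) (f i))) _ _).
- by move=> V; rewrite -tmap_id; apply: tmap_ext => i; apply: tmap_id.
by move=> V W Z g f; rewrite -tmap_comp; apply: tmap_ext => i; apply: tmap_comp.
Defined.
Definition GR : finGroupType := {dffun forall i, 'S_(R i)}.
Definition AR := galg K GR.

Definition rhoT (V : spaces) (g : GR) : 'End(TV V) :=
  tmap (fun i => permt (V i) (g i)).

Lemma permt1 r (A : vectType K) : permt A (1 : 'S_r)%g = \1%VF.
Proof.
apply: tens_lfunP => v; rewrite permt_ptens id_lfunE; apply: ptens_ext => i.
by rewrite invg1 perm1.
Qed.

Lemma rhoTM V g h : rhoT V (g * h)%g = (rhoT V h \o rhoT V g)%VF.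
Proof. by rewrite -tmap_comp; apply: tmap_ext => i; rewrite ffunE permtM. Qed.

Lemma rhoT1 V : rhoT V 1%g = \1%VF.
Proof. by rewrite -tmap_id; apply: tmap_ext => i; rewrite ffunE permt1. Qed.

Definition actT (V : spaces) : AR -> 'End(TV V) := gact (rhoT V).
HB.instance Definition _ V := GRing.Linear.on (actT V).

Lemma actTM V x y t : actT V (x * y) t = actT V y (actT V x t).
Proof. exact: gactME (@rhoTM V) x y t. Qed.

Lemma rhoT_natural (V W : spaces) (f : forall i, 'Hom(V i, W i)) g t :
  rhoT W g (tmap (fun i => tpow_map (R i) (f i)) t) =
  tmap (fun i => tpow_map (R i) (f i)) (rhoT V g t).
Proof.
rewrite -!comp_lfunE; congr (fun_of_lfun _ t); rewrite -!tmap_comp.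
apply: tmap_ext => i; apply/lfunP => x; rewrite !comp_lfunE.
exact/esym/tpow_map_permt.
Qed.

Lemma actT_natural x (V W : spaces) (f : forall i, 'Hom(V i, W i)) t :
  actT W x (tmap (fun i => tpow_map (R i) (f i)) t) =
  tmap (fun i => tpow_map (R i) (f i)) (actT V x t).
Proof.
rewrite /actT !gactE linear_sum; apply: eq_bigr => g _.
by rewrite rhoT_natural linearZ.
Qed.

Lemma actT_gtens V (x : forall i, galg K 'S_(R i)) :
  actT V (gtens x) = tmap (fun i => gact (@permt K (R i) (V i)) (x i)).
Proof.
rewrite tmap_sum; apply: eq_bigr => g _.
by rewrite ffunE.
Qed.

End TensorPowers.

(** * Iterated tensor products *)

Section Nested.
Variables (K : fieldType) (I : finType) (J : I -> finType).
Variable V : forall i, J i -> vectType K.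
Arguments V : clear implicits.
Implicit Types (v : forall i j, V i j).

Definition nptens v : tens (fun i => tens (V i)) := ptens (fun i => ptens (v i)).

Lemma nptens_ext (u v : forall i j, V i j) : (forall i j, u i j = v i j) -> nptens u = nptens v.
Proof. by move=> e; apply: ptens_ext => i; apply: ptens_ext => j. Qed.

Definition nidx : finType := {dffun forall i, tidx (V i)}.
Definition nbasis (L : nidx) := nptens (fun i j => ebasis (L i j)).
(** The basis [ebasis] of an inner space [tens (V i)] is an arbitrary one, so coordinates along
    products of the basis vectors of the [V i j] involve a change of basis. *)
Definition ncoord (L : nidx) (t : tens (fun i => tens (V i))) : K^o :=
  \sum_M t M * \prod_i (ebasis (M i) : tens (V i)) (L i).

Lemma ncoord_linear L : linear (ncoord L).
Proof.
move=> k s t; rewrite scaler_sumr -big_split; apply: eq_bigr => M _ /=.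
by rewrite !ffunE mulrDl /GRing.scale /= mulrA.
Qed.
HB.instance Definition _ L := GRing.isLinear.Build K _ K^o *:%R (ncoord L) (ncoord_linear L).

Lemma ncoord_ptens L (t : forall i, tens (V i)) : ncoord L (ptens t) = \prod_i t i (L i).
Proof.
pose F i k := ecoord k (t i) * (ebasis k : tens (V i)) (L i).
transitivity (\prod_i \sum_k F i k).
  rewrite distr_dffun; apply: eq_bigr => M _; rewrite ffunE -big_split.
  by [].
apply: eq_bigr => i _; rewrite [in RHS](ebasis_sum (t i)) sum_ffunE.
by apply: eq_bigr => k _; rewrite ffunE.
Qed.

Lemma ncoord_nptens L v : ncoord L (nptens v) = \prod_i \prod_j ecoord (L i j) (v i j).
Proof. by rewrite ncoord_ptens; apply: eq_bigr => i _; rewrite ffunE. Qed.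

Lemma nptens_sum v :
  nptens v = \sum_(L : nidx) (\prod_i \prod_j ecoord (L i j) (v i j)) *: nbasis L.
Proof.
rewrite /nptens (ptens_ext (fun i => tens_sum (ptens (v i)))) ptens_sum.
by apply: eq_bigr => L _; congr (_ *: _); apply: eq_bigr => i _; rewrite ffunE.
Qed.

Lemma ncoord_sum t : t = \sum_(L : nidx) ncoord L t *: nbasis L.
Proof.
rewrite {1}[t]tens_sum.
transitivity (\sum_M t M *: \sum_(L : nidx) (\prod_i (ebasis (M i) : tens (V i)) (L i)) *: nbasis L).
  apply: eq_bigr => M _; congr (_ *: _).
  by rewrite (ptens_ext (fun i => tens_sum (ebasis (M i) : tens (V i)))) ptens_sum.
under eq_bigr => M _ do rewrite scaler_sumr.
rewrite exchange_big; apply: eq_bigr => L _; rewrite /ncoord scaler_suml.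
by apply: eq_bigr => M _; rewrite scalerA.
Qed.

Lemma nested_lfunP (U : vectType K) (f g : 'Hom(tens (fun i => tens (V i)), U)) :
  (forall v, f (nptens v) = g (nptens v)) -> f = g.
Proof.
move=> fg; apply/lfunP => t; rewrite [t]ncoord_sum !linear_sum.
by apply: eq_bigr => L _; rewrite !linearZ /= fg.
Qed.

Section Ext.
Variables (U : vectType K) (phi : (forall i j, V i j) -> U).
Definition ntext_fun t : U := \sum_(L : nidx) ncoord L t *: phi (fun i j => ebasis (L i j)).
Lemma ntext_linear : linear ntext_fun.
Proof.
move=> k s t; rewrite scaler_sumr -big_split; apply: eq_bigr => L _ /=.
by rewrite linearP scalerDl scalerA.
Qed.
HB.instance Definition _ := GRing.isLinear.Build K _ U *:%R ntext_fun ntext_linear.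
Definition ntext : 'Hom(tens (fun i => tens (V i)), U) := linfun ntext_fun.
Lemma ntext_nptens v :
    phi v = \sum_(L : nidx) (\prod_i \prod_j ecoord (L i j) (v i j)) *:
              phi (fun i j => ebasis (L i j)) ->
  ntext (nptens v) = phi v.
Proof.
move=> ->; rewrite lfunE; apply: eq_bigr => L _.
by rewrite ncoord_nptens.
Qed.
End Ext.

End Nested.

Section Swap.
Variables (K : fieldType) (I J : finType) (V : I -> J -> vectType K).

Definition tswap : 'Hom(tens (fun i => tens (V i)), tens (fun j => tens (fun i => V i j))) :=
  ntext (fun v : forall i j, V i j => nptens (fun j i => v i j)).

Lemma tswap_nptens (v : forall i j, V i j) :
  tswap (nptens v) = nptens (fun j i => v i j).
Proof.
rewrite /tswap ntext_nptens // nptens_sum.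
pose h (L : nidx V) : nidx (fun j i => V i j) := [ffun j => [ffun i => L i j]].
rewrite (reindex h) /=; last first.
  exists (fun M : nidx (fun j i => V i j) => [ffun i => [ffun j => M j i]] : nidx V) => L _;
  by apply/ffunP => i; apply/ffunP => j; rewrite !ffunE.
apply: eq_bigr => L _; congr (_ *: _).
  rewrite exchange_big; apply: eq_bigr => i _; apply: eq_bigr => j _.
  by rewrite !ffunE.
by apply: nptens_ext => j i; rewrite !ffunE.
Qed.
End Swap.

Lemma tswapK (K : fieldType) (I J : finType) (V : I -> J -> vectType K) :
  cancel (tswap V) (tswap (fun j i => V i j)).
Proof.
move=> t; rewrite -comp_lfunE -[RHS]id_lfunE; congr (fun_of_lfun _ t).
by apply: nested_lfunP => v; rewrite comp_lfunE !tswap_nptens id_lfunE.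
Qed.

Section Concatenation.
Variables (K : fieldType) (k l r : nat) (f : 'I_k -> 'I_r) (g : 'I_l -> 'I_r).
Variable A : vectType K.

Definition tcat (s : tpow k A) (t : tpow l A) : tpow r A :=
  [ffun J : tidx (fun _ : 'I_r => A) => s [ffun i => J (f i)] * t [ffun j => J (g j)]].

Lemma tcat_linearl t : linear (tcat^~ t).
Proof. by move=> c u v; apply/ffunP => J; rewrite !ffunE mulrDl -mulrA. Qed.
Lemma tcat_linearr s : linear (tcat s).
Proof.
move=> c u v; apply/ffunP => J; rewrite !ffunE mulrDr.
by congr (_ + _); rewrite /GRing.scale /= mulrCA.
Qed.

(** Expresses that [f] and [g] together enumerate each of the r positions once, in the form in which
    it applies to coordinates of pure tensors. *)
Definition shuffle := forall F : 'I_r -> K, \prod_x F x = (\prod_i F (f i)) * \prod_j F (g j).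
Hypothesis fg : shuffle.

Lemma tcat_ptens (u : 'I_r -> A) :
  tcat (ptens (fun i => u (f i))) (ptens (fun j => u (g j))) = ptens u.
Proof.
apply/ffunP => J; rewrite !ffunE fg; congr (_ * _).
  by apply: eq_bigr => i _; rewrite ffunE.
by apply: eq_bigr => i _; rewrite ffunE.
Qed.
End Concatenation.

Section Dimensions.
Variable K : fieldType.

Lemma dim_tens (I : finType) (V : I -> vectType K) :
  \dim {:tens V} = (\prod_i \dim {:V i})%N.
Proof.
transitivity (#|tidx V| * 1)%N; first by rewrite dimvf.
rewrite muln1 card_dep_ffun.
rewrite foldrE big_map big_enum /=.
by apply: eq_bigr => i _; rewrite card_ord.
Qed.

Lemma dim_tens2 (A B : vectType K) : \dim {:tens2 A B} = (\dim {:A} * \dim {:B})%N.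
Proof. by rewrite dimvf dim_matrix. Qed.

Lemma lfun_surj_bij (A B : vectType K) (f : 'Hom(A, B)) :
  \dim {:A} = \dim {:B} -> limg f = fullv -> bijective f.
Proof.
move=> d e; have k0 : lker f == 0%VS.
  by rewrite -dimv_eq0 -(eqn_add2r (\dim (limg f))) -{1}(capfv (lker f)) limg_ker_dim e d add0n.
exists (f^-1)%VF; first exact: lker0_lfunK.
by move=> x; apply: limg_lfunVK; rewrite e memvf.
Qed.

End Dimensions.

Record shuffle_data (k l r : nat) := Shuffle {
  sl : 'I_k -> 'I_r;
  sr : 'I_l -> 'I_r;
  sp : 'I_r -> 'I_k + 'I_l;
  spl : forall i, sp (sl i) = inl i;
  spr : forall j, sp (sr j) = inr j;
  spK : forall x, match sp x with inl i => sl i | inr j => sr j end = x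
}.

Section Shuffles.
Variables (k l r : nat) (s : shuffle_data k l r).

Lemma shuffle_prod (T : Type) (idx : T) (op : Monoid.com_law idx) (F : 'I_r -> T) :
  \big[op/idx]_x F x =
  op (\big[op/idx]_i F (sl s i)) (\big[op/idx]_j F (sr s j)).
Proof.
rewrite (reindex (fun u => match u with inl i => sl s i | inr j => sr s j end)).
  by rewrite big_sumType.
exists (sp s) => [[i|j]|x] _; [exact: spl | exact: spr | exact: spK].
Qed.

Lemma shuffle_size : r = (k + l)%N.
Proof.
have := shuffle_prod addn (fun=> 1%N).
by rewrite !sum_nat_const !card_ord !muln1.
Qed.

Lemma sl_inj : injective (sl s).
Proof. by move=> i j e; have := spl s i; rewrite e spl => -[]. Qed.
Lemma sl_sr i j : sl s i != sr s j.
Proof. by apply/eqP => e; have := spl s i; rewrite e spr. Qed.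

Definition glue (T : Type) (v : 'I_k -> T) (w : 'I_l -> T) x : T :=
  match sp s x with inl i => v i | inr j => w j end.
Lemma gluel T (v : 'I_k -> T) w i : glue v w (sl s i) = v i.
Proof. by rewrite /glue spl. Qed.
Lemma gluer T (v : 'I_k -> T) w i : glue v w (sr s i) = w i.
Proof. by rewrite /glue spr. Qed.

End Shuffles.

Definition shuffle_split (d p : nat) : shuffle_data d p (d + p).
Proof.
exists (@lshift d p) (@rshift d p) (@split d p) => [i|j|x].
- exact: (unsplitK (inl i)).
- exact: (unsplitK (inr j)).
by rewrite -[RHS]splitK; case: (split x).
Defined.

(** After the differential the first exterior factor belongs to the symmetric part, where [tcons]
    puts it in front. Sending [ord0] to position d, its place under [shuffle_split d p.+1], keeps
    every vector where it was in the common space of d + p + 1 factors. *)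
Definition shuffle_next (d p : nat) : shuffle_data d.+1 p (d + p.+1).
Proof.
exists (fun i : 'I_d.+1 => if unlift ord0 i is Some j then lshift p.+1 j else rshift d ord0)
  (fun j : 'I_p => rshift d (lift ord0 j))
  (fun x => match split x with
            | inl i => inl (lift ord0 i)
            | inr j => if unlift ord0 j is Some j' then inr j' else inl ord0
            end) => [i|j|x].
- case: unliftP => [j|] ->; first by rewrite (unsplitK (inl j)).
  by rewrite (unsplitK (inr ord0)) unlift_none.
- by rewrite (unsplitK (inr (lift ord0 j))) liftK.
rewrite -[RHS]splitK; case: (split x) => [i|j] /=; first by rewrite liftK.
by case: unliftP => [j'|] -> //; rewrite unlift_none.
Defined.

Section Phi.
Variables (K : fieldType) (n l : nat) (k R : 'I_n -> nat).
Variables (s : forall i, shuffle_data (k i) l (R i)) (V : 'I_n -> vectType K).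

Definition Phi_fun (X : tpow l (tens V)) (Y : tens (fun i => tpow (k i) (V i))) :
    tens (fun i => tpow (R i) (V i)) :=
  tens_mul (fun i => @tcat K _ _ _ (sl (s i)) (sr (s i)) (V i)) Y
    (tswap (fun (_ : 'I_l) i => V i) X).

Definition Phi : 'Hom(tens2 (tpow l (tens V)) (tens (fun i => tpow (k i) (V i))),
    tens (fun i => tpow (R i) (V i))) := text2 Phi_fun.

Lemma Phi_ptens2 X Y : Phi (ptens2 X Y) = Phi_fun X Y.
Proof.
rewrite /Phi text2_ptens2 // => [Y' c u v|X' c u v].
  by rewrite /Phi_fun linearP tens_mul_linearr.
by rewrite /Phi_fun tens_mul_linearl.
Qed.

Lemma Phi_ptens (w : 'I_l -> forall i, V i) (M : forall i, tpow (k i) (V i)) :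
  Phi (ptens2 (nptens (fun j i => w j i)) (ptens M)) =
  ptens (fun i => tcat (sl (s i)) (sr (s i)) (M i) (ptens (fun j => w j i))).
Proof.
rewrite Phi_ptens2 /Phi_fun tswap_nptens tens_mul_ptens // => i x.
  exact: tcat_linearl.
exact: tcat_linearr.
Qed.

Lemma Phi_nptens (u : forall i, 'I_(R i) -> V i) :
  Phi (ptens2 (nptens (fun j i => u i (sr (s i) j)) : tpow l (tens V))
              (nptens (fun i x => u i (sl (s i) x)))) = nptens u.
Proof.
rewrite (Phi_ptens (fun j i => u i (sr (s i) j))); apply: ptens_ext => i.
by apply: tcat_ptens => F; apply: shuffle_prod.
Qed.

Lemma tens2_nested_lfunP (U : vectType K)
  (f g : 'Hom(tens2 (tpow l (tens V)) (tens (fun i => tpow (k i) (V i))), U)) :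
  (forall (u : forall i, 'I_(R i) -> V i),
    f (ptens2 (nptens (fun j i => u i (sr (s i) j)) : tpow l (tens V))
              (nptens (fun i x => u i (sl (s i) x)))) =
    g (ptens2 (nptens (fun j i => u i (sr (s i) j)) : tpow l (tens V))
              (nptens (fun i x => u i (sl (s i) x))))) -> f = g.
Proof.
move=> fg; apply: tens2_lfunP => X Y.
rewrite [X](ncoord_sum (V := fun (_ : 'I_l) i => V i)).
rewrite [Y](ncoord_sum (V := fun i (_ : 'I_(k i)) => V i)).
rewrite (linear_comb (ptens2_linearl _)) !linear_sum; apply: eq_bigr => L _.
rewrite (linear_comb (ptens2_linearr _)) !linearZ /= !linear_sum.
apply: eq_bigr => M _ /=; congr (_ *: _); rewrite !linearZ /=; congr (_ *: _).
pose u i x := glue (s i) (fun y => ebasis (M i y)) (fun j => ebasis (L j i)) x.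
have := fg u.
have -> : nptens (fun j i => u i (sr (s i) j)) = nbasis L.
  by apply: nptens_ext => j i; rewrite /u gluer.
have -> // : nptens (fun i x => u i (sl (s i) x)) = nbasis M.
by apply: nptens_ext => j i; rewrite /u gluel.
Qed.

Lemma Phi_bij : bijective Phi.
Proof.
apply: lfun_surj_bij.
  have dt r A : \dim {:tpow r A} = (\dim {:A} ^ r)%N by rewrite dim_tens prod_nat_const card_ord.
  rewrite dim_tens2 dt !dim_tens (big_morph _ (fun x y => expnMn x y l) (exp1n l)) -big_split.
  apply: eq_bigr => i _ /=.
  by rewrite !dt (shuffle_size (s i)) expnD mulnC.
apply/eqP; rewrite eqEsubv subvf; apply/subvP => t _.
rewrite [t](ncoord_sum (V := fun i (_ : 'I_(R i)) => V i)).
apply: memv_suml => L _; apply: memvZ; rewrite /nbasis -Phi_nptens.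
by rewrite memv_img ?memvf.
Qed.

Lemma Phi_equivariant (sg : 'S_l) (t : forall i, 'S_(k i)) (g : forall i, 'S_(R i)) m :
    (forall i x, g i (sl (s i) x) = sl (s i) (t i x)) ->
    (forall i j, g i (sr (s i) j) = sr (s i) (sg j)) ->
  Phi (tmap2 (permt (tens V) sg) (tmap (fun i => permt (V i) (t i))) m) =
  tmap (fun i => permt (V i) (g i)) (Phi m).
Proof.
move=> gl gr; rewrite -!comp_lfunE; congr (fun_of_lfun _ m).
apply: tens2_nested_lfunP => u; rewrite !comp_lfunE tmap2_ptens2 Phi_nptens.
rewrite !tmap_ptens permt_ptens.
pose u' i x := u i ((g i)^-1%g x).
transitivity (nptens u'); last by apply: ptens_ext => i; rewrite permt_ptens.
rewrite -Phi_nptens; congr (Phi (ptens2 _ _)).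
  apply: nptens_ext => j i; rewrite /u'; congr (u i _).
  by apply: (@perm_inj _ (g i)); rewrite permKV gr permKV.
apply: ptens_ext => i; rewrite permt_ptens; apply: ptens_ext => x.
rewrite /u'; congr (u i _).
by apply: (@perm_inj _ (g i)); rewrite permKV gl permKV.
Qed.
End Phi.

(** * The kernel of the Koszul differential *)

Lemma vsvalE (K : fieldType) (A : vectType K) (U : {vspace A}) (x : subvs_of U) :
  linfun vsval x = vsval x.
Proof. by rewrite lfunE. Qed.

Section SymmetricProduct.
Variables (K : fieldType) (charK : [pchar K] =i pred0) (d : nat) (A : vectType K).

Lemma permt_symt (s : 'S_d) t : t \in limg (symt d A) -> permt A s t = t.
Proof.
case/memv_imgP => u _ ->; rewrite sum_lfunE linear_sum [RHS](reindex_inj (mulIg s)) /=.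
by apply: eq_bigr => g _; rewrite permtM comp_lfunE.
Qed.

Lemma permt_tcons (s : 'S_d) v (t : tpow d A) :
  permt A (lift_perm ord0 ord0 s) (tcons v t) = tcons v (permt A s t).
Proof.
apply/ffunP => J; rewrite permtE !ffunE lift_perm_id permtE; congr (_ * t _).
by apply/ffunP => i; rewrite !ffunE lift_perm_lift.
Qed.

(** The indicator of [s] sums to 1 over the permutations with the same value at [ord0]; rewritten as
    a sum over lifts, it has a nonzero term. *)
Lemma lift_perm_ex (s : 'S_d.+1) : exists t, s = lift_perm ord0 (s ord0) t.
Proof.
have := @sum_lift_perm K d (s ord0) K^o (fun t => (t == s)%:R).
rewrite (bigD1 s) //= eqxx big1 ?addr0 => [|t /andP [_ /negPf ->]]; last by [].
move=> e.
have [t /eqP et|nt] := pickP (fun t => lift_perm ord0 (s ord0) t == s); first by exists t.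
move: e; rewrite big1 => [/eqP|t _]; first by rewrite oner_eq0.
by rewrite nt.
Qed.

(** As [f] is symmetric, a permuted tensor depends only on where [v] lands, and each of the d + 1
    positions occurs d! times. *)
Lemma smul_sum v (f : sym_space d A) : vsval (smul v f) =
  (d.+1)%:R^-1 *: \sum_(k < d.+1) permt A (tperm ord0 k) (tcons v (vsval f)).
Proof.
set X := tcons v (vsval f).
have XE k (s : 'S_d.+1) : s ord0 = k -> permt A s X = permt A (lift_perm ord0 k 1) X.
  move=> <-; have [t {1}->] := lift_perm_ex s.
  rewrite -[t in LHS]mulg1 -(lift_permM ord0 ord0) permtM comp_lfunE permt_tcons.
  by rewrite permt_symt // subvsP.
rewrite smul_val -/X sum_lfunE (partition_big (fun s : 'S_d.+1 => s ord0) predT) //=.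
rewrite factS natrM invfM -scalerA scaler_sumr; congr (_ *: _).
apply: eq_bigr => k _; rewrite sum_lift_perm.
rewrite (eq_bigr (fun=> permt A (tperm ord0 k) X)) => [|s _].
  rewrite sumr_const card_Sn -scaler_nat scalerA mulVf ?scale1r //.
  by rewrite natK_eq0 // -lt0n fact_gt0.
by rewrite !(XE k) ?tpermL // lift_perm_id.
Qed.

End SymmetricProduct.

Lemma ptensZ (K : fieldType) (I : finType) (V : I -> vectType K) (c : I -> K)
    (x : forall i, V i) :
  ptens (fun i => c i *: x i) = (\prod_i c i) *: ptens x.
Proof.
apply/ffunP => J; rewrite !ffunE /GRing.scale /= -big_split.
by apply: eq_bigr => i _; rewrite linearZ.
Qed.

(** * The Koszul differential as a group algebra element *)

Section Embedding.
Variables (K : fieldType) (charK : [pchar K] =i pred0) (n : nat).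
Local Notation spaces := ('I_n -> vectType K).

Definition ks_incl (p : nat) (dd : 'I_n -> nat) (V : spaces) :
  'Hom(tens2 (ext_space p (tens V)) (tens (fun i => sym_space (dd i) (V i))),
       tens2 (tpow p (tens V)) (tens (fun i => tpow (dd i) (V i)))) :=
  tmap2 (linfun vsval) (tmap (fun i => linfun vsval)).

Definition kemb (p : nat) (dd R : 'I_n -> nat)
    (s : forall i, shuffle_data (dd i) p (R i)) (V : spaces) :
  'Hom(tens2 (ext_space p (tens V)) (tens (fun i => sym_space (dd i) (V i))),
       tens (fun i => tpow (R i) (V i))) := (Phi s V \o ks_incl p dd V)%VF.

Variables (p : nat) (dd : 'I_n -> nat).

Definition Dslot d : galg K 'S_(d + p.+1) :=
  \sum_(k < d.+1) gdelta K (tperm (sl (shuffle_next d p) ord0) (sl (shuffle_next d p) k)).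

(** The formula of [smul_sum] extended to arbitrary tensors, so that multiplication is given by
    transpositions. *)
Definition smul_avg d (A : vectType K) (v : A) (t : tpow d A) : tpow d.+1 A :=
  (d.+1)%:R^-1 *: \sum_(k < d.+1) permt A (tperm ord0 k) (tcons v t).

Lemma smul_avg_linearl d (A : vectType K) (t : tpow d A) : linear (fun v => smul_avg v t).
Proof.
move=> c u v; rewrite /smul_avg scalerA mulrC -scalerA -scalerDr; congr (_ *: _).
rewrite scaler_sumr -big_split; apply: eq_bigr => k _ /=.
by rewrite tcons_linearl linearP.
Qed.
Lemma smul_avg_linearr d (A : vectType K) (v : A) : linear (@smul_avg d A v).
Proof.
move=> c s t; rewrite /smul_avg scalerA mulrC -scalerA -scalerDr; congr (_ *: _).
rewrite scaler_sumr -big_split; apply: eq_bigr => k _ /=.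
by rewrite tcons_linearr linearP.
Qed.

Definition kdelta (V : spaces) :
  'Hom(tens2 (tpow p.+1 (tens V)) (tens (fun i => tpow (dd i) (V i))),
       tens2 (tpow p (tens V)) (tens (fun i => tpow (dd i).+1 (V i)))) :=
  text2 (fun X Y => \sum_k ptens2 (tcontr k X)
    (tens_mul (fun i => @smul_avg (dd i) (V i)) (ebasis k) Y)).

Lemma kdelta_ptens2 V X Y : kdelta V (ptens2 X Y) = \sum_k ptens2 (tcontr k X)
    (tens_mul (fun i => @smul_avg (dd i) (V i)) (ebasis k) Y).
Proof.
rewrite /kdelta text2_ptens2 // => [Y' c u v|X' c u v].
  rewrite scaler_sumr -big_split; apply: eq_bigr => k _ /=.
  by rewrite tcontr_linear ptens2_linearl.
rewrite scaler_sumr -big_split; apply: eq_bigr => k _ /=.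
by rewrite tens_mul_linearr ptens2_linearr.
Qed.

Definition smul_tens (V : spaces) :
    tens V -> tens (fun i => sym_space (dd i) (V i)) ->
    tens (fun i => sym_space (dd i).+1 (V i)) :=
  tens_mul (fun i => @smul K (dd i) (V i)).

Lemma ks_incl_smul_tens V (a : tens V) m :
  tmap (fun i => linfun vsval) (smul_tens a m) =
  tens_mul (fun i => @smul_avg (dd i) (V i)) a (tmap (fun i => linfun vsval) m).
Proof.
rewrite -[a in RHS]id_lfunE -tmap_id; apply: tens_mul_natural.
- by move=> i u; apply: smul_linearl.
- by move=> i u; apply: smul_linearr.
- by move=> i u; apply: smul_avg_linearl.
- by move=> i u; apply: smul_avg_linearr.
by move=> i u v; rewrite id_lfunE vsvalE [in RHS]vsvalE smul_sum.
Qed.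

Lemma ks_incl_kdiff V y :
  ks_incl p (fun i => (dd i).+1) V (kdiff p (@smul_tens V) y) =
  kdelta V (ks_incl p.+1 dd V y).
Proof.
rewrite -[LHS]comp_lfunE -[RHS]comp_lfunE; congr (fun_of_lfun _ y).
apply: tens2_lfunP => x m; rewrite [LHS]comp_lfunE [RHS]comp_lfunE.
rewrite kdiff_ptens2; last by move=> a; apply: tens_mul_linearr.
rewrite tmap2_ptens2 kdelta_ptens2 linear_sum; apply: eq_bigr => k _.
rewrite [LHS]tmap2_ptens2 ks_incl_smul_tens vsvalE contr_val.
by rewrite [in RHS]vsvalE.
Qed.

Definition kscal : K := \prod_(i < n) (dd i).+1%:R^-1.

Lemma kdelta_ptens V (w : 'I_p.+1 -> tens V) (Y : tens (fun i => tpow (dd i) (V i))) :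
  kdelta V (ptens2 (ptens w : tpow p.+1 (tens V)) Y) =
  ptens2 (ptens (fun j => w (lift ord0 j)) : tpow p (tens V))
    (tens_mul (fun i => @smul_avg (dd i) (V i)) (w ord0) Y).
Proof.
rewrite kdelta_ptens2 [in RHS](ebasis_sum (w ord0)).
rewrite (linear_comb (tens_mul_linearl _ _)) (linear_comb (ptens2_linearr _)).
apply: eq_bigr => k _; rewrite tcontr_ptens.
have := @linear_comb K _ _ _ (ptens2_linearl (A := tpow p (tens V))
   (tens_mul (fun i => @smul_avg (dd i) (V i)) (ebasis k) Y))
   'I_1 (fun=> ecoord k (w ord0)) (fun=> ptens (fun i : 'I_p => w (lift ord0 i))).
by rewrite !big_ord1.
Qed.

Lemma tcat_smul_avg d (A : vectType K) (u : 'I_(d + p.+1) -> A) :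
  tcat (sl (shuffle_next d p)) (sr (shuffle_next d p))
    (smul_avg (u (rshift d ord0)) (ptens (fun x => u (lshift p.+1 x))))
    (ptens (fun j => u (rshift d (lift ord0 j)))) =
  (d.+1)%:R^-1 *: gact (@permt K (d + p.+1) A) (Dslot d) (ptens u).
Proof.
set S := shuffle_next d p.
rewrite /smul_avg; have cl := tcat_linearl (sl S) (sr S) (A := A).
have := @linear_comb K _ _ _ (cl (ptens (fun j => u (rshift d (lift ord0 j))))).
move=> /(_ 'I_d.+1 (fun=> (d.+1)%:R^-1)) e; rewrite scaler_sumr e {e}.
rewrite (linear_sum (gact _)) sum_lfunE scaler_sumr; apply: eq_bigr => k _; congr (_ *: _).
rewrite /= gact_delta permt_ptens tpermV tcons_ptens permt_ptens tpermV.
rewrite -(tcat_ptens (f := sl S) (g := sr S)); last by move=> F; apply: shuffle_prod.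
congr (tcat _ _ _ _); apply: ptens_ext => i; last first.
  by rewrite tpermD ?sl_sr.
rewrite -(inj_tperm _ _ _ (@sl_inj _ _ _ S)) /=.
by case: unliftP.
Qed.

(** With these arrangements of source and target, contraction followed by [tcons] moves nothing.
    What remains is the sum of transpositions in each slot, and [kscal] collects the denominators of
    the averages. *)
Lemma Phi_kdelta V m :
  Phi (fun i => shuffle_next (dd i) p) V (kdelta V m) =
  kscal *: actT V (gtens (fun i => Dslot (dd i)))
    (Phi (fun i => shuffle_split (dd i) p.+1) V m).
Proof.
rewrite -scale_lfunE -!comp_lfunE; congr (fun_of_lfun _ m).
apply: (tens2_nested_lfunP (s := fun i => shuffle_split (dd i) p.+1)) => u.
rewrite !comp_lfunE scale_lfunE Phi_nptens kdelta_ptens.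
rewrite tens_mul_ptens; last 2 first.
- by move=> i x; apply: smul_avg_linearl.
- by move=> i x; apply: smul_avg_linearr.
rewrite (Phi_ptens _ (fun j i => u i (rshift (dd i) (lift ord0 j)))).
rewrite (ptens_ext (fun i => tcat_smul_avg (u i))) actT_gtens tmap_ptens.
exact: ptensZ.
Qed.

Lemma kemb_kdiff V y :
  kemb (fun i => shuffle_next (dd i) p) V (kdiff p (@smul_tens V) y) =
  kscal *: actT V (gtens (fun i => Dslot (dd i)))
    (kemb (fun i => shuffle_split (dd i) p.+1) V y).
Proof.
by rewrite /kemb [LHS]comp_lfunE ks_incl_kdiff Phi_kdelta [in RHS]comp_lfunE.
Qed.

Lemma kscal_neq0 : kscal != 0.
Proof. by apply/prodf_neq0 => i _; rewrite invr_eq0 natK_eq0. Qed.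

End Embedding.

Section TensorMaps.
Variable K : fieldType.

Lemma lfun_injP (A B : vectType K) (f : 'Hom(A, B)) : injective f -> (f^-1 \o f)%VF = \1%VF.
Proof. by move=> fI; apply: lker0_compVf; apply/lker0P. Qed.

Lemma tmap2_inj (A B A' B' : vectType K) (f : 'Hom(A, A')) (g : 'Hom(B, B')) :
  injective f -> injective g -> injective (tmap2 f g).
Proof.
move=> fI gI; apply: (can_inj (g := tmap2 f^-1%VF g^-1%VF)) => x.
by rewrite -comp_lfunE -tmap2_comp !lfun_injP // tmap2_id id_lfunE.
Qed.

Lemma tmap_inj (I : finType) (V W : I -> vectType K) (f : forall i, 'Hom(V i, W i)) :
  (forall i, injective (f i)) -> injective (tmap f).
Proof.
move=> fI; apply: (can_inj (g := tmap (fun i => (f i)^-1%VF))) => x.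
rewrite -comp_lfunE -tmap_comp -[RHS]id_lfunE -tmap_id; congr (fun_of_lfun _ x).
by apply: tmap_ext => i; apply: lfun_injP.
Qed.

Lemma vsval_lfun_inj (A : vectType K) (U : {vspace A}) :
  injective (linfun (vsval : subvs_of U -> A)).
Proof. by move=> x y; rewrite !lfunE => /val_inj. Qed.

Lemma tmap2_suml (A B A' B' : vectType K) (I : finType) (c : I -> K)
    (f : I -> 'Hom(A, A')) (g : 'Hom(B, B')) :
  tmap2 (\sum_i c i *: f i) g = \sum_i c i *: tmap2 (f i) g.
Proof.
apply: tens2_lfunP => a b; rewrite tmap2_ptens2 !sum_lfunE.
under eq_bigr => i _ do rewrite scale_lfunE.
rewrite (linear_comb (ptens2_linearl _)); apply: eq_bigr => i _.
by rewrite scale_lfunE tmap2_ptens2.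
Qed.

Lemma tmap2_sumr (A B A' B' : vectType K) (I : finType) (c : I -> K)
    (f : 'Hom(A, A')) (g : I -> 'Hom(B, B')) :
  tmap2 f (\sum_i c i *: g i) = \sum_i c i *: tmap2 f (g i).
Proof.
apply: tens2_lfunP => a b; rewrite tmap2_ptens2 !sum_lfunE.
under eq_bigr => i _ do rewrite scale_lfunE.
rewrite (linear_comb (ptens2_linearr _)); apply: eq_bigr => i _.
by rewrite scale_lfunE tmap2_ptens2.
Qed.

Lemma nptens_map (I : finType) (J : I -> finType) (V W : forall i, J i -> vectType K)
    (f : forall i j, 'Hom(V i j, W i j)) (v : forall i j, V i j) :
  tmap (fun i => tmap (f i)) (nptens v) = nptens (fun i j => f i j (v i j)).
Proof. by rewrite tmap_ptens; apply: ptens_ext => i; rewrite tmap_ptens. Qed.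

End TensorMaps.

Section Naturality.
Variables (K : fieldType) (n p : nat) (dd R : 'I_n -> nat).
Variable s : forall i, shuffle_data (dd i) p (R i).
Local Notation spaces := ('I_n -> vectType K).

Variables (V W : spaces) (f : forall i, 'Hom(V i, W i)).

Let mW : 'Hom(tpow p (tens V), tpow p (tens W)) := tpow_map p (tmap f).
Let mS : 'Hom(tens (fun i => tpow (dd i) (V i)), tens (fun i => tpow (dd i) (W i))) :=
  tmap (fun i => tpow_map (dd i) (f i)).
Definition ext_map : 'Hom(ext_space p (tens V), ext_space p (tens W)) :=
  fmap (ExtF p (TensV K n)) f.
Definition sym_map i : 'Hom(sym_space (dd i) (V i), sym_space (dd i) (W i)) :=
  fmap (SymF (dd i) (ProjF K i)) f.
Local Notation eW := ext_map.
Local Notation eS := sym_map.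

Lemma ext_incl : (linfun vsval \o eW)%VF = (mW \o linfun vsval)%VF.
Proof.
apply/lfunP => x; rewrite [LHS]comp_lfunE [RHS]comp_lfunE [LHS]vsvalE [in RHS]vsvalE.
exact: (@Ext_val K n p (TensV K n) V W f x).
Qed.

Lemma sym_incl i : (linfun vsval \o eS i)%VF = (tpow_map (dd i) (f i) \o linfun vsval)%VF.
Proof.
apply/lfunP => x; rewrite [LHS]comp_lfunE [RHS]comp_lfunE [LHS]vsvalE [in RHS]vsvalE.
exact: (@Sym_val K n (dd i) (ProjF K i) V W f x).
Qed.

Lemma ks_incl_natural :
  (ks_incl p dd W \o tmap2 eW (tmap eS) = tmap2 mW mS \o ks_incl p dd V)%VF.
Proof.
rewrite /ks_incl -!tmap2_comp ext_incl -!tmap_comp; congr tmap2.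
by apply: tmap_ext => i; apply: sym_incl.
Qed.

Lemma Phi_natural :
  (Phi s W \o tmap2 mW mS = tmap (fun i => tpow_map (R i) (f i)) \o Phi s V)%VF.
Proof.
apply: (tens2_nested_lfunP (s := s)) => u.
rewrite [LHS]comp_lfunE [RHS]comp_lfunE tmap2_ptens2 Phi_nptens.
rewrite [RHS](nptens_map (fun i (_ : 'I_(R i)) => f i)) -(Phi_nptens s).
congr (fun_of_lfun _ (ptens2 _ _)).
  exact: (nptens_map (fun (_ : 'I_p) i => f i)).
exact: (nptens_map (fun i (_ : 'I_(dd i)) => f i)).
Qed.

Lemma kemb_natural y :
  kemb s W (tmap2 eW (tmap eS) y) = tmap (fun i => tpow_map (R i) (f i)) (kemb s V y).
Proof.
rewrite -[LHS]comp_lfunE -[RHS]comp_lfunE; congr (fun_of_lfun _ y).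
by rewrite /kemb -comp_lfunA ks_incl_natural !comp_lfunA Phi_natural.
Qed.
End Naturality.

(** The differential yields the relation only at the factor that it contracts, the first one. The
    diagonal transposition of [j] and [j'] acts on [t] by a sign and carries the relation at one to
    that at the other. *)
Lemma antisym_kosm_shift (K : fieldType) (a p : nat) (M : vectType K)
    (rs : 'S_(a + p) -> 'End(M)) (rd : 'S_p -> 'End(M)) (t : M) :
    (forall sg, rd sg t = (-1) ^+ sg *: t) ->
    (forall sg u, rd sg (rs u t) = rs (u ^ pshift a sg)%g ((-1) ^+ sg *: t)) ->
  forall j j', t + \sum_i rs (tperm (lshift p i) (rshift a j)) t = 0 ->
    t + \sum_i rs (tperm (lshift p i) (rshift a j')) t = 0.
Proof.
move=> tA rA j j' e; pose sg := tperm j j'.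
transitivity ((-1) ^+ sg *: rd sg (t + \sum_i rs (tperm (lshift p i) (rshift a j)) t)).
  rewrite (linearD (rd sg)) (linear_sum (rd sg)) /= scalerDr tA scalerA -expr2 sqrr_sign.
  rewrite scale1r scaler_sumr; congr (_ + _); apply: eq_bigr => i _ /=.
  rewrite rA linearZ /= scalerA -expr2 sqrr_sign scale1r tpermJ pshiftl pshiftr.
  by rewrite /sg tpermL.
by rewrite e linear0 scaler0.
Qed.

Section KernelFunctor.
Variables (K : fieldType) (charK : [pchar K] =i pred0) (n p : nat) (dd : 'I_n -> nat).
Local Notation R := (fun i => (dd i + p)%N).
Local Notation spaces := ('I_n -> vectType K).

Definition diag (sg : 'S_p) : GR R := [ffun i => pshift (dd i) sg].

Variable i0 : 'I_n.
Hypothesis dd0 : forall i, i != i0 -> dd i = 0%N.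

Definition slot (s : 'S_(dd i0 + p)) : GR R := finfun (dfwith (fun i : 'I_n => 1%g : 'S_(R i)) s).

Lemma slotM : {morph slot : s t / (s * t)%g}.
Proof.
move=> s t; apply/ffunP => i; rewrite !ffunE.
have [<-|ne] := eqVneq i0 i; first by rewrite !dfwith_in.
by rewrite !dfwith_out // mulg1.
Qed.
Lemma slot1 : slot 1 = 1%g.
Proof.
apply/ffunP => i; rewrite !ffunE.
by have [<-|ne] := eqVneq i0 i; rewrite ?dfwith_in ?dfwith_out.
Qed.

Lemma slot_diag s sg : (slot s * diag sg = diag sg * slot (s ^ pshift (dd i0) sg))%g.
Proof.
apply/ffunP => i; rewrite !ffunE.
have [<-|ne] := eqVneq i0 i; last by rewrite !dfwith_out // mulg1 mul1g.
by rewrite !dfwith_in conjgE !mulgA mulgV mul1g.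
Qed.

Definition rslot (V : spaces) s : 'End(tens (fun i => tpow (R i) (V i))) := rhoT V (slot s).
Lemma rslotM V s t : rslot V (s * t)%g = (rslot V t \o rslot V s)%VF.
Proof. by rewrite /rslot slotM rhoTM. Qed.
Lemma rslot1 V : rslot V 1%g = \1%VF.
Proof. by rewrite /rslot slot1 rhoT1. Qed.

(* The elements of the Koszul kernel inside ⊗ V_i^⊗(d_i + p). *)
Definition koszul_tensor V (t : tens (fun i => tpow (R i) (V i))) :=
  (forall sg, rhoT V (diag sg) t = (-1) ^+ sg *: t) /\ kosm (rslot V) t.

Local Notation kq V := (@kemb K n p dd R (fun i => shuffle_split (dd i) p) V).

Lemma kq_inj V : injective (kq V).
Proof.
move=> x y; rewrite /kemb !comp_lfunE => /(bij_inj (Phi_bij _ _)).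
by apply: tmap2_inj; [apply: vsval_lfun_inj | apply: tmap_inj => i; apply: vsval_lfun_inj].
Qed.

Lemma perm0_eq d (s t : 'S_d) : d = 0%N -> s = t.
Proof. by move=> d0; apply/permP => -[x xd]; exfalso; rewrite d0 in xd. Qed.

Lemma slot_equivariant V (s : 'S_(dd i0)) (g : 'S_(dd i0 + p)) m :
    (forall x, g (lshift p x) = lshift p (s x)) ->
    (forall x, g (rshift (dd i0) x) = rshift (dd i0) x) ->
  Phi (fun i => shuffle_split (dd i) p) V
    (tmap2 \1%VF (tmap (fun i => permt (V i) (dfwith (fun i : 'I_n => 1%g : 'S_(dd i)) s i))) m) =
  rslot V g (Phi (fun i => shuffle_split (dd i) p) V m).
Proof.
move=> gl gr; rewrite -(permt1 p (tens V)).
rewrite (Phi_equivariant (g := slot g)) // => i x; rewrite ffunE; move: x.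
  have [<-|ne] := eqVneq i0 i; first by move=> x; rewrite !dfwith_in gl.
  by move=> x; rewrite !dfwith_out // !perm1.
have [<-|ne] := eqVneq i0 i; first by move=> x; rewrite !dfwith_in gr perm1.
by move=> x; rewrite !dfwith_out // !perm1.
Qed.

Lemma gtens_slot (x : galg K 'S_(dd i0 + p)) :
  gtens (dfwith (fun i : 'I_n => 1 : galg K 'S_(R i)) x) = gmap slot x.
Proof.
apply/ffunP => g; rewrite ffunE sum_ffunE (bigD1 i0) //= dfwith_in.
have [/forallP g1|/forallPn [i]] := boolP [forall i, (i != i0) ==> (g i == 1%g)].
  have gE : g = slot (g i0).
    apply/ffunP => i; rewrite ffunE; have [<-|ne] := eqVneq i0 i; first by rewrite dfwith_in.
    by rewrite dfwith_out //; apply/eqP; have := g1 i; rewrite eq_sym ne.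
  rewrite big1 ?mulr1 => [|i ne]; last first.
    by rewrite dfwith_out 1?eq_sym // galg1E ffunE; have := g1 i; rewrite ne /= => ->.
  rewrite (bigD1 (g i0)) //= big1 ?addr0 => [|s ne]; last first.
    rewrite !ffunE gE; case: eqP => [/ffunP /(_ i0)|_]; last by rewrite scaler0.
    by rewrite !ffunE !dfwith_in => e; rewrite e eqxx in ne.
  by rewrite !ffunE -gE eqxx /GRing.scale /= mulr1.
rewrite negb_imply => /andP [ne gi]; rewrite (bigD1 i) //= dfwith_out 1?eq_sym //.
rewrite galg1E ffunE (negPf gi) mul0r mulr0 big1 // => s _; rewrite !ffunE.
case: eqP => [e|_]; last by rewrite scaler0.
by rewrite e ffunE dfwith_out 1?eq_sym // eqxx in gi.
Qed.

Lemma actT_slot V (x : galg K 'S_(dd i0 + p)) :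
  actT V (gmap slot x) = gact (rslot V) x.
Proof.
rewrite (linear_sum (actT V)); apply: eq_bigr => s _.
by rewrite linearZ /= /actT gact_delta.
Qed.

Section Image.
Variable V : spaces.
Local Notation incl := (ks_incl p dd V).

Lemma permt_asymt r (A : vectType K) (s : 'S_r) t : t \in limg (asymt r A) ->
  permt A s t = (-1) ^+ s *: t.
Proof.
case/memv_imgP => u _ ->; rewrite sum_lfunE linear_sum scaler_sumr.
rewrite [RHS](reindex_inj (mulIg s)) /=; apply: eq_bigr => g _.
rewrite !scale_lfunE linearZ /= scalerA permtM comp_lfunE odd_permM signr_addb.
by rewrite [_ * (-1) ^+ s]mulrC signrMK.
Qed.

Lemma kq_diag sg y : rhoT V (diag sg) (kq V y) = (-1) ^+ sg *: kq V y.
Proof.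
rewrite /kemb comp_lfunE.
rewrite -(Phi_equivariant (s := fun i => shuffle_split (dd i) p) (g := diag sg)
  (sg := sg) (t := fun=> 1%g)); last first.
- by move=> i j; rewrite ffunE pshiftr.
- by move=> i x; rewrite ffunE pshiftl perm1.
suff e : (tmap2 (permt (tens V) sg) (tmap (fun i => permt (V i) 1%g)) \o incl =
    (-1) ^+ sg *: incl)%VF.
  by rewrite -[tmap2 _ _ (incl y)]comp_lfunE e scale_lfunE linearZ.
apply: tens2_lfunP => x m; rewrite comp_lfunE scale_lfunE /ks_incl !tmap2_ptens2.
rewrite vsvalE permt_asymt ?subvsP //.
have := @linear_comb K _ _ _ (ptens2_linearl (A := tpow p (tens V))
  (tmap (fun i => linfun vsval) m : tens (fun i => tpow (dd i) (V i))))
  'I_1 (fun=> (-1) ^+ sg) (fun=> vsval x).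
rewrite !big_ord1 => <-; congr ptens2.
rewrite -[RHS]id_lfunE -tmap_id; congr (fun_of_lfun _ _).
by apply: tmap_ext => i; rewrite permt1.
Qed.

Lemma kq_sym i i' y : rslot V (tperm (lshift p i) (lshift p i')) (kq V y) = kq V y.
Proof.
rewrite /kemb comp_lfunE -(slot_equivariant (s := tperm i i')); last first.
- by move=> x; rewrite tpermD // eq_lrshift.
- by move=> x; rewrite inj_tperm //; apply: lshift_inj.
rewrite -[tmap2 _ _ (incl y)]comp_lfunE; congr (fun_of_lfun _ (fun_of_lfun _ y)).
rewrite /ks_incl -tmap2_comp -tmap_comp; congr tmap2.
  by apply/lfunP => x; rewrite comp_lfunE id_lfunE.
apply: tmap_ext => j; apply/lfunP => x; rewrite comp_lfunE vsvalE.
by rewrite permt_symt // subvsP.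
Qed.

Lemma koszul_tensor_shift t : (forall sg, rhoT V (diag sg) t = (-1) ^+ sg *: t) ->
  forall j j', t + \sum_i rslot V (tperm (lshift p i) (rshift (dd i0) j)) t = 0 ->
    t + \sum_i rslot V (tperm (lshift p i) (rshift (dd i0) j')) t = 0.
Proof.
move=> tA; apply: (antisym_kosm_shift (rd := fun sg => rhoT V (diag sg))) => // sg u.
have e : (rhoT V (diag sg) \o rhoT V (slot u) =
    rhoT V (slot (u ^ pshift (dd i0) sg)%g) \o rhoT V (diag sg))%VF.
  by rewrite -!rhoTM slot_diag.
rewrite -[LHS]comp_lfunE [(_ \o _)%VF]e [LHS]comp_lfunE.
congr (fun_of_lfun _ _); exact: tA.
Qed.

End Image.
End KernelFunctor.

Lemma Dslot0 (K : fieldType) p d : d = 0%N -> Dslot K p d = 1.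
Proof. by move=> ->; rewrite /Dslot big_ord1 tperm1. Qed.

Section KernelImage.
Variables (K : fieldType) (charK : [pchar K] =i pred0) (n : nat) (dd : 'I_n -> nat).
Variable i0 : 'I_n.
Hypothesis dd0 : forall i, i != i0 -> dd i = 0%N.
Local Notation spaces := ('I_n -> vectType K).
Local Notation kq p V := (@kemb K n p dd (fun i => dd i + p)%N (fun i => shuffle_split (dd i) p) V).

(** In the slots with [dd i] zero, multiplication starts from Sym^0 and [Dslot] is 1; only slot [i0]
    contributes transpositions. *)
Lemma actT_Dslot p V t : actT V (gtens (fun i => Dslot K p (dd i))) t =
  t + \sum_i rslot (i0 := i0) V (tperm (lshift p.+1 i) (rshift (dd i0) ord0)) t.
Proof.
rewrite (@gtens_ext K _ _ _ (dfwith (fun i : 'I_n => 1 : galg K 'S_(dd i + p.+1)) (Dslot K p (dd i0)))).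
  rewrite gtens_slot actT_slot /Dslot (linear_sum (gact _)) sum_lfunE big_ord_recl.
  rewrite /= gact_delta tperm1 rslot1 id_lfunE; congr (_ + _); apply: eq_bigr => i _.
  by rewrite /= gact_delta unlift_none liftK tpermC.
move=> i; have [<-|ne] := eqVneq i0 i; first by rewrite dfwith_in.
by rewrite dfwith_out // Dslot0 // dd0 // eq_sym.
Qed.

Lemma kq_relation q V y : kdiff q (@smul_tens K n dd V) y = 0 -> forall j,
  kq q.+1 V y + \sum_i rslot (i0 := i0) V (tperm (lshift q.+1 i) (rshift (dd i0) j)) (kq q.+1 V y) = 0.
Proof.
move=> y0 j; have D0 : actT V (gtens (fun i => Dslot K q (dd i))) (kq q.+1 V y) = 0.
  apply: (scalerI (kscal_neq0 charK dd)); rewrite scaler0.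
  by rewrite -[LHS](kemb_kdiff charK y) y0 linear0.
rewrite actT_Dslot in D0.
have H := @koszul_tensor_shift K n q.+1 dd i0 V (kq q.+1 V y) (@kq_diag K n q.+1 dd V ^~ y).
exact: H D0.
Qed.

Definition ks_cycle p V : tens2 (ext_space p (tens V)) (tens (fun i => sym_space (dd i) (V i))) -> Prop :=
  match p with 0 => fun _ => True | q.+1 => fun y => kdiff q (@smul_tens K n dd V) y = 0 end.

Lemma kq_koszul p V y : ks_cycle y -> koszul_tensor i0 (kq p V y).
Proof.
move=> yZ; split=> [sg|]; first exact: kq_diag.
split=> [i i'|]; first exact: kq_sym.
case: p y yZ => [y _ [] //|q y]; exact: kq_relation.
Qed.

End KernelImage.

Section KernelSurjective.
Variables (K : fieldType) (charK : [pchar K] =i pred0) (n : nat) (dd : 'I_n -> nat).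
Variable i0 : 'I_n.
Hypothesis dd0 : forall i, i != i0 -> dd i = 0%N.
Variables (p : nat) (V : 'I_n -> vectType K).
Local Notation R := (fun i => (dd i + p)%N).
Local Notation kq := (@kemb K n p dd R (fun i => shuffle_split (dd i) p) V).
Local Notation PhiV := (@Phi K n p dd R (fun i => shuffle_split (dd i) p) V).

(** Transpositions generate the group in slot [i0], and the groups in the other slots are
    trivial. *)
Lemma permt_slot_inv m :
    (forall x y, tmap2 \1%VF (tmap (fun i => permt (V i)
        (dfwith (fun i : 'I_n => 1%g : 'S_(dd i)) (tperm x y : 'S_(dd i0)) i))) m = m) ->
  forall s : {dffun forall i, 'S_(dd i)},
    tmap2 (\1%VF : 'End(tpow p (tens V))) (tmap (fun i => permt (V i) (s i))) m = m.
Proof.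
move=> mT s; pose f (s0 : 'S_(dd i0)) := tmap2 (\1%VF : 'End(tpow p (tens V)))
  (tmap (fun i => permt (V i) (dfwith (fun i : 'I_n => 1%g : 'S_(dd i)) s0 i))).
have -> : tmap (fun i => permt (V i) (s i)) =
    tmap (fun i => permt (V i) (dfwith (fun i : 'I_n => 1%g : 'S_(dd i)) (s i0) i)).
  apply: tmap_ext => i; have [<-|ne] := eqVneq i0 i; first by rewrite dfwith_in.
  by rewrite dfwith_out //; congr permt; apply: perm0_eq; apply: dd0; rewrite eq_sym.
have fM u v : f (u * v)%g = (f v \o f u)%VF.
  rewrite /f -tmap2_comp -tmap_comp comp_lfun1l; congr tmap2; apply: tmap_ext => i.
  have [<-|ne] := eqVneq i0 i; first by rewrite !dfwith_in permtM.
  by rewrite !dfwith_out // permt1 comp_lfun1l.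
have f1 : f 1%g = \1%VF.
  rewrite /f -tmap2_id -tmap_id; congr tmap2; apply: tmap_ext => i.
  by have [<-|ne] := eqVneq i0 i; rewrite ?dfwith_in ?dfwith_out // permt1.
rewrite -/(f (s i0)); have [ts -> _] := prod_tpermP (s i0).
elim: ts => [|[x y] ts IHts]; first by rewrite big_nil f1 id_lfunE.
rewrite big_cons fM [LHS]comp_lfunE -[RHS]IHts.
by congr (fun_of_lfun _ _); apply: mT.
Qed.

(** Pulled back along [Phi], [t] is fixed by the normalized antisymmetrizer and symmetrizers, whose
    composite factors through the exterior and symmetric powers. *)
Lemma koszul_tensor_image (t : tens (fun i => tpow (R i) (V i))) : koszul_tensor i0 t -> exists y, kq y = t.
Proof.
move=> [tA [tS _]]; have [Psi PsiK PhiK] := Phi_bij (fun i => shuffle_split (dd i) p) V.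
pose m := Psi t.
have mt : PhiV m = t by rewrite PhiK.
have mA sg : tmap2 (permt (tens V) sg) \1%VF m = (-1) ^+ sg *: m.
  apply: (can_inj PsiK); rewrite linearZ /= mt -tA -mt.
  rewrite -[RHS](Phi_equivariant (sg := sg) (t := fun=> 1%g)); last first.
  - by move=> i j; rewrite ffunE pshiftr.
  - by move=> i x; rewrite ffunE pshiftl perm1.
  congr (fun_of_lfun _ (fun_of_lfun (tmap2 _ _) _)).
  by rewrite -tmap_id; apply: tmap_ext => i; rewrite permt1.
have mS s := permt_slot_inv (m := m) _ s.
have {}mS : forall s : {dffun forall i, 'S_(dd i)},
    tmap2 (\1%VF : 'End(tpow p (tens V))) (tmap (fun i => permt (V i) (s i))) m = m.
  apply: permt_slot_inv => x y; apply: (can_inj PsiK).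
  rewrite (slot_equivariant (g := tperm (lshift p x) (lshift p y))).
  - by rewrite mt tS.
  - by move=> z; rewrite inj_tperm //; apply: lshift_inj.
  by move=> z; rewrite tpermD // eq_lrshift.
have fact0 k : (k`!)%:R != 0 :> K by rewrite natK_eq0 // -lt0n fact_gt0.
have e1 : tmap2 (p`!%:R^-1 *: asymt p (tens V)) \1%VF m = m.
  rewrite /asymt scaler_sumr; under eq_bigr => s _ do rewrite scalerA.
  rewrite tmap2_suml sum_lfunE.
  rewrite (eq_bigr (fun=> p`!%:R^-1 *: m)) => [|s _].
    by rewrite sumr_const card_Sn -scaler_nat scalerA mulfV ?scale1r.
  by rewrite scale_lfunE mA scalerA -mulrA -expr2 sqrr_sign mulr1.
have e2 : tmap2 (\1%VF : 'End(tpow p (tens V)))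
    (tmap (fun i => (dd i)`!%:R^-1 *: symt (dd i) (V i))) m = m.
  rewrite (tmap_ext (g := fun i => \sum_(s : 'S_(dd i)) (dd i)`!%:R^-1 *: permt (V i) s)).
    rewrite tmap_sum tmap2_sumr sum_lfunE.
    rewrite (eq_bigr (fun=> (\prod_i (dd i)`!%:R^-1) *: m)) => [|s _].
      rewrite -scaler_suml.
      rewrite -(distr_dffun (fun i (s : 'S_(dd i)) => (dd i)`!%:R^-1)) big1 ?scale1r //.
      by move=> i _; rewrite sumr_const card_Sn -[LHS]mulr_natr mulVf.
    by rewrite scale_lfunE mS.
  by move=> i; rewrite scaler_sumr.
pose fA : 'Hom(tpow p (tens V), ext_space p (tens V)) :=
  (linfun (vsproj _) \o (p`!%:R^-1 *: asymt p (tens V)))%VF.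
pose fS i : 'Hom(tpow (dd i) (V i), sym_space (dd i) (V i)) :=
  (linfun (vsproj _) \o ((dd i)`!%:R^-1 *: symt (dd i) (V i)))%VF.
have e : (ks_incl p dd V \o tmap2 fA (tmap fS) =
    tmap2 (p`!%:R^-1 *: asymt p (tens V)) \1 \o
    tmap2 (\1%VF : 'End(tpow p (tens V))) (tmap (fun i => (dd i)`!%:R^-1 *: symt (dd i) (V i))))%VF.
  rewrite /ks_incl -!tmap2_comp -tmap_comp comp_lfun1l comp_lfun1r.
  congr tmap2; last first.
    apply: tmap_ext => i; apply/lfunP => x.
    rewrite [LHS]comp_lfunE vsvalE comp_lfunE lfunE /= vsprojK //.
    by rewrite scale_lfunE memvZ // memv_img ?memvf.
  apply/lfunP => x; rewrite [LHS]comp_lfunE vsvalE comp_lfunE lfunE /= vsprojK //.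
  by rewrite scale_lfunE memvZ // memv_img ?memvf.
exists (tmap2 fA (tmap fS) m).
rewrite [LHS]comp_lfunE -mt; congr (fun_of_lfun _ _).
rewrite -[LHS]comp_lfunE e [LHS]comp_lfunE.
by rewrite -[RHS]e1 -[in RHS]e2.
Qed.

(** The relation at the first exterior factor says that the differential vanishes after [kemb],
    which is injective on its target. *)
Lemma koszul_tensor_cycle y : koszul_tensor i0 (kq y) -> ks_cycle y.
Proof.
case: p y => [//|q] y yk.
have [_ [_ /(_ ord0)]] := yk; rewrite -actT_Dslot // => D0.
have inj : injective (@kemb K n q _ _ (fun i => shuffle_next (dd i) q) V).
  move=> u v; rewrite /kemb [LHS]comp_lfunE [RHS]comp_lfunE => /(bij_inj (Phi_bij _ _)).
  by apply: tmap2_inj; [apply: vsval_lfun_inj | apply: tmap_inj => i; apply: vsval_lfun_inj].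
apply: inj; rewrite linear0 [LHS](kemb_kdiff charK y).
by rewrite [X in _ *: X]D0 scaler0.
Qed.

End KernelSurjective.

Section Quotient.
Variables (K : fieldType) (n : nat) (F : mfunctor K n).
Variables (Z B : forall V : 'I_n -> vectType K, {vspace F V}).
Variables (stZ : sub_stable Z) (stB : sub_stable B).
Hypothesis B0 : forall V, B V = 0%VS.

Lemma QuoF_zero : exists chi : forall V, 'Hom(QuoF stZ stB V, F V),
  [/\ natural chi, forall V, injective (chi V) &
      forall V x, x \in Z V <-> exists y, chi V y = x].
Proof.
exists (fun V => linfun (vsval : subvs_of (Z V :\: B V)%VS -> F V)); split.
- move=> V W f x; rewrite vsvalE [in RHS]vsvalE.
  have Zx : vsval x \in Z V by apply: subvP (subvsP x); apply: diffvSl.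
  have b0 b : b \in B W -> b = 0 by rewrite B0 memv0 => /eqP.
  have /b0 /eqP := quo_class_rep (B W) (@stZ _ _ f _ Zx); rewrite subr_eq0 => /eqP e.
  rewrite [RHS]e; congr vsval.
  rewrite [LHS]comp_lfunE [LHS]comp_lfunE; congr (quo_class _ _ (fmap F f _)).
  exact: vsvalE.
- by move=> V; apply: vsval_lfun_inj.
move=> V x; split=> [Zx|[y <-]]; last first.
  by rewrite vsvalE; apply: subvP (subvsP y); apply: diffvSl.
have Zx' : x \in (Z V :\: B V)%VS.
  have : (Z V <= Z V :\: B V)%VS.
    by rewrite -{1}(addv_diff_cap (Z V) (B V)) B0 capv0 addv0.
  by move/subvP; apply.
by exists (vsproj _ x); rewrite vsvalE vsprojK.
Qed.
End Quotient.

Section KoszulEmbedding.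
Variables (K : fieldType) (charK : [pchar K] =i pred0) (n p : nat) (dd : 'I_n -> nat).
Variable i0 : 'I_n.
Hypothesis dd0 : forall i, i != i0 -> dd i = 0%N.
Local Notation R := (fun i => (dd i + p)%N).

Lemma Kcycles_ks (V : 'I_n -> vectType K) y :
  y \in Kcycles p (fun i => Posz (dd i)) V <-> @ks_cycle K n dd p V y.
Proof.
case: p y => [|q] y; first exact: (conj (fun _ => I) (fun _ => memvf y)).
rewrite memv_ker; apply: iff_sym; exact: (rwP eqP).
Qed.

(** [z] is a variable with an equation because the degrees of the Koszul complex equal [Posz (dd i)]
    only propositionally, and the type of [KTerm] depends on them. *)
Lemma KTerm_embedding (z : 'I_n -> int) : z = (fun i => Posz (dd i)) ->
  exists phi : forall V, 'Hom(KTerm K p z V, TR K R V),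
  [/\ natural phi, forall V, injective (phi V) &
      forall V (t : TR K R V), koszul_tensor (p := p) i0 t <->
        exists2 y, y \in Kcycles p z V & phi V y = t].
Proof.
move=> ->.
exists (fun V => @kemb K n p dd R (fun i => shuffle_split (dd i) p) V); split.
- move=> V W f y; exact: (kemb_natural (fun i => shuffle_split (dd i) p) f y).
- by move=> V; apply: kq_inj.
move=> V t; split=> [kt|[y /Kcycles_ks yZ <-]]; last exact: kq_koszul.
have [y yt] := koszul_tensor_image charK dd0 kt.
exists y => //; apply/Kcycles_ks; apply: (koszul_tensor_cycle charK dd0).
by rewrite yt.
Qed.
End KoszulEmbedding.

(** * Direct sums of functors *)

Section TrivialSpaces.
Variable K : fieldType.

Definition trivial_space (A : vectType K) := forall x y : A, x = y.

Lemma trivial_dim (A : vectType K) : trivial_space A -> \dim {:A} = 0%N.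
Proof.
move=> tA; apply/eqP; rewrite dimv_eq0 -subv0; apply/subvP => x _.
by rewrite (tA x 0) mem0v.
Qed.

Lemma dim_trivial (A : vectType K) : \dim {:A} = 0%N -> trivial_space A.
Proof.
move=> d0 x y; have /subvP z : ({:A} <= 0)%VS by rewrite subv0 -dimv_eq0 d0.
by have := z x (memvf x); have := z y (memvf y); rewrite !memv0 => /eqP -> /eqP ->.
Qed.

Lemma tens_trivial (I : finType) (V : I -> vectType K) i :
  trivial_space (V i) -> trivial_space (tens V).
Proof.
by move=> tV; apply: dim_trivial; rewrite dim_tens (bigD1 i) //= trivial_dim // mul0n.
Qed.

Lemma tens2_trivial (A B : vectType K) : trivial_space B -> trivial_space (tens2 A B).
Proof. by move=> tB; apply: dim_trivial; rewrite dim_tens2 (trivial_dim tB) muln0. Qed.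

Variable n : nat.

Lemma ZSymF_trivial (d : int) (F : mfunctor K n) V : d < 0 -> trivial_space (ZSymF d F V).
Proof. by case: d => // k _ x y; apply: zero_uniq. Qed.

Lemma KTerm_trivial p (d : 'I_n -> int) (V : 'I_n -> vectType K) i : d i < 0 -> trivial_space (KTerm K p d V).
Proof.
move=> di; apply: tens2_trivial; apply: (@tens_trivial _ _ i).
exact: ZSymF_trivial.
Qed.

Lemma Kboundaries_trivial p (d : 'I_n -> int) (V : 'I_n -> vectType K) i : d i < 0 -> Kboundaries p d V = 0%VS.
Proof.
move=> di; apply/eqP; rewrite -subv0; apply/subvP => x /memv_imgP [y _ ->].
by rewrite (@KTerm_trivial p.+1 d V i di y 0) linear0 mem0v.
Qed.

Lemma QuoF_trivial (F : mfunctor K n) (Z B : forall V, {vspace F V})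
    (stZ : sub_stable Z) (stB : sub_stable B) V :
  trivial_space (F V) -> trivial_space (QuoF stZ stB V).
Proof. by move=> tF x y; apply: val_inj; apply: tF. Qed.

Lemma Koszul_trivial p q (b : 'I_n -> int) (V : 'I_n -> vectType K) i : b i + q < 0 -> trivial_space (Koszul K p q b V).
Proof.
move=> di; apply: QuoF_trivial; apply: (@KTerm_trivial _ _ _ i).
by rewrite /twist; apply: le_lt_trans di; lia.
Qed.

Lemma nat_iso_trivial (F G : mfunctor K n) :
  (forall V, trivial_space (F V)) -> (forall V, trivial_space (G V)) -> nat_iso F G.
Proof.
move=> tF tG; exists (fun V => 0); split=> [V W f x|V]; first exact: tG.
by exists (fun _ => 0) => x; [apply: tF | apply: tG].
Qed.

Lemma copies_trivial m (F : mfunctor K n) :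
  (forall V, trivial_space (F V)) -> forall V, trivial_space (copies m F V).
Proof.
move=> tF V; elim: m => [x y|m IHm [x1 x2] [y1 y2]]; first exact: zero_uniq.
by congr (_, _); [apply: tF | apply: IHm].
Qed.

Lemma big_dsum_trivial (I : finType) (F : I -> mfunctor K n) :
  (forall i V, trivial_space (F i V)) -> forall V, trivial_space (big_dsum F V).
Proof.
move=> tF V; rewrite /big_dsum; elim/big_rec: _ => [x y|i G _ tG [x1 x2] [y1 y2]].
  exact: zero_uniq.
by congr (_, _); [apply: tF | apply: tG].
Qed.

End TrivialSpaces.

Section KoszulGroup.
Variables (K : fieldType) (charK : [pchar K] =i pred0) (n p : nat) (dd : 'I_n -> nat).
Variables (i0 j0 : 'I_n) (q : int) (b : 'I_n -> int).
Hypothesis dd0 : forall i, i != i0 -> dd i = 0%N.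
Hypothesis bE : forall i, b i + q = Posz (dd i).
Hypothesis b0 : b j0 + q = 0.

Lemma Koszul_embedding :
  exists phi : forall V, 'Hom(Koszul K p q b V, TR K (fun i => dd i + p)%N V),
  [/\ natural phi, forall V, injective (phi V) &
      forall V (t : TR K (fun i => dd i + p)%N V), koszul_tensor (p := p) i0 t <->
        exists y, phi V y = t].
Proof.
pose e : 'I_n -> int := fun i => b i + (q - 1).
have ze : twist e = (fun i => Posz (dd i)).
  by apply: functional_extensionality_dep => i; rewrite /twist /e -bE; lia.
have [phi [nphi iphi kphi]] := KTerm_embedding charK p dd0 ze.
have Be (V : 'I_n -> vectType K) : Kboundaries p e V = 0%VS.
  apply: (@Kboundaries_trivial K n p e V j0); rewrite /e.
  by have := b0; lia.
have [chi [nchi ichi kchi]] :=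
  QuoF_zero (@Kcycles_stable K n p (twist e)) (@Kboundaries_stable K n p e) Be.
exists (fun V => (phi V \o chi V)%VF); split.
- by move=> V W f x; rewrite [LHS]comp_lfunE nchi nphi [in RHS]comp_lfunE.
- by move=> V x y; rewrite [LHS]comp_lfunE [RHS]comp_lfunE => /iphi /ichi.
move=> V t; rewrite kphi; split=> [[y /kchi [x <-] <-]|[x <-]].
  by exists x; rewrite comp_lfunE.
by exists (chi V x); [apply/kchi; exists x | rewrite comp_lfunE].
Qed.
End KoszulGroup.

Section PairMaps.
Variables (K : fieldType) (A B C : vectType K).

Section Out.
Variables (f : 'Hom(A, C)) (g : 'Hom(B, C)).
Definition pair_out_fun (x : A * B) : C := f x.1 + g x.2.
Lemma pair_out_linear : linear pair_out_fun.
Proof. by move=> c x y; rewrite /pair_out_fun !linearP scalerDr addrACA. Qed.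
HB.instance Definition _ :=
  GRing.isLinear.Build K (A * B)%type C *:%R pair_out_fun pair_out_linear.
Definition pair_out : 'Hom((A * B)%type, C) := linfun pair_out_fun.
Lemma pair_outE x : pair_out x = f x.1 + g x.2. Proof. by rewrite lfunE. Qed.
End Out.

Section In.
Variables (f : 'Hom(C, A)) (g : 'Hom(C, B)).
Definition pair_in_fun (x : C) : A * B := (f x, g x).
Lemma pair_in_linear : linear pair_in_fun.
Proof. by move=> c x y; rewrite /pair_in_fun !linearP. Qed.
HB.instance Definition _ :=
  GRing.isLinear.Build K C (A * B)%type *:%R pair_in_fun pair_in_linear.
Definition pair_in : 'Hom(C, (A * B)%type) := linfun pair_in_fun.
Lemma pair_inE x : pair_in x = (f x, g x). Proof. by rewrite lfunE. Qed.
End In.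
End PairMaps.

Section DirectSums.
Variables (K : fieldType) (n : nat).
Local Notation functor := (mfunctor K n).
Local Notation spaces := ('I_n -> vectType K).
Local Notation nmap F G := (forall V : spaces, 'Hom(fobj F V, fobj G V)).

Definition dsum_list (s : seq functor) : functor := foldr (@DSumF K n) (@ZeroF K n) s.

(* A family of orthonormal pairs of natural maps F_k -> Q -> F_k identifies the
   direct sum of the F_k with the image of the idempotent \sum_k u_k v_k of Q. *)
Lemma dsum_list_split (Q : functor) (I : eqType) (F : I -> functor)
    (u : forall k, nmap (F k) Q) (v : forall k, nmap Q (F k)) (s : seq I) :
    (forall k, natural (u k)) -> (forall k, natural (v k)) -> uniq s ->
    (forall k V x, k \in s -> v k V (u k V x) = x) ->
    (forall k l V x, k \in s -> l \in s -> k != l -> v l V (u k V x) = 0) ->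
  exists (phi : nmap (dsum_list [seq F k | k <- s]) Q)
         (psi : nmap Q (dsum_list [seq F k | k <- s])),
  [/\ natural phi, natural psi, forall V x, psi V (phi V x) = x &
      forall V x, phi V (psi V x) = \sum_(k <- s) u k V (v k V x)].
Proof.
move=> nu nv; elim: s => [_ _ _|a s IHs /= /andP [as_ us] vu vu0].
  exists (fun V => 0), (fun V => 0); split=> [V W f x|V W f x|V x|V x].
  - by rewrite !zero_lfunE linear0.
  - exact: zero_uniq.
  - exact: zero_uniq.
  by rewrite big_nil !zero_lfunE.
have [||phi [psi [nphi npsi psiK phiE]]] := IHs us.
- by move=> k V x ks; apply: vu; rewrite inE ks orbT.
- by move=> k l V x ks ls; apply: vu0; rewrite inE ?ks ?ls orbT.
have va0 V x : v a V (phi V x) = 0.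
  rewrite -[x](psiK V) phiE linear_sum big1_seq // => k /andP [_ ks].
  apply: vu0; rewrite ?mem_head //; first by rewrite inE ks orbT.
  by apply: contraNneq as_ => <-.
have ua0 V x : psi V (u a V x) = 0.
  rewrite -(psiK V (psi V _)) phiE big1_seq ?linear0 // => k /andP [_ ks].
  rewrite vu0 ?linear0 ?mem_head //; first by rewrite inE ks orbT.
  by apply: contraNneq as_ => ->.
pose D := dsum_list [seq F k | k <- s].
pose P V : 'Hom(DSumF (F a) D V, Q V) := pair_out (u a V) (phi V).
pose S V : 'Hom(Q V, DSumF (F a) D V) := pair_in (v a V) (psi V).
exists P, S; split=> [V W f [x y]|V W f x|V [x y]|V x].
- rewrite [LHS]pair_outE /= pair_lfunE /= nu nphi -linearD; congr (fmap Q f _).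
  by rewrite [RHS]pair_outE.
- by rewrite [LHS]pair_inE /= pair_lfunE [S V x]pair_inE /= nv npsi.
- rewrite [LHS]pair_inE [P V _]pair_outE /= !linearD /= va0 ua0 psiK vu ?mem_head //.
  by rewrite addr0 add0r.
by rewrite [LHS]pair_outE [S V x]pair_inE /= phiE big_cons.
Qed.

Lemma copiesE m (F : functor) : copies m F = dsum_list (nseq m F).
Proof. by elim: m => //= m ->. Qed.

Lemma copies_split (Q F : functor) m (u : 'I_m -> nmap F Q) (v : 'I_m -> nmap Q F) :
    (forall k, natural (u k)) -> (forall k, natural (v k)) ->
    (forall k l V x, v l V (u k V x) = if k == l then x else 0) ->
  exists (phi : nmap (copies m F) Q) (psi : nmap Q (copies m F)),
  [/\ natural phi, natural psi, forall V x, psi V (phi V x) = x &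
      forall V x, phi V (psi V x) = \sum_k u k V (v k V x)].
Proof.
move=> nu nv vu; have -> : copies m F = dsum_list [seq F | k <- enum 'I_m].
  by rewrite copiesE; congr dsum_list; rewrite -{1}(size_enum_ord m); elim: (enum _) => //= x s ->.
have [||phi [psi [? ? ? e]]] :=
  @dsum_list_split Q _ (fun=> F) u v (enum 'I_m) nu nv (enum_uniq _).
- by move=> k V x _; rewrite vu eqxx.
- by move=> k l V x _ _ /negPf kl; rewrite vu kl.
by exists phi, psi; split=> // V x; rewrite e big_enum.
Qed.

Lemma big_dsumE (I : finType) (F : I -> functor) :
  big_dsum F = dsum_list [seq F k | k <- index_enum I].
Proof. by rewrite /big_dsum /dsum_list foldrE big_map. Qed.

Lemma big_dsum_copies_iso (Q : functor) (I : finType) (F : I -> functor) (m : I -> nat)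
    (u : forall i, 'I_(m i) -> nmap (F i) Q) (v : forall i, 'I_(m i) -> nmap Q (F i)) :
    (forall i k, natural (u i k)) -> (forall i k, natural (v i k)) ->
    (forall i k l V x, v i l V (u i k V x) = if k == l then x else 0) ->
    (forall i j k l V x, i != j -> v j l V (u i k V x) = 0) ->
    (forall V x, x = \sum_i \sum_(k < m i) u i k V (v i k V x)) ->
  nat_iso Q (big_dsum (fun i => copies (m i) (F i))).
Proof.
move=> nu nv vu vu0 uv.
pose X i := cid (copies_split (nu i) (nv i) (vu i)).
pose phi i := projT1 (X i); pose Y i := cid (projT2 (X i)).
pose psi i := projT1 (Y i).
have XP i : [/\ natural (phi i), natural (psi i), forall V x, psi i V (phi i V x) = x &
    forall V x, phi i V (psi i V x) = \sum_k u i k V (v i k V x)] := projT2 (Y i).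
have nphi i : natural (phi i) by have [] := XP i.
have npsi i : natural (psi i) by have [] := XP i.
have psiK i V x : psi i V (phi i V x) = x by have [_ _ ->] := XP i.
have phiE i V x : phi i V (psi i V x) = \sum_k u i k V (v i k V x) by have [_ _ _ ->] := XP i.
have orth i j V x : i != j -> psi j V (phi i V x) = 0.
  move=> ij; rewrite -(psiK j V (psi j V _)) phiE big1 ?linear0 // => k _.
  rewrite -(psiK i V x) phiE linear_sum big1 ?linear0 // => l _.
  exact: vu0.
have [||P [S [nP nS SK PE]]] := @dsum_list_split Q _ (fun i => copies (m i) (F i))
  phi psi (index_enum I) nphi npsi (index_enum_uniq I).
- by move=> i V x _.
- by move=> i j V x _ _; apply: orth.
rewrite big_dsumE; exists S; split=> // V; exists (P V) => x; last exact: SK.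
by rewrite PE [RHS]uv; apply: eq_bigr => i _; rewrite phiE.
Qed.
End DirectSums.

(** * Blocks of a corner of a group algebra *)

Section Blocks.
Variables (K : fieldType) (charK : [pchar K] =i pred0) (gT : finGroupType).
Local Notation A := (galg K gT).
Variables (I : finType) (c : I -> A) (cP : complete_family c).
Variables (e : A) (eK : e * e = e).

Definition corner (l : I) (x : A) : A := c l * x * e.
Lemma corner_linear l : linear (corner l).
Proof. by move=> k x y; rewrite /corner mulrDr mulrDl -scalerAr -scalerAl. Qed.
HB.instance Definition _ l := GRing.isLinear.Build K A A *:%R (corner l) (corner_linear l).

Definition block l : {vspace A} := limg (linfun (corner l)).
Definition block_mult l : nat := \dim (block l).
Definition block_basis l (k : 'I_(block_mult l)) : A := (vbasis (block l))`_k.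

Lemma corner_block l x : corner l x \in block l.
Proof. by rewrite -[corner l x]lfunE memv_img ?memvf. Qed.

Definition block_coef l (k : 'I_(block_mult l)) (g : gT) : K :=
  coord (vbasis (block l)) k (corner l (gdelta K g^-1)).
(** The component of [e] for l is kappa^-2 times the sum of g c g^-1 e. Write c g^-1 e in the basis
    of the block; each basis element equals kappa^-1 c times itself. This is the source of the
    factor c and of the third power of [kappa]. *)
Definition block_dual l (k : 'I_(block_mult l)) : A :=
  (kappa (c l) ^+ 3)^-1 *: \sum_g block_coef k g *: (gdelta K g * c l).

Let cprim l : primitive (c l) := cP.1.1 l.
Let k0 l : kappa (c l) != 0 := kappa_neq0 charK (cprim l).

Lemma block_left l y : y \in block l -> c l * y = kappa (c l) *: y.
Proof.
case/memv_imgP => x _ ->; rewrite lfunE /= /corner !mulrA primitive_sq //.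
by rewrite -!scalerAl.
Qed.
Lemma block_right l y : y \in block l -> y * e = y.
Proof. by case/memv_imgP => x _ ->; rewrite lfunE /= /corner -mulrA eK. Qed.

Lemma block_basis_mem l (k : 'I_(block_mult l)) : block_basis k \in block l.
Proof. by apply: vbasis_mem; rewrite mem_nth ?size_tuple. Qed.

Lemma block_dual_right l (k : 'I_(block_mult l)) : block_dual k * c l = kappa (c l) *: block_dual k.
Proof.
rewrite /block_dual -scalerAl [RHS]scalerA mulrC -[RHS]scalerA; congr (_ *: _).
rewrite mulr_suml scaler_sumr; apply: eq_bigr => g _.
by rewrite -scalerAl -mulrA primitive_sq // -scalerAr scalerA mulrC -scalerA.
Qed.

Lemma block_dual_basis_sum l :
  \sum_(k < block_mult l) block_dual k * block_basis k =
  \sum_g (kappa (c l) ^+ 2)^-1 *: (gdelta K g * c l * (gdelta K g^-1 * e)).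
Proof.
transitivity (\sum_(k < block_mult l) (kappa (c l) ^+ 2)^-1 *:
    \sum_g block_coef k g *: (gdelta K g * block_basis k)).
  apply: eq_bigr => k _; rewrite -scalerAl mulr_suml.
  rewrite (eq_bigr (fun g => kappa (c l) *: (block_coef k g *: (gdelta K g * block_basis k)))) => [|g _].
    rewrite -scaler_sumr scalerA exprS invfM mulrAC mulVf // mul1r //.
  by rewrite -scalerAl -mulrA block_left ?block_basis_mem // -scalerAr !scalerA mulrC.
rewrite -[LHS]scaler_sumr exchange_big -[RHS]scaler_sumr; congr (_ *: _).
apply: eq_bigr => g _ /=.
transitivity (gdelta K g * corner l (gdelta K g^-1)); last by rewrite /corner !mulrA.
rewrite [in RHS](coord_vbasis (corner_block l (gdelta K g^-1))) mulr_sumr.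
by apply: eq_bigr => k _; rewrite -scalerAr.
Qed.

Lemma block_sum : e = \sum_l \sum_(k < block_mult l) block_dual k * block_basis k.
Proof.
rewrite {1}(complete_sum e cP); apply: eq_bigr => l _.
exact/esym/block_dual_basis_sum.
Qed.

Lemma block_basis_dual_neq l m (k : 'I_(block_mult l)) (j : 'I_(block_mult m)) : l != m -> block_basis k * block_dual j = 0.
Proof.
move=> lm; apply: (scalerI (k0 l)); rewrite scalerAl -block_left ?block_basis_mem // scaler0.
apply: (scalerI (k0 m)); rewrite scalerAr -block_dual_right scaler0.
by rewrite !mulrA -[c l * _ * _]mulrA cP.1.2.
Qed.

(** The product is a scalar multiple s c of c, since it lies in cAc. Multiplying [block_basis k] by
    the expansion of [e] writes it in the basis with coefficients kappa s, which linear independence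
    identifies. *)
Lemma block_basis_dual l (k j : 'I_(block_mult l)) :
  block_basis k * block_dual j = if k == j then (kappa (c l))^-1 *: c l else 0.
Proof.
have sE (i i' : 'I_(block_mult l)) : exists s, block_basis i * block_dual i' = s *: c l :> A.
  have [_ /(_ (block_basis i * block_dual i')) [s es]] := cprim l.
  exists ((kappa (c l) ^+ 2)^-1 * s); rewrite -scalerA -es.
  have -> : c l * (block_basis i * block_dual i') * c l = (c l * block_basis i) * (block_dual i' * c l) by rewrite !mulrA.
  rewrite block_left ?block_basis_mem // block_dual_right -scalerAl -[_ * (_ *: block_dual i')]scalerAr !scalerA.
  rewrite -mulrA -expr2.
  by rewrite mulVf ?scale1r // expf_neq0.
pose s i i' := projT1 (cid (sE i i')).
have sP i i' : block_basis i * block_dual i' = s i i' *: c l := projT2 (cid (sE i i')).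
have comb i : block_basis i = \sum_i' (kappa (c l) * s i i') *: block_basis i'.
  rewrite -[LHS](block_right (block_basis_mem i)) block_sum mulr_sumr (bigD1 l) //=.
  rewrite [X in _ + X]big1 ?addr0 => [|m ml]; last first.
    rewrite mulr_sumr big1 // => i' _; rewrite mulrA block_basis_dual_neq ?mul0r //.
    by rewrite eq_sym.
  rewrite mulr_sumr; apply: eq_bigr => i' _.
  by rewrite mulrA sP -scalerAl block_left ?block_basis_mem // scalerA mulrC.
have fr := basis_free (vbasisP (block l)).
have := congr1 (coord (vbasis (block l)) j) (comb k).
rewrite linear_sum /= (bigD1 j) //= big1 ?addr0 => [|i ij]; last first.
  by rewrite linearZ /= coord_free // (negPf ij) mulr0.
rewrite linearZ /= !coord_free // eqxx mulr1 sP => e1.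
have -> : s k j = (kappa (c l))^-1 * (k == j)%:R by rewrite e1 mulKf.
by case: (k == j); rewrite ?mulr1 ?mulr0 ?scale0r.
Qed.
End Blocks.

Lemma tmapZ (K : fieldType) (I : finType) (V W : I -> vectType K) (k : I -> K)
    (f : forall i, 'Hom(V i, W i)) :
  tmap (fun i => k i *: f i) = (\prod_i k i) *: tmap f.
Proof.
apply: tens_lfunP => v; rewrite scale_lfunE !tmap_ptens -ptensZ.
by apply: ptens_ext => i; rewrite scale_lfunE.
Qed.

Section Lifts.
Variables (K : fieldType) (n : nat).
Local Notation functor := (mfunctor K n).
Local Notation spaces := ('I_n -> vectType K).
Local Notation nmap F G := (forall V : spaces, 'Hom(fobj F V, fobj G V)).

Lemma nat_lift (Q T F : functor) (psi : nmap Q T) (f : nmap F T) :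
    natural psi -> (forall V, injective (psi V)) -> natural f ->
    (forall V x, exists y, psi V y = f V x) ->
  exists f' : nmap F Q, natural f' /\ forall V x, psi V (f' V x) = f V x.
Proof.
move=> npsi ipsi nf im; exists (fun V => ((psi V)^-1 \o f V)%VF).
have fK V x : psi V (((psi V)^-1 \o f V)%VF x) = f V x.
  rewrite comp_lfunE; have [y <-] := im V x; congr (psi V _).
  by apply: lker0_lfunK; apply/lker0P.
split=> // V W g x; apply: ipsi.
by rewrite fK nf npsi fK.
Qed.

(* Up to scaling, c is a projector of the tensor power with image F. *)
Definition splits1 (F : functor) (i : 'I_n) r (c : galg K 'S_r) :=
  exists (iota : forall V, 'Hom(F V, tpow r (V i))) (rho : forall V, 'Hom(tpow r (V i), F V)),
  [/\ forall (V W : spaces) (f : forall i, 'Hom(V i, W i)) x, iota W (fmap F f x) = tpow_map r (f i) (iota V x),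
      forall (V W : spaces) (f : forall i, 'Hom(V i, W i)) t, rho W (tpow_map r (f i) t) = fmap F f (rho V t),
      forall V t, iota V (rho V t) = gact (@permt K r (V i)) c t &
      exists2 k : K, k != 0 & forall V x, rho V (iota V x) = k *: x].

Definition splits (F : functor) (R : 'I_n -> nat) (c : AR K R) :=
  exists (iota : nmap F (TR K R)) (rho : nmap (TR K R) F),
  [/\ natural iota, natural rho, forall V t, iota V (rho V t) = actT V c t &
      exists2 k : K, k != 0 & forall V x, rho V (iota V x) = k *: x].

Lemma TensF_splits (F : 'I_n -> functor) R (c : forall i, galg K 'S_(R i)) :
  (forall i, splits1 (F i) i (c i)) -> splits (TensF F) (gtens c).
Proof.
move=> sp; pose X i := cid (sp i); pose iota i := projT1 (X i).
pose Y i := cid (projT2 (X i)); pose rho i := projT1 (Y i).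
pose P i := projT2 (Y i).
exists (fun V => tmap (fun i => iota i V)), (fun V => tmap (fun i => rho i V)); split.
- move=> V W f x; rewrite -[LHS]comp_lfunE -[RHS]comp_lfunE; congr (fun_of_lfun _ x).
  rewrite -[LHS]tmap_comp -[RHS]tmap_comp; apply: tmap_ext => i.
  by apply/lfunP => y; rewrite [LHS]comp_lfunE [RHS]comp_lfunE; have [-> _ _ _] := P i.
- move=> V W f x; rewrite -[LHS]comp_lfunE -[RHS]comp_lfunE; congr (fun_of_lfun _ x).
  rewrite -[LHS]tmap_comp -[RHS]tmap_comp; apply: tmap_ext => i.
  by apply/lfunP => y; rewrite [LHS]comp_lfunE [RHS]comp_lfunE; have [_ -> _ _] := P i.
- move=> V t; rewrite actT_gtens -[LHS]comp_lfunE; congr (fun_of_lfun _ t).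
  rewrite -[LHS]tmap_comp; apply: tmap_ext => i.
  by apply/lfunP => y; rewrite [LHS]comp_lfunE; have [_ _ -> _] := P i.
have kP i : {k : K | k != 0 /\ forall V x, rho i V (iota i V x) = k *: x}.
  by apply: cid; have [_ _ _ [k kn kE]] := P i; exists k.
exists (\prod_i projT1 (kP i)) => [|V x].
  by apply/prodf_neq0 => i _; have [] := projT2 (kP i).
rewrite -[LHS]comp_lfunE -[X in _ = _ *: X]id_lfunE -tmap_id -scale_lfunE.
congr (fun_of_lfun _ x); rewrite -[LHS]tmap_comp.
by rewrite -tmapZ; apply: tmap_ext => i; apply/lfunP => y; rewrite comp_lfunE;
  rewrite (projT2 (kP i)).2 scale_lfunE id_lfunE.
Qed.
End Lifts.

(** * Natural maps between tensor powers *)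

Section Schur.
Variables (K : fieldType) (charK : [pchar K] =i pred0) (n : nat).
Local Notation spaces := ('I_n -> vectType K).

Lemma youngtE r (A : vectType K) sh : youngt r A sh = gact (@permt K r A) (young K r sh).
Proof.
rewrite /young /yrow mulr_suml (linear_sum (gact _)); apply: eq_bigr => s _.
rewrite mulr_sumr (linear_sum (gact _)); apply: eq_bigr => t _.
by rewrite -scalerAr gdeltaM linearZ /= gact_delta.
Qed.

Lemma SchurF_splits1 r sh (i : 'I_n) : sumn sh = r ->
  splits1 (SchurF r sh (ProjF K i)) i (young K r sh).
Proof.
move=> shr; have cP := young_primitive charK shr.
exists (fun V => linfun vsval), (fun V => (linfun (vsproj _) \o youngt r (V i) sh)%VF); split.
- move=> V W f x; rewrite [LHS]vsvalE [in RHS]vsvalE.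
  exact: (@SubF_val K n (TPowF r (ProjF K i)) _ (@youngt_stable K n r sh (ProjF K i)) V W f x).
- move=> V W f t; apply: val_inj.
  rewrite [RHS](@SubF_val K n (TPowF r (ProjF K i)) _ (@youngt_stable K n r sh (ProjF K i)) V W f _).
  rewrite [in LHS]comp_lfunE [in RHS]comp_lfunE ![linfun (vsproj _) _]lfunE /=.
  rewrite !vsprojK ?memv_img ?memvf //.
  exact/esym/tpow_map_youngt.
- by move=> V t; rewrite vsvalE comp_lfunE lfunE /= vsprojK ?memv_img ?memvf // youngtE.
exists (kappa (young K r sh)) => [|V x]; first exact: kappa_neq0.
apply: val_inj; rewrite linearZ /= comp_lfunE [linfun (vsproj _) _]lfunE /= vsprojK ?memv_img ?memvf //.
rewrite vsvalE.
have /memv_imgP [y _ ->] : vsval x \in limg (youngt r (V i) sh) := subvsP x.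
rewrite !youngtE -(gactME (@permtM K r (V i))) primitive_sq // linearZ /= scale_lfunE //.
Qed.

Lemma SchurPadF_splits1 p a la (i : 'I_n) : sumn la = p -> (head 0%N la <= a)%N ->
  splits1 (SchurPadF p la (p%:Z + a%:Z) (ProjF K i)) i (young K (a + p) (a :: la)).
Proof.
move=> lap laa; rewrite /SchurPadF.
have -> : (head 0%N la)%:Z <= p%:Z + a%:Z - p%:Z by lia.
have -> : absz (p%:Z + a%:Z - p%:Z)%R = a by lia.
have -> : absz (p%:Z + a%:Z)%R = (a + p)%N by lia.
by apply: SchurF_splits1; rewrite /= lap.
Qed.

End Schur.

Section Yoneda.
Variables (K : fieldType) (n : nat) (R : 'I_n -> nat).
Local Notation spaces := ('I_n -> vectType K).
Local Notation TV V := (tens (fun i => tpow (R i) (V i))).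

(* The multilinear test object: V_i has a basis indexed by 'I_(R i). *)
Definition test_space : spaces := fun i => 'rV[K]_(R i).

Lemma dim_test_space i : R i = \dim {:test_space i}.
Proof. by rewrite dimvf [RHS]dim_matrix [RHS]mul1n. Qed.
Definition test_index i (j : 'I_(R i)) : 'I_(\dim {:test_space i}) := cast_ord (dim_test_space i) j.
Definition test_tensor : TV test_space := nptens (fun i (j : 'I_(R i)) => ebasis (test_index j)).

Lemma test_index_inj i : injective (@test_index i).
Proof. exact: cast_ord_inj. Qed.

Local Notation nidxR := (nidx (fun i (_ : 'I_(R i)) => test_space i)).
Definition permidx (g : GR R) : nidxR := [ffun i => [ffun j => test_index (g i j)]].

Lemma permidx_inj : injective permidx.
Proof.
move=> g h /ffunP e; apply/ffunP => i; apply/permP => j; apply: (@test_index_inj i).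
by have := e i; rewrite !ffunE => /ffunP /(_ j); rewrite !ffunE.
Qed.

Lemma rhoT_test_tensor g : rhoT test_space g test_tensor = nbasis (permidx (g^-1)%g).
Proof.
rewrite /rhoT /test_tensor tmap_ptens; apply: ptens_ext => i.
by rewrite permt_ptens; apply: ptens_ext => j; rewrite !ffunE.
Qed.

Lemma ncoord_nbasis (L M : nidxR) : ncoord L (nbasis M) = (L == M)%:R.
Proof.
rewrite ncoord_nptens; have [->|neq] := eqVneq L M.
  by rewrite big1 // => i _; rewrite big1 // => j _; rewrite ecoord_ebasis eqxx.
have [i neqi] : exists i, L i != M i.
  apply/existsP; apply: contraNT neq => /existsPn eqJ.
  by apply/eqP/ffunP => i; apply/eqP; rewrite -[_ == _]negbK eqJ.
have [j neqj] : exists j, L i j != M i j.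
  apply/existsP; apply: contraNT neqi => /existsPn eqJ.
  by apply/eqP/ffunP => j; apply/eqP; rewrite -[_ == _]negbK eqJ.
by rewrite (bigD1 i) //= (bigD1 j) //= ecoord_ebasis eq_sym (negPf neqj) !mul0r.
Qed.

(** Permutations take the test tensor to distinct basis tensors, so coefficients appear as
    coordinates; the inverse is the one in [permt]. *)
Lemma actT_test_tensor (x : AR K R) g : ncoord (permidx g) (actT test_space x test_tensor) = x (g^-1)%g.
Proof.
rewrite /actT gactE (linear_sum (ncoord (permidx g))) (bigD1 (g^-1)%g) //= big1 => [|h neq].
  by rewrite addr0 linearZ /= rhoT_test_tensor invgK ncoord_nbasis eqxx /GRing.scale /= mulr1.
rewrite linearZ /= rhoT_test_tensor ncoord_nbasis (inj_eq permidx_inj).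
case: eqP => [e|_]; last by rewrite /GRing.scale /= mulr0.
by rewrite e invgK eqxx in neq.
Qed.

Lemma actT_faithful (x y : AR K R) : actT test_space x test_tensor = actT test_space y test_tensor -> x = y.
Proof.
by move=> e; apply/ffunP => g; rewrite -[g]invgK -!actT_test_tensor e.
Qed.

Definition lext_fun (A B : vectType K) (u : 'I_(\dim {:A}) -> B) (a : A) : B :=
  \sum_k ecoord k a *: u k.
Lemma lext_linear A B u : linear (@lext_fun A B u).
Proof.
move=> c a b; rewrite /lext_fun scaler_sumr -big_split; apply: eq_bigr => k _ /=.
by rewrite linearP scalerDl scalerA.
Qed.
HB.instance Definition _ (A B : vectType K) (u : 'I_(\dim {:A}) -> B) :=
  GRing.isLinear.Build K A B *:%R (lext_fun u) (lext_linear u).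
Definition lext (A B : vectType K) (u : 'I_(\dim {:A}) -> B) : 'Hom(A, B) := linfun (lext_fun u).
Lemma lext_ebasis (A B : vectType K) (u : 'I_(\dim {:A}) -> B) k : lext u (ebasis k) = u k.
Proof.
rewrite lfunE /= /lext_fun (bigD1 k) //= big1 => [|l neq].
  by rewrite ecoord_ebasis eqxx scale1r addr0.
by rewrite ecoord_ebasis eq_sym (negPf neq) scale0r.
Qed.

Lemma ncoord_inj (s t : TV test_space) : (forall L : nidxR, ncoord L s = ncoord L t) -> s = t.
Proof.
by move=> e; rewrite [s]ncoord_sum [t]ncoord_sum; apply: eq_bigr => L _; rewrite e.
Qed.

Lemma ncoord_tmap (L : nidxR) (f : forall i, 'End(test_space i)) t :
    (forall i j a, ecoord (L i j) (f i a) = ecoord (L i j) a) ->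
  ncoord L (tmap (fun i => tpow_map (R i) (f i)) t) = ncoord L t.
Proof.
move=> fE; rewrite [t]ncoord_sum !linear_sum; apply: eq_bigr => M _.
rewrite !linearZ /=; congr (_ *: _).
rewrite (nptens_map (fun i (_ : 'I_(R i)) => f i)) !ncoord_nptens.
by apply: eq_bigr => i _; apply: eq_bigr => j _.
Qed.

Lemma ecoord_lext (A : vectType K) k l (a : A) : l != k ->
  ecoord l (lext (fun l => if l == k then 0 else ebasis l) a) = ecoord l a.
Proof.
move=> lk; rewrite [in LHS](ebasis_sum a) !linear_sum [in RHS](ebasis_sum a) linear_sum.
apply: eq_bigr => m _; rewrite !linearZ /= lext_ebasis; congr (_ * _).
by case: eqP => // ->; rewrite linear0 ecoord_ebasis eq_sym (negPf lk).
Qed.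

Variable phi : forall V, 'Hom(TR K R V, TR K R V).
Hypothesis nphi : natural phi.

(* The endomorphism of the i-th space killing one basis vector kills [test_tensor]. *)
Lemma nat_test_tensor_coord (L : nidxR) i k : (forall j, L i j != k) -> ncoord L (phi test_space test_tensor) = 0.
Proof.
move=> Lk; pose kill : 'End(test_space i) := lext (fun l => if l == k then 0 else ebasis l).
pose f : forall i, 'End(test_space i) := dfwith (fun i => \1%VF : 'End(test_space i)) kill.
have fgen : fmap (TR K R) f test_tensor = 0.
  rewrite [LHS](nptens_map (fun i (_ : 'I_(R i)) => f i)).
  pose j0 : 'I_(R i) := cast_ord (esym (dim_test_space i)) k.
  have z : ptens (fun j : 'I_(R i) => f i (ebasis (test_index j))) = 0.
    apply/ffunP => J; rewrite !ffunE (bigD1 j0) //= /f dfwith_in lext_ebasis.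
    have -> : test_index j0 = k by apply: val_inj.
    by rewrite eqxx linear0 mul0r.
  by apply/ffunP => J; rewrite !ffunE (bigD1 i) //= z linear0 mul0r.
have fx : fmap (TR K R) f (phi test_space test_tensor) = 0 by rewrite -nphi fgen linear0.
(* [L] avoids [k], so [f] leaves this coordinate unchanged, although it kills the image of the test
   tensor. *)
rewrite -(@ncoord_tmap L f (phi test_space test_tensor)) => [|i' j a]; first by rewrite [tmap _ _]fx linear0.
by move: j a; rewrite /f; case: dfwithP => [|i'' _] j a; [apply: ecoord_lext | rewrite id_lfunE].
Qed.

(* A natural endomorphism is determined by the image of the multilinear test tensor. *)
Lemma yoneda : exists x : AR K R, forall V t, phi V t = actT V x t.
Proof.
(* The index of a nonzero coordinate uses every basis vector of each space; with as many slots as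
   basis vectors, it is a permutation. *)
have surj (L : nidxR) : ncoord L (phi test_space test_tensor) != 0 -> exists g, L = permidx g.
  move=> nz; have Ls i k : exists j, L i j == k.
    apply/existsP; apply: contraNT nz => /existsPn h; apply/eqP.
    exact: (nat_test_tensor_coord h).
  pose s i (k : 'I_(R i)) := xchoose (Ls i (test_index k)).
  have sE i k : L i (s i k) = test_index k := eqP (xchooseP (Ls i (test_index k))).
  have sI i : injective (s i) by move=> k l e; apply: test_index_inj; rewrite -!sE e.
  exists [ffun i => (perm (@sI i))^-1%g]; apply/ffunP => i; apply/ffunP => j; rewrite !ffunE.
  by rewrite -sE -[s i _](permE (@sI i)) permKV.
pose x : AR K R := [ffun g => ncoord (permidx (g^-1)%g) (phi test_space test_tensor)].
have gen : phi test_space test_tensor = actT test_space x test_tensor.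
  apply: ncoord_inj => L; have [[g ->]|nL] := pselect (exists g, L = permidx g).
    by rewrite actT_test_tensor ffunE invgK.
  transitivity (0 : K); first by apply/eqP; apply: contra_notT nL => /surj.
  rewrite /actT gactE linear_sum big1 // => g _.
  rewrite linearZ /= rhoT_test_tensor ncoord_nbasis; case: eqP => [e|_]; last exact: mulr0.
  by case: nL; exists (g^-1)%g.
exists x => V t; congr (fun_of_lfun _ t); apply: nested_lfunP => u.
(* Every pure tensor is the image of the test tensor under maps sending basis vectors to its
   factors, so naturality transports the formula. *)
pose f i : 'Hom(test_space i, V i) := lext (fun k => u i (cast_ord (esym (dim_test_space i)) k)).
have <- : fmap (TR K R) f test_tensor = nptens u.
  rewrite [LHS](nptens_map (fun i (_ : 'I_(R i)) => f i)); apply: nptens_ext => i j.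
  by rewrite lext_ebasis; congr (u i); apply: val_inj.
by rewrite nphi gen [RHS]actT_natural.
Qed.
End Yoneda.

(** * Multiplicities in exterior powers *)

Section ExteriorPower.
Variables (K : fieldType) (charK : [pchar K] =i pred0) (n p : nat).
Local Notation spaces := ('I_n -> vectType K).
Local Notation Rp := (fun _ : 'I_n => p).

Definition diag_perm (s : 'S_p) : GR Rp := [ffun=> s].
Lemma diag_permM : {morph diag_perm : s t / (s * t)%g}.
Proof. by move=> s t; apply/ffunP => i; rewrite !ffunE. Qed.

Definition gsign : AR K Rp := p`!%:R^-1 *: \sum_(s : 'S_p) (-1) ^+ s *: gdelta K (diag_perm s).

Lemma factK0 : p`!%:R != 0 :> K.
Proof. by rewrite natK_eq0 // -lt0n fact_gt0. Qed.

Lemma diag_perm_gsign s : gdelta K (diag_perm s) * gsign = (-1) ^+ s *: gsign.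
Proof.
rewrite /gsign -[LHS]scalerAr [RHS]scalerA mulrC -[RHS]scalerA; congr (_ *: _).
rewrite mulr_sumr scaler_sumr [RHS](reindex_inj (mulgI s)) /=; apply: eq_bigr => t _.
rewrite -scalerAr gdeltaM -diag_permM scalerA odd_permM signr_addb mulrA -expr2 sqrr_sign mul1r //.
Qed.

Lemma gsignK : gsign * gsign = gsign.
Proof.
rewrite {1}/gsign -scalerAl mulr_suml (eq_bigr (fun=> gsign)) => [|s _].
  by rewrite sumr_const card_Sn -scaler_nat scalerA mulVf ?factK0 // scale1r.
by rewrite -scalerAl diag_perm_gsign scalerA -expr2 sqrr_sign scale1r.
Qed.

Local Notation sw V := (tswap (fun (_ : 'I_p) i => (V : spaces) i)).
Local Notation wS V := (tswap (fun i (_ : 'I_p) => (V : spaces) i)).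

Lemma tswap_permt (V : spaces) s (x : tpow p (tens V)) :
  sw V (permt (tens V) s x) = rhoT (R := Rp) V (diag_perm s) (sw V x).
Proof.
rewrite -[LHS]comp_lfunE -[RHS]comp_lfunE; congr (fun_of_lfun _ x).
apply: nested_lfunP => v; rewrite [LHS]comp_lfunE [RHS]comp_lfunE.
rewrite permt_ptens [X in _ = _ X]tswap_nptens [LHS](tswap_nptens (fun j => v (s^-1%g j))).
rewrite /rhoT tmap_ptens; apply: ptens_ext => i.
by rewrite permt_ptens ffunE.
Qed.

Lemma tswap_asymt (V : spaces) (x : tpow p (tens V)) :
  sw V (p`!%:R^-1 *: asymt p (tens V) x) = actT V gsign (sw V x).
Proof.
rewrite linearZ /= /gsign linearZ /= scale_lfunE; congr (_ *: _).
rewrite sum_lfunE (linear_sum (sw V)) (linear_sum (actT V)) sum_lfunE; apply: eq_bigr => s _.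
rewrite scale_lfunE !linearZ /= scale_lfunE; congr (_ *: _).
by rewrite tswap_permt /actT gact_delta.
Qed.

Lemma asymt_limg (A : vectType K) x : x \in limg (asymt p A) -> p`!%:R^-1 *: asymt p A x = x.
Proof.
move=> xA; rewrite sum_lfunE (eq_bigr (fun=> x)) => [|s _].
  by rewrite sumr_const card_Sn -scaler_nat scalerA mulVf ?factK0 // scale1r.
by rewrite scale_lfunE permt_asymt // scalerA -expr2 sqrr_sign scale1r.
Qed.

(** Exchanging the two levels of tensor products turns permutations of the p factors into the
    diagonal action, so the exterior power becomes the image of [gsign]. *)
Lemma Ext_embedding :
  exists lam : forall V, 'Hom(ExtF p (TensF (@ProjF K n)) V, TR K Rp V),
  [/\ natural lam, forall V, injective (lam V) &
      forall V (t : TR K Rp V), actT V gsign t = t <-> exists y, lam V y = t].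
Proof.
exists (fun V => (sw V \o linfun (vsval : subvs_of (limg (asymt p (tens V))) -> _))%VF).
have E (V : spaces) y : (sw V \o linfun (vsval : subvs_of (limg (asymt p (tens V))) -> _))%VF y
    = sw V (vsval y) by rewrite comp_lfunE vsvalE.
split.
- move=> V W f x; rewrite [LHS]E [in RHS]E.
  have -> := Ext_val f x.
  rewrite -[LHS]comp_lfunE -[RHS]comp_lfunE; congr (fun_of_lfun _ (vsval x)).
  apply: nested_lfunP => v; rewrite [LHS]comp_lfunE [RHS]comp_lfunE.
  rewrite [X in _ = _ X]tswap_nptens [RHS](nptens_map (fun i (_ : 'I_p) => f i)).
  by rewrite (nptens_map (fun (_ : 'I_p) i => f i)) tswap_nptens.
- move=> V x y; rewrite [LHS]E [RHS]E => /(can_inj (tswapK (V := fun (_ : 'I_p) i => V i))).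
  exact: val_inj.
move=> V t; split=> [tA|[y <-]]; last first.
  by rewrite E -tswap_asymt asymt_limg // subvsP.
exists (vsproj _ (p`!%:R^-1 *: asymt p (tens V) (wS V t))).
rewrite [LHS]E vsprojK; last by rewrite memvZ // memv_img ?memvf.
by rewrite tswap_asymt (tswapK (V := fun i (_ : 'I_p) => V i)) tA.
Qed.
End ExteriorPower.

Section Multiplicity.
Variables (K : fieldType) (charK : [pchar K] =i pred0) (n : nat).
Local Notation functor := (mfunctor K n).
Local Notation spaces := ('I_n -> vectType K).
Local Notation nmap F G := (forall V : spaces, 'Hom(fobj F V, fobj G V)).

Lemma copies_proj (F : functor) m :
  exists (j : 'I_m -> nmap F (copies m F)) (pr : 'I_m -> nmap (copies m F) F),
    (forall k, natural (j k)) /\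
    forall k l V x, pr l V (j k V x) = if k == l then x else 0.
Proof.
elim: m => [|m [j [pr [nj prj]]]].
  by exists (fun k V => 0), (fun k V => 0); split; case.
exists (fun k V => if unlift ord0 k is Some k' then pair_in 0 (j k' V) else pair_in \1%VF 0).
exists (fun k V => if unlift ord0 k is Some k' then (pr k' V \o pair_out 0 \1%VF)%VF
                   else pair_out \1%VF 0).
split=> [k V W f x|k l V x].
  rewrite /=; case: unliftP => [k' _|_]; rewrite !pair_inE pair_lfunE /=.
    by rewrite !zero_lfunE linear0 nj.
  by rewrite !zero_lfunE !id_lfunE linear0.
case: unliftP => [k' ->|->]; case: unliftP => [l' ->|->].
- rewrite pair_inE [LHS]comp_lfunE pair_outE /= !zero_lfunE add0r id_lfunE prj.
  by rewrite (inj_eq (@lift_inj _ _)).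
- by rewrite pair_inE [LHS]comp_lfunE pair_outE /= !zero_lfunE add0r id_lfunE linear0.
- by rewrite pair_inE pair_outE /= !zero_lfunE linear0 addr0.
by rewrite pair_inE pair_outE /= !zero_lfunE addr0 id_lfunE id_lfunE.
Qed.

Variables (R : 'I_n -> nat) (F : functor) (lam : nmap F (TR K R)) (e : AR K R).
Hypotheses (nlam : natural lam) (ilam : forall V, injective (lam V)) (eK : e * e = e).
Hypothesis lamP : forall V (t : TR K R V), actT V e t = t <-> exists y, lam V y = t.
Variables (I : finType) (c : I -> AR K R) (cP : complete_family c).
Variables (S : functor) (l : I) (sS : splits S (c l)).

Local Notation b := (block_mult c e l).

(** Right multiplication by an element of cAe takes the image of c into that of e, and the dual
    elements give retractions. Their scalar undoes the kappa^-1 of [block_basis_dual] and the scalar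
    k of rho iota, which occurs twice. *)
Lemma embed_block_mult m : (m <= b)%N -> nat_embed (copies m S) F.
Proof.
move=> mb; have [iota [rho [niota nrho iotaK [k kn rhoK]]]] := sS.
pose w := widen_ord mb.
have nact (x : AR K R) : natural (fun V => actT V x : 'Hom(TR K R V, TR K R V)).
  by move=> V W f t; apply: actT_natural.
have L i : exists f' : nmap S F, natural f' /\ forall V x, lam V (f' V x) = actT V (block_basis (w i)) (iota V x).
  have [|V x|f' [nf fE]] := @nat_lift K n F (TR K R) S lam
    (fun V => actT V (block_basis (w i)) \o iota V)%VF nlam ilam.
  - by move=> V W f x; rewrite [LHS]comp_lfunE niota nact [in RHS]comp_lfunE.
  - by apply/lamP; rewrite comp_lfunE -actTM (block_right eK (block_basis_mem (w i))).
  by exists f'; split=> // V x; rewrite fE comp_lfunE.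
pose u i := projT1 (cid (L i)).
have uP i : natural (u i) /\ forall V x, lam V (u i V x) = actT V (block_basis (w i)) (iota V x) := projT2 (cid (L i)).
pose v (i : 'I_m) V : 'Hom(F V, S V) := (kappa (c l) / k ^+ 2) *: (rho V \o actT V (block_dual (w i)) \o lam V)%VF.
have vE i V x : v i V x = (kappa (c l) / k ^+ 2) *: rho V (actT V (block_dual (w i)) (lam V x)).
  by rewrite scale_lfunE !comp_lfunE.
have k0 := kappa_neq0 charK (cP.1.1 l).
have [i|i|i j V x|phi [psi [nphi _ psiK _]]] := @copies_split K n F S m u v.
- exact: (uP i).1.
- by move=> V W f x; rewrite [LHS]vE [in RHS]vE nlam nact nrho [RHS]linearZ.
- rewrite vE (uP i).2 -actTM (block_basis_dual charK cP eK).
  have -> : (w i == w j) = (i == j) by [].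
  case: eqP => _; last by rewrite linear0 zero_lfunE linear0 scaler0.
  rewrite linearZ /= scale_lfunE -iotaK linearZ /= !rhoK !scalerA.
  by rewrite [X in X *: _](_ : _ = 1) ?scale1r //; field; rewrite k0 kn.
by exists phi; split=> // V; apply: can_inj (psiK V).
Qed.

(** Each copy, composed with [rho], is a natural endomorphism of the tensor power, hence an element
    of cAe by [yoneda]. More copies than the dimension would give a linear relation, which
    contradicts injectivity at the test tensor. *)
Lemma embed_le_block_mult m : nat_embed (copies m S) F -> (m <= b)%N.
Proof.
move=> [Psi [nPsi iPsi]]; have [iota [rho [niota nrho iotaK [k kn rhoK]]]] := sS.
have [j [pr [nj prj]]] := copies_proj S m.
pose h i V : 'Hom(TR K R V, TR K R V) := (lam V \o Psi V \o j i V \o rho V)%VF.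
have hE i V t : h i V t = lam V (Psi V (j i V (rho V t))) by rewrite !comp_lfunE.
have nh i : natural (h i) by move=> V W f t; rewrite !hE nrho nj nPsi nlam.
pose al i := projT1 (cid (yoneda (nh i))).
have alE i V t : lam V (Psi V (j i V (rho V t))) = actT V (al i) t.
  by rewrite -hE (projT2 (cid (yoneda (nh i)))).
have blk i : al i \in block c e l.
  have ce : c l * al i = k *: al i.
    apply: actT_faithful; rewrite actTM -iotaK -alE rhoK !linearZ /= alE.
    by rewrite scale_lfunE.
  have ae : al i * e = al i.
    by apply: actT_faithful; rewrite actTM; apply/lamP; rewrite -alE; eexists.
  have -> : al i = corner c e l (k^-1 *: al i).
    by rewrite /corner -scalerAr ce scalerA mulVf // scale1r ae.
  exact: corner_block.
rewrite leqNgt; apply/negP => mb.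
have /freeP nf : ~~ free [tuple al i | i < m].
  apply/negP => fr; have : (\dim <<[tuple al i | i < m]>> <= b)%N.
    by apply: dimvS; apply/span_subvP => x /mapP [i _ ->].
  by rewrite (eqP fr) size_tuple leqNgt mb.
have [d [d0 [i di]]] : exists d : 'I_m -> K, \sum_i d i *: al i = 0 /\ exists i, d i != 0.
  apply: contrapT => nd; apply: nf => d; rewrite (eq_bigr (fun i => d i *: al i)) => [d0 i|i _]; last first.
    by rewrite -tnth_nth tnth_mktuple.
  apply/eqP; apply: contrapT => di; case: nd; exists d; split=> //; exists i.
  exact/negP.
have : pr i _ (\sum_i d i *: j i _ (rho (@test_space K n R) (@test_tensor K n R))) = d i *: rho (@test_space K n R) (@test_tensor K n R).
  rewrite linear_sum (bigD1 i) //= linearZ /= prj eqxx big1 ?addr0 // => i' ne.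
  by rewrite linearZ /= prj (negPf ne) scaler0.
have -> : \sum_i d i *: j i _ (rho (@test_space K n R) (@test_tensor K n R)) = 0.
  apply: (iPsi); apply: ilam; rewrite !linear0.
  transitivity (actT (@test_space K n R) (\sum_i d i *: al i) (@test_tensor K n R)); last by rewrite d0 linear0 zero_lfunE.
  rewrite !linear_sum sum_lfunE; apply: eq_bigr => i' _.
  by rewrite !linearZ /= alE scale_lfunE.
(* Now [rho] kills the test tensor, so c acts on it as zero, and faithfulness gives c = 0. *)
rewrite linear0 => /esym/eqP; rewrite scaler_eq0 (negPf di) /= => /eqP r0.
have := primitive_neq0 (cP.1.1 l); case/eqP; apply: actT_faithful.
by rewrite -iotaK r0 !linear0 zero_lfunE.
Qed.

Lemma multiplicity_block_mult : multiplicity S F = b.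
Proof.
apply: classical_sets.xget_unique => [|m [em nem]].
  by split; [apply: embed_block_mult | move/embed_le_block_mult; rewrite ltnn].
apply/eqP; rewrite eqn_leq embed_le_block_mult //= leqNgt; apply/negP => /embed_block_mult.
exact: nem.
Qed.
End Multiplicity.

(** * Irreducibility *)

Section PolynomialMaps.
Variables (K : fieldType) (charK : [pchar K] =i pred0).

Lemma nat_root_eq0 (P : {poly K}) : (forall i : nat, root P i%:R) -> P = 0.
Proof.
move=> rP; apply/eqP; apply: contraT => Pn.
have := max_poly_roots (rs := [seq i%:R | i <- iota 0 (size P)]) Pn.
rewrite size_map size_iota ltnn; apply.
  by apply/allP => x /mapP [i _ ->].
rewrite map_inj_uniq ?iota_uniq // => i j; wlog ij : i j / (i <= j)%N.
  by move=> h; case/orP: (leq_total i j) => [/h //|/h {}h] /esym /h.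
move/esym/eqP; rewrite -subr_eq0 -natrB // natK_eq0 // subn_eq0 => ji.
by apply/eqP; rewrite eqn_leq ij.
Qed.

(** In each coordinate, the polynomial times [q] vanishes at all natural numbers, infinitely many in
    characteristic zero. *)
Lemma poly_map_eq0 (A : vectType K) (J : finType) (e : J -> nat) (a : J -> A) (q : {poly K}) t :
    q != 0 -> (forall t, ~~ root q t -> \sum_j t ^+ e j *: a j = 0) ->
  \sum_j t ^+ e j *: a j = 0.
Proof.
move=> qn h; rewrite [LHS](coord_vbasis (memvf _)) big1 // => i _.
pose P : {poly K} := \sum_j coord (vbasis {:A}) i (a j) *: 'X^(e j).
have PE u : P.[u] = coord (vbasis {:A}) i (\sum_j u ^+ e j *: a j).
  rewrite horner_sum linear_sum; apply: eq_bigr => j _.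
  by rewrite linearZ /= hornerZ hornerXn mulrC.
suff P0 : P = 0 by rewrite -PE P0 horner0 scale0r.
have /eqP : P * q = 0.
  apply: nat_root_eq0 => k; rewrite rootM orbC; case: (boolP (root q k%:R)) => //= nq.
  by rewrite /root PE h // linear0.
by rewrite mulf_eq0 (negPf qn) orbF => /eqP.
Qed.

Lemma bij_char_poly (A : vectType K) (f : 'End(A)) : exists2 q : {poly K}, q != 0 &
  forall t, ~~ root q t -> bijective (f - t *: \1%VF).
Proof.
pose M := \matrix_(k, l) ecoord l (f (ebasis k)).
exists (char_poly M) => [|t]; first exact: monic_neq0 (char_poly_monic M).
rewrite -eigenvalue_root_char => /eigenvalueP nev.
have k0 : lker (f - t *: \1%VF)%VF == 0%VS.
  rewrite -subv0; apply/subvP => v; rewrite memv_ker memv0 add_lfunE opp_lfunE scale_lfunE id_lfunE subr_eq0.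
  move=> /eqP fv; apply: contraT => vn; case: nev.
  exists (\row_k ecoord k v); last first.
    apply: contraNneq vn => /rowP r0; rewrite (ebasis_sum v) big1 // => k _.
    by have := r0 k; rewrite !mxE => ->; rewrite scale0r.
  apply/rowP => l; rewrite !mxE; transitivity (ecoord l (f v)); last by rewrite fv linearZ.
  rewrite [in RHS](ebasis_sum v) !linear_sum; apply: eq_bigr => k _.
  by rewrite !linearZ /= !mxE.
by apply: lfun_surj_bij => //; apply: lker0_limgf.
Qed.

End PolynomialMaps.

Section Polarization.
Variables (K : fieldType) (r : nat) (A : vectType K).

(** Inclusion-exclusion: for a map h of the positions, the signed count of the subsets that contain
    its image is the product of 1 - 1 over the positions missed by h. Only bijections survive, with
    coefficient 1. *)
Lemma polarization (f : 'I_r -> 'End(A)) :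
  \sum_(B : {set 'I_r}) (\prod_j (if j \in B then 1 else -1)) *: tpow_map r (\sum_(j in B) f j) =
  \sum_(s : 'S_r) tmap (fun k => f (s k)).
Proof.
transitivity (\sum_(B : {set 'I_r}) \sum_(h : {dffun forall _ : 'I_r, 'I_r})
    ((\prod_j (if j \in B then 1 else -1)) * \prod_k (h k \in B)%:R) *: tmap (fun k => f (h k))).
  apply: eq_bigr => B _; have -> : \sum_(j in B) f j = \sum_j ((j \in B)%:R : K) *: f j.
    rewrite big_mkcond; apply: eq_bigr => j _.
    by case: (j \in B); rewrite ?scale1r ?scale0r.
  rewrite /tpow_map (tmap_sum (fun (_ : 'I_r) j => (j \in B)%:R) (fun (_ : 'I_r) j => f j)).
  by rewrite scaler_sumr; apply: eq_bigr => h _; rewrite scalerA.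
rewrite exchange_big /=.
transitivity (\sum_(h : {dffun forall _ : 'I_r, 'I_r} | injectiveb h) tmap (fun k => f (h k))).
  rewrite [RHS]big_mkcond; apply: eq_bigr => h _; rewrite -scaler_suml.
  have -> : \sum_(B : {set 'I_r}) (\prod_j (if j \in B then 1 else -1)) * \prod_k (h k \in B)%:R
      = \prod_j (1 + (if j \in codom h then 0 else -1)) :> K.
    rewrite bigA_distr; apply: eq_bigr => B _.
    have [/forallP hB|/forallPn [k kB]] := boolP [forall k, h k \in B].
      rewrite [X in _ * X]big1 ?mulr1 => [|k _]; last by rewrite hB.
      apply: eq_bigr => j _; case: ifP => // jB; case: ifP => // /codomP [k jE].
      by rewrite jE hB in jB.
    rewrite [X in _ * X](bigD1 k) //= (negPf kB) mul0r mulr0 (bigD1 (h k)) //=.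
    by rewrite (negPf kB) codom_f mul0r.
  have [hI|/injectivePn [k [l kl hkl]]] := boolP (injectiveb h).
    rewrite big1 ?scale1r // => j _; have := injF_onto (injectiveP _ hI) j.
    by move=> ->; rewrite addr0.
  have [j jh] : exists j, j \notin codom h.
    apply/existsP; apply: contraT; rewrite negb_exists => /forallP hs.
    have /image_injP hI : #|codom h| == #|'I_r|.
      by apply/eqP/eq_card => j; have := hs j; rewrite negbK => ->.
    by rewrite (hI k l _ _ hkl) ?eqxx in kl.
  by rewrite (bigD1 j) //= (negPf jh) subrr mul0r scale0r.
rewrite (reindex (@pval _)) /=; last first.
  pose in_Sr := insubd (1%g : 'S_r).
  by exists in_Sr => /= g Ug; first apply: val_inj; apply: insubdK.
apply: eq_big => [s|s _]; first exact: (valP s).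
by apply: tmap_ext => k; rewrite -pvalE.
Qed.
End Polarization.

Section Irreducible.
Variables (K : fieldType) (charK : [pchar K] =i pred0) (n : nat) (R : 'I_n -> nat).
Local Notation spaces := ('I_n -> vectType K).
Variables (F : mfunctor K n) (c : AR K R).
Local Notation T V := (tens (fun i => tpow (R i) (V i))).
Variables (iota : forall V : spaces, 'Hom(F V, T V)) (rho : forall V : spaces, 'Hom(T V, F V)).
Hypothesis rho_natural : forall (V W : spaces) (f : forall i, 'Hom(V i, W i)) t,
  rho W (tmap (fun i => tpow_map (R i) (f i)) t) = fmap F f (rho V t).
Hypothesis iotaK : forall V t, iota V (rho V t) = actT V c t.
Variable k : K.
Hypotheses (kn : k != 0) (rhoK : forall V x, rho V (iota V x) = k *: x).
Variables (V : spaces) (U : {vspace F V}).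
Hypothesis Ug : forall g : forall i, 'End(V i), (forall i, bijective (g i)) -> (fmap F g @: U <= U)%VS.

Lemma fmap_rho f x : fmap F f x = k^-1 *: rho V (tmap (fun i => tpow_map (R i) (f i)) (iota V x)).
Proof. by rewrite rho_natural rhoK linearZ scalerA mulVf // scale1r. Qed.

(* Membership in U is a linear condition and f - t is invertible for all but finitely many t. *)
Lemma stable_End (f : forall i, 'End(V i)) x : x \in U -> fmap F f x \in U.
Proof.
move=> xU; pose ft (t : K) i : 'End(V i) := (f i - t *: \1%VF)%VF.
(* [true] marks the factors in which -t replaces [f], so [e C] is the power of t that the choice [C]
   contributes. *)
pose h i (b : bool) : 'End(V i) := if b then - \1%VF else f i.
pose J : finType := {dffun forall i, {dffun forall _ : 'I_(R i), bool}}.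
pose X (C : J) : 'End(T V) := tmap (fun i => tmap (fun j : 'I_(R i) => h i (C i j))).
pose e (C : J) : nat := (\sum_i \sum_j C i j)%N.
have ftE t : tmap (fun i => tpow_map (R i) (ft t i)) = \sum_C t ^+ e C *: X C.
  have -> : tmap (fun i => tpow_map (R i) (ft t i)) =
      tmap (fun i => \sum_(B : {dffun forall _ : 'I_(R i), bool})
        (\prod_j t ^+ B j) *: tmap (fun j : 'I_(R i) => h i (B j))).
    apply: tmap_ext => i.
    rewrite -(tmap_sum (fun (_ : 'I_(R i)) (b : bool) => t ^+ b) (fun (_ : 'I_(R i)) (b : bool) => h i b)).
    apply: tmap_ext => j; rewrite /ft /h big_bool /= expr1 expr0 scale1r.
    by rewrite scalerN addrC.
  rewrite tmap_sum; apply: eq_bigr => C _; congr (_ *: _).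
  rewrite /e -prodrXr; apply: eq_bigr => i _.
  by rewrite -prodrXr.
pose pi : 'End(F V) := (\1 - projv U)%VF.
have piU y : (pi y == 0) = (y \in U).
  rewrite add_lfunE opp_lfunE id_lfunE subr_eq0; apply/eqP/idP => [->|/projv_id -> //].
  exact: memv_proj.
pose a C : F V := pi (k^-1 *: rho V (X C (iota V x))).
have aE t : \sum_C t ^+ e C *: a C = pi (fmap F (ft t) x).
  rewrite fmap_rho ftE sum_lfunE (linear_sum (rho V)) scaler_sumr (linear_sum pi).
  apply: eq_bigr => C _; rewrite scale_lfunE.
  transitivity (pi (k^-1 *: (t ^+ e C *: rho V (X C (iota V x))))).
    by rewrite /a -[LHS]linearZ scalerA mulrC -scalerA.
  by congr (pi (_ *: _)); exact/esym/linearZ.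
have Q i : {q : {poly K} | q != 0 /\ forall t, ~~ root q t -> bijective (ft t i)}.
  by apply: cid; have [q qn qP] := bij_char_poly (f i); exists q.
have qn : \prod_i projT1 (Q i) != 0.
  by apply/prodf_neq0 => i _; have [] := projT2 (Q i).
have qP t : ~~ root (\prod_i projT1 (Q i)) t -> forall i, bijective (ft t i).
  move=> nr i; have [_] := projT2 (Q i); apply; apply: contraNN nr => rq.
  by rewrite rootE horner_prod (bigD1 i) //= (eqP rq) mul0r.
have f0 : ft 0 = f.
  by apply: functional_extensionality_dep => i; rewrite /ft scale0r subr0.
rewrite -piU -{1}f0 -aE (poly_map_eq0 charK _ qn) // => t /qP bt.
by rewrite aE; apply/eqP; rewrite piU (subvP (Ug bt)) // memv_img.
Qed.

Lemma stable_perms (f : forall i, 'I_(R i) -> 'End(V i)) x : x \in U ->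
  rho V (tmap (fun i => \sum_(s : 'S_(R i)) tmap (fun j => f i (s j))) (iota V x)) \in U.
Proof.
move=> xU.
have -> : tmap (fun i => \sum_(s : 'S_(R i)) tmap (fun j => f i (s j))) =
    tmap (fun i => \sum_(B : {set 'I_(R i)}) (\prod_j (if j \in B then 1 else -1)) *:
      tpow_map (R i) (\sum_(j in B) f i j)) :> 'End(T V).
  by apply: tmap_ext => i; rewrite polarization.
rewrite tmap_sum sum_lfunE (linear_sum (rho V)); apply: memv_suml => B _.
rewrite scale_lfunE linearZ /= memvZ // rho_natural rhoK linearZ memvZ //.
exact: stable_End.
Qed.

Local Notation nidxV := (nidx (fun i (_ : 'I_(R i)) => V i)).

Lemma ncoord_perm (L : nidxV) (g : GR R) t :
  ncoord [ffun i => [ffun j => L i (g i j)] : {dffun forall _ : 'I_(R i), _}] t = ncoord L (rhoT V g t).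
Proof.
rewrite [t]ncoord_sum !linear_sum; apply: eq_bigr => M _; rewrite !linearZ /=; congr (_ * _).
rewrite /nbasis /rhoT tmap_ptens ncoord_nptens.
rewrite (ptens_ext (v := fun i => ptens (fun j => ebasis (M i ((g i)^-1%g j))))); last first.
  by move=> i; rewrite permt_ptens.
rewrite (ncoord_nptens L (fun i j => ebasis (M i ((g i)^-1%g j)))); apply: eq_bigr => i _.
rewrite [RHS](reindex_inj (@perm_inj _ (g i))) /=; apply: eq_bigr => j _.
by rewrite !ffunE permK.
Qed.

(** For a basis tensor W, take maps that send one basis vector of [L] to the corresponding one of W
    and the others to zero; [stable_perms] then yields this sum. *)
Lemma stable_coef (L : nidxV) x W : x \in U ->
  rho V (\sum_g ncoord L (rhoT V g (iota V x)) *: rhoT V (g^-1)%g W) \in U.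
Proof.
move=> xU; rewrite [W]ncoord_sum.
have -> : \sum_g ncoord L (rhoT V g (iota V x)) *: rhoT V (g^-1)%g (\sum_M ncoord M W *: nbasis M) =
   \sum_M ncoord M W *: \sum_g ncoord L (rhoT V g (iota V x)) *: rhoT V (g^-1)%g (nbasis M).
  under eq_bigr => g _ do rewrite linear_sum scaler_sumr.
  rewrite exchange_big; apply: eq_bigr => M _; rewrite scaler_sumr; apply: eq_bigr => g _.
  by rewrite linearZ /= !scalerA mulrC.
rewrite linear_sum; apply: memv_suml => M _; rewrite linearZ memvZ //.
pose f i (j : 'I_(R i)) : 'End(V i) := lext (fun l => (l == L i j)%:R *: ebasis (M i j)).
have := stable_perms f xU; congr (_ \in U); congr (rho V _).
set t := iota V x.
have -> : tmap (fun i => \sum_(s : 'S_(R i)) tmap (fun j => f i (s j))) =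
    \sum_(g : GR R) tmap (fun i => tmap (fun j => f i (g i j))) :> 'End(T V).
  rewrite (tmap_ext (g := fun i => \sum_(s : 'S_(R i)) 1 *: tmap (fun j => f i (s j)))); last first.
    by move=> i; apply: eq_bigr => s _; rewrite scale1r.
  rewrite tmap_sum; apply: eq_bigr => g _.
  by rewrite big1 ?scale1r.
rewrite sum_lfunE; apply: eq_bigr => g _; rewrite -ncoord_perm.
rewrite [t]ncoord_sum !linear_sum scaler_suml; apply: eq_bigr => N _.
rewrite !linearZ -scalerA; congr (_ *: _).
rewrite [LHS](nptens_map (fun i (j : 'I_(R i)) => f i (g i j))).
rewrite /= ncoord_nptens /rhoT tmap_ptens; refine (etrans _ (ptensZ _ _)); apply: ptens_ext => i.
rewrite permt_ptens; refine (etrans _ (ptensZ _ _)); apply: ptens_ext => j.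
by rewrite lext_ebasis !ffunE ecoord_ebasis invgK.
Qed.

Hypothesis cP : primitive c.

(** A nonzero coordinate of [iota V x] gives z with z c = k z and z(1) nonzero, so c z c is a
    nonzero multiple of c. By [stable_coef] its action leads into U from any tensor, and [rho] is
    surjective. *)
Lemma stable_full x : x \in U -> x != 0 -> U = fullv.
Proof.
move=> xU xn; have [L Ln] : exists L : nidxV, ncoord L (iota V x) != 0.
  apply: contrapT => nL; case/eqP: xn; apply: (scalerI kn); rewrite -rhoK scaler0.
  rewrite [iota V x]ncoord_sum big1 ?linear0 // => L _.
  have -> : ncoord L (iota V x) = 0 by apply/eqP; apply: contrapT => Ln; apply: nL; exists L; apply/negP.
  by rewrite scale0r.
pose t := iota V x.
have ct : actT V c t = k *: t by rewrite -iotaK rhoK linearZ.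
pose z : AR K R := \sum_g ncoord L (rhoT V g t) *: gdelta K (g^-1)%g.
have zc : z * c = k *: z.
  transitivity (\sum_h \sum_g (c h * ncoord L (rhoT V g t)) *: gdelta K (g^-1 * h)%g).
    rewrite [in LHS](galg_sum c) mulr_sumr; apply: eq_bigr => h _.
    rewrite -scalerAr mulr_suml scaler_sumr; apply: eq_bigr => g _.
    by rewrite -scalerAl gdeltaM scalerA.
  transitivity (\sum_u \sum_h (c h * ncoord L (rhoT V (h * u)%g t)) *: gdelta K (u^-1)%g).
    rewrite [RHS]exchange_big; apply: eq_bigr => h _.
    rewrite (reindex_inj (mulgI h)) /=; apply: eq_bigr => u _.
    by rewrite invMg mulgKV.
  rewrite scaler_sumr; apply: eq_bigr => u _; rewrite -scaler_suml scalerA; congr (_ *: _).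
  transitivity (ncoord L (rhoT V u (k *: t))); last by rewrite !linearZ.
  rewrite -ct /actT gactE !linear_sum; apply: eq_bigr => h _.
  by rewrite !linearZ /= rhoTM comp_lfunE.
have z1 : z 1%g = ncoord L t.
  rewrite sum_ffunE (bigD1 1%g) //= big1 ?addr0 => [|g gn].
    by rewrite !ffunE invg1 eqxx rhoT1 id_lfunE /GRing.scale /= mulr1.
  by rewrite !ffunE eq_sym invg_eq1 (negPf gn) scaler0.
have key W : actT V (c * z * c) W = iota V (rho V (\sum_g ncoord L (rhoT V g t) *: rhoT V (g^-1)%g (actT V c W))).
  rewrite !actTM iotaK; congr (actT V c _).
  rewrite (linear_sum (actT V)) sum_lfunE; apply: eq_bigr => g _.
  by rewrite linearZ /= scale_lfunE /actT gact_delta.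
have rU W : rho V W \in U.
  have := key W; rewrite primitive_sandwich // zc.
  set s := _ * _; set Y := \sum_g _ => sY.
  have sn : s != 0 by rewrite mulf_neq0 ?kappa_neq0 // ffunE mulf_neq0 // z1.
  have : rho V Y \in U by apply: stable_coef.
  have -> : rho V Y = s *: rho V W.
    apply: (scalerI kn); rewrite -rhoK -sY linearZ /= scale_lfunE -iotaK.
    by rewrite linearZ /= rhoK !scalerA mulrC.
  by move/(memvZ s^-1); rewrite scalerK.
apply/eqP; rewrite eqEsubv subvf; apply/subvP => y _.
by rewrite -[y](scalerK kn) -rhoK memvZ // rU.
Qed.
End Irreducible.

Lemma splits_irreducible (K : fieldType) (charK : [pchar K] =i pred0) (n : nat) (R : 'I_n -> nat)
    (F : mfunctor K n) (c : AR K R) V :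
  primitive c -> splits F c -> gl_irreducible F V.
Proof.
move=> cP [iota [rho [niota nrho iotaK [k kn rhoK]]]] U Ug.
have [->|Un] := eqVneq U 0%VS; [by left | right].
apply: (stable_full charK nrho iotaK kn rhoK Ug cP (memv_pick U)).
by rewrite vpick0.
Qed.

(** * The decomposition *)

(** For a variable [d] equal to zero, S_(d+p) and S_p are different types, identified by
    [pshift]. *)
Lemma young_pshift0 (K : fieldType) d p sh : d = 0%N ->
  young K (d + p) sh = gmap (@pshift d p) (young K p sh) /\
  kappa (young K (d + p) sh) = kappa (young K p sh).
Proof.
move=> ->; split=> //; rewrite [LHS]galg_sum; apply: eq_bigr => s _; congr (_ *: gdelta K _).
apply/permP => i; have -> : i = rshift 0 i by apply: val_inj.
by rewrite pshiftr; apply: val_inj => /=; congr (val (s _)); apply: val_inj.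
Qed.

(** Acting twice by c on the test tensor gives c c = k c, by faithfulness. *)
Lemma splits_kappa (K : fieldType) (n : nat) (R : 'I_n -> nat) (F : mfunctor K n) (c : AR K R)
    (iota : forall V, 'Hom(F V, TR K R V)) (rho : forall V, 'Hom(TR K R V, F V)) k :
    primitive c -> (forall V t, iota V (rho V t) = actT V c t) ->
    (forall V x, rho V (iota V x) = k *: x) ->
  k = kappa c.
Proof.
move=> cP iotaK rhoK; have : c * c = k *: c.
  apply: actT_faithful; rewrite actTM -!iotaK rhoK !linearZ /= iotaK.
  by rewrite scale_lfunE.
rewrite primitive_sq // => /eqP; rewrite -subr_eq0 -scalerBl scaler_eq0.
by rewrite (negPf (primitive_neq0 cP)) orbF subr_eq0 => /eqP.
Qed.

(** The module version of [kos_shift], for a larger group that acts on the slots through [pi]. *)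
Lemma kosm_transport (K : fieldType) (a p : nat) (M : vectType K) (H : finType)
    (rs : 'S_(a + p) -> 'End(M)) (ra : H -> 'End(M)) (pi : H -> 'S_p) (x : H -> K) (t : M) :
    (forall g u s, rs u (ra g s) = ra g (rs (u ^ (pshift a (pi g))^-1)%g s)) ->
  kosm rs t -> kosm rs (\sum_g x g *: ra g t).
Proof.
move=> rsa [t1 t2]; split=> [i i'|j].
  rewrite linear_sum; apply: eq_bigr => g _; rewrite linearZ /= rsa; congr (_ *: ra g _).
  by rewrite tpermJ -pshiftV !pshiftl t1.
rewrite (eq_bigr (fun i => \sum_g x g *: ra g (rs (tperm (lshift p i)
    (rshift a ((pi g)^-1%g j))) t))) => [|i _]; last first.
  rewrite linear_sum; apply: eq_bigr => g _; rewrite linearZ /= rsa; congr (_ *: ra g _).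
  by rewrite tpermJ -pshiftV pshiftl pshiftr.
rewrite exchange_big -big_split big1 // => g _ /=.
by rewrite -scaler_sumr -scalerDr -linear_sum -linearD t2 linear0 scaler0.
Qed.

Lemma actTZ (K : fieldType) n (R : 'I_n -> nat) V k (x : AR K R) t :
  actT V (k *: x) t = k *: actT V x t.
Proof. by rewrite linearZ /= scale_lfunE. Qed.

(** * S_p^n acting on the last p factors of every slot *)

Section Slots.
Variables (K : fieldType) (charK : [pchar K] =i pred0) (n p : nat) (dd : 'I_n -> nat).
Local Notation R := (fun i => (dd i + p)%N).
Local Notation Rp := (fun _ : 'I_n => p).
Local Notation spaces := ('I_n -> vectType K).
Variable i0 : 'I_n.
Hypothesis dd0 : forall i, i != i0 -> dd i = 0%N.

Definition allshift (g : GR Rp) : GR R := [ffun i => pshift (dd i) (g i)].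
Lemma allshiftM : {morph allshift : g h / (g * h)%g}.
Proof. by move=> g h; apply/ffunP => i; rewrite !ffunE pshiftM. Qed.
Lemma allshift_diag_perm s : allshift (diag_perm n s) = diag dd s.
Proof. by apply/ffunP => i; rewrite !ffunE. Qed.

Definition lift_AR : AR K Rp -> AR K R := gmap allshift.
HB.instance Definition _ := GRing.Linear.on lift_AR.
Lemma lift_ARZ k x : lift_AR (k *: x) = k *: lift_AR x.
Proof. exact: linearZ. Qed.
Lemma lift_ARM x y : lift_AR (x * y) = lift_AR x * lift_AR y.
Proof. exact: (gmapM allshiftM). Qed.

Lemma lift_AR_gtens (x : forall i : 'I_n, galg K 'S_p) :
  lift_AR (gtens x) = gtens (fun i => gmap (@pshift (dd i) p) (x i)).
Proof.
rewrite [RHS](_ : _ = gtens (fun i => \sum_s x i s *: gdelta K (pshift (dd i) s))) //.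
rewrite gtens_sum; apply: eq_bigr => g _; rewrite ffunE gtensZ; congr (_ *: _).
by rewrite -gtens_delta; apply: gtens_ext => i; rewrite ffunE.
Qed.

Lemma actT_lift_AR (V : spaces) x (t : tens (fun i => tpow (R i) (V i))) :
  actT V (lift_AR x) t = \sum_g x g *: rhoT V (allshift g) t.
Proof.
rewrite /lift_AR /gmap (linear_sum (actT V)) sum_lfunE; apply: eq_bigr => g _.
by rewrite linearZ /= scale_lfunE /actT gact_delta.
Qed.

Lemma kosm_lift (V : spaces) x (t : tens (fun i => tpow (R i) (V i))) :
  kosm (rslot (i0 := i0) V) t -> kosm (rslot (i0 := i0) V) (actT V (lift_AR x) t).
Proof.
move=> kt; have shift_rslot g u s : rslot (i0 := i0) V u (rhoT V (allshift g) s) =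
    rhoT V (allshift g) (rslot (i0 := i0) V (u ^ (pshift (dd i0) (g i0))^-1)%g s).
  rewrite /rslot -[LHS]comp_lfunE -[RHS]comp_lfunE -!rhoTM; congr (rhoT V _ s).
  apply/ffunP => i; rewrite !ffunE; have [<-|ne] := eqVneq i0 i; last by rewrite !dfwith_out // mulg1 mul1g.
  by rewrite !dfwith_in conjgE invgK -!mulgA mulVg mulg1.
have := kosm_transport (pi := fun g : GR Rp => g i0) x shift_rslot kt.
by rewrite actT_lift_AR.
Qed.

Lemma gsign_diag_perm s : gsign K n p * gdelta K (diag_perm n s) = (-1) ^+ s *: gsign K n p.
Proof.
rewrite /gsign -[LHS]scalerAl [RHS]scalerA mulrC -[RHS]scalerA; congr (_ *: _).
rewrite mulr_suml scaler_sumr [RHS](reindex_inj (mulIg s)) /=; apply: eq_bigr => t _.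
rewrite -scalerAl gdeltaM -diag_permM scalerA odd_permM signr_addb mulrCA -expr2 sqrr_sign mulr1 //.
Qed.

(** The factor [gsign] at the right end of [x] provides the antisymmetry; the other conditions
    survive by [kosm_lift]. *)
Lemma koszul_tensor_lift (V : spaces) x (t : tens (fun i => tpow (R i) (V i))) :
    x * gsign K n p = x -> kosm (rslot (i0 := i0) V) t ->
  koszul_tensor i0 (actT V (lift_AR x) t).
Proof.
move=> xe kt; split=> [s|]; last exact: kosm_lift.
transitivity (actT V (lift_AR x * gdelta K (diag dd s)) t).
  by rewrite actTM; congr (fun_of_lfun _ _); rewrite /actT gact_delta.
have -> : lift_AR x * gdelta K (diag dd s) = (-1) ^+ s *: lift_AR x.
  rewrite -allshift_diag_perm -(gmap_delta K allshift) -[gmap _ _]/(lift_AR _) -lift_ARM -{1}xe -mulrA.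
  by rewrite gsign_diag_perm -scalerAr lift_ARZ xe.
by rewrite actTZ.
Qed.

Lemma koszul_tensor_gsign (V : spaces) (t : tens (fun i => tpow (R i) (V i))) :
  koszul_tensor i0 t -> actT V (lift_AR (gsign K n p)) t = t.
Proof.
move=> [tA _]; have -> : lift_AR (gsign K n p) =
    p`!%:R^-1 *: \sum_(s : 'S_p) (-1) ^+ s *: gdelta K (diag dd s).
  rewrite /gsign lift_ARZ (linear_sum lift_AR) /=; congr (_ *: _); apply: eq_bigr => s _.
  by rewrite lift_ARZ /lift_AR gmap_delta allshift_diag_perm.
rewrite actTZ (linear_sum (actT V)) sum_lfunE.
rewrite (eq_bigr (fun=> t)) => [|s _].
  by rewrite sumr_const card_Sn -scaler_nat scalerA mulVf ?scale1r // factK0.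
rewrite actTZ /actT gact_delta tA.
by rewrite scalerA -expr2 sqrr_sign scale1r.
Qed.

End Slots.

Lemma kosm_gact (K : fieldType) (a p : nat) (M : vectType K) (rho : 'S_(a + p) -> 'End(M))
    x t : (forall g h, rho (g * h)%g = (rho h \o rho g)%VF) ->
  kos x -> kosm rho (gact rho x t).
Proof.
move=> rM [k1 k2]; split=> [i i'|j].
  by rewrite -(gact_delta rho) -gactME // k1.
under eq_bigr => i _ do rewrite -(gact_delta rho) -gactME //.
by rewrite -sum_lfunE -linear_sum -add_lfunE -linearD k2 linear0 zero_lfunE.
Qed.

Section SlotPair.
Variables (K : fieldType) (charK : [pchar K] =i pred0) (n p : nat) (dd : 'I_n -> nat).
Local Notation R := (fun i => (dd i + p)%N).
Local Notation Rp := (fun _ : 'I_n => p).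
Local Notation spaces := ('I_n -> vectType K).
Local Notation T V := (tens (fun i => tpow (R i) (V i))).
Variable i0 : 'I_n.
Hypothesis dd0 : forall i, i != i0 -> dd i = 0%N.
Variable lam : 'I_n -> intpart p.

Definition ysym : AR K Rp := gtens (fun i => young K p (parts (lam i))).
Local Notation a := (dd i0).
Local Notation la := (parts (lam i0)).
Local Notation cnu := (young K (a + p) (a :: la)).
Local Notation yl := (gmap (@pshift a p) (young K p la)).

Definition padded_young i : galg K 'S_(dd i + p) :=
  young K (dd i + p) (if i == i0 then dd i :: parts (lam i) else parts (lam i)).
Definition pad_sym : AR K R := gtens padded_young.

(** A product of two such elements squares the Young symmetrizers in the slots other than [i0],
    which is where [kappa_other] comes from. *)
Definition fill (x : galg K 'S_(a + p)) : AR K R :=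
  gtens (dfwith (fun i => gmap (@pshift (dd i) p) (young K p (parts (lam i))) : galg K 'S_(R i)) x).
Definition kappa_other := \prod_(i | i != i0) kappa (young K p (parts (lam i))).

Lemma fillM x y : fill x * fill y = kappa_other *: fill (x * y).
Proof.
rewrite /kappa_other big_mkcond /= gtensM -gtensZ; apply: gtens_ext => i.
have [<-|ne] := eqVneq i0 i; first by rewrite /= scale1r !dfwith_in.
rewrite /= !dfwith_out // -(gmapM (@pshiftM _ _)) primitive_sq ?linearZ //.
by apply: young_primitive => //; apply: parts_sumn.
Qed.

Lemma fill_slot x : fill x = gmap (@slot n p dd i0) x * fill 1.
Proof.
rewrite -gtens_slot gtensM; apply: gtens_ext => i.
have [<-|ne] := eqVneq i0 i; first by rewrite !dfwith_in mulr1.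
by rewrite !dfwith_out // mul1r.
Qed.

Lemma slot_fill x : fill x = fill 1 * gmap (@slot n p dd i0) x.
Proof.
rewrite -gtens_slot gtensM; apply: gtens_ext => i.
have [<-|ne] := eqVneq i0 i; first by rewrite !dfwith_in mul1r.
by rewrite !dfwith_out // mulr1.
Qed.

Lemma fillZ k x : fill (k *: x) = k *: fill x.
Proof. by rewrite fill_slot linearZ -scalerAl -fill_slot. Qed.

Lemma lift_ysym : lift_AR dd ysym = fill yl.
Proof.
rewrite lift_AR_gtens; apply: gtens_ext => i.
by have [<-|ne] := eqVneq i0 i; rewrite ?dfwith_in ?dfwith_out.
Qed.

Lemma pad_symE : pad_sym = fill cnu.
Proof.
apply: gtens_ext => i; rewrite /padded_young; have [<-|ne] := eqVneq i0 i.
  by rewrite dfwith_in.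
rewrite dfwith_out //; rewrite eq_sym in ne.
by rewrite (young_pshift0 K p (parts (lam i)) (dd0 ne)).1.
Qed.

Lemma pad_sym_primitive : primitive pad_sym.
Proof.
apply: gtens_primitive => i; apply: young_primitive => //.
case: eqVneq => [_|ne]; first by rewrite /= parts_sumn.
by rewrite parts_sumn dd0.
Qed.

Lemma kappa_pad_sym : kappa pad_sym = kappa cnu * kappa_other.
Proof.
rewrite gtens_kappa (bigD1 i0) //= /padded_young eqxx; congr (_ * _).
apply: eq_bigr => i ne; rewrite (negPf ne).
exact: (young_pshift0 K p (parts (lam i)) (dd0 ne)).2.
Qed.

Lemma kappa_ysym : kappa ysym = kappa (young K p la) * kappa_other.
Proof. by rewrite gtens_kappa (bigD1 i0). Qed.

Lemma kappa_other_neq0 : kappa_other != 0.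
Proof.
apply/prodf_neq0 => i _; apply: kappa_neq0 => //.
by apply: young_primitive => //; apply: parts_sumn.
Qed.

Lemma actT_fill (V : spaces) x (t : T V) :
  actT V (fill x) t = actT V (fill 1) (gact (rslot (i0 := i0) V) x t).
Proof. by rewrite fill_slot actTM actT_slot. Qed.

Lemma actT_kinv_kkey (V : spaces) (t : T V) : (forall k, (nth 0%N la k <= a)%N) ->
    kosm (rslot (i0 := i0) V) t ->
  actT V (fill (yl * kinv K a p la * kkey K a p la)) t =
  (kscale K a p la * kappa cnu) *: actT V (fill yl) t.
Proof.
move=> laa kt; have rM := @rslotM K n p dd i0 V.
refine (etrans (actT_fill _ _) _).
transitivity (actT V (fill 1) ((kscale K a p la * kappa cnu) *: gact (rslot (i0 := i0) V) yl t)).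
  congr (fun_of_lfun _ _).
  refine (etrans (gactME rM _ _ _) _).
  refine (etrans (congr1 _ (gactME rM _ _ _)) _).
  exact: (kosm_kinv_kkey charK rM (@rslot1 K n p dd i0 V) (parts_sumn (lam i0)) (parts_sorted (lam i0)) laa kt).
refine (etrans (linearZ _ _) _); congr (_ *: _).
exact/esym/actT_fill.
Qed.

Variables (S : mfunctor K n).

(* Multiplication by [kkey] and [kinv] exchanges the images of S_la in V^⊗p, sitting
   inside the Koszul kernel, and of S_(a, la) in V^⊗(a+p). *)
Lemma slot_pair : (forall k, (nth 0%N la k <= a)%N) -> splits S pad_sym ->
  exists (I : forall V, 'Hom(S V, TR K R V)) (J : forall V, 'Hom(TR K R V, S V)),
  [/\ natural I, natural J,
      forall V x, kosm (rslot (i0 := i0) V) (I V x),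
      forall V x, J V (actT V (lift_AR dd ysym) (I V x)) = kappa ysym *: x &
      forall V t, kosm (rslot (i0 := i0) V) t ->
        I V (J V (actT V (lift_AR dd ysym) t)) = actT V (lift_AR dd ysym) t].
Proof.
move=> laa [iota [rho [niota nrho iotaK [k kn rhoK]]]].
have lap := parts_sumn (lam i0).
have las := parts_sorted (lam i0).
have kE := splits_kappa pad_sym_primitive iotaK rhoK.
have ks0 : kscale K a p la != 0 by apply: kscale_neq0.
have kc0 : kappa cnu != 0.
  by apply: kappa_neq0 => //; apply: young_primitive; rewrite //= lap.
have k'0 := kappa_other_neq0.
(* [kscale] comes from [kkey_kinv] and [k ^+ 2] from rho iota occurring twice. Of the two factors
   [kappa_other] produced by [fillM], one is kept to form [kappa ysym]. *)
pose s := (kscale K a p la * kappa_other * k ^+ 2)^-1.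
pose I V : 'Hom(S V, TR K R V) := (actT V (fill (kkey K a p la)) \o iota V)%VF.
pose J V : 'Hom(TR K R V, S V) := (s *: (rho V \o actT V (fill (kinv K a p la))))%VF.
have IE V x : I V x = actT V (fill (kkey K a p la)) (iota V x) by rewrite [LHS]comp_lfunE.
have JE V t : J V t = s *: rho V (actT V (fill (kinv K a p la)) t).
  by rewrite [LHS]scale_lfunE; congr (_ *: _); exact: comp_lfunE.
exists I, J; split.
- by move=> V W f x; rewrite [LHS]IE [in RHS]IE niota; apply: actT_natural.
- move=> V W f t; rewrite [LHS]JE [in RHS]JE [RHS]linearZ /=; congr (_ *: _).
  by refine (etrans _ (nrho _ _ f _)); congr (rho W _); apply: actT_natural.
- move=> V x; rewrite IE slot_fill.
  rewrite actTM actT_slot; apply: (kosm_gact _ (@rslotM _ _ _ _ _ _)).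
  exact: kos_kkey.
- move=> V x; rewrite JE IE lift_ysym -!actTM mulrA.
  rewrite !fillM -!scalerAl !fillM kkey_shift // -scalerAl kkey_kinv // !fillZ -pad_symE.
  rewrite !actTZ -iotaK !linearZ /= rhoK rhoK.
  rewrite !scalerA; congr (_ *: _); rewrite kappa_ysym /s; field.
  by rewrite k'0 kn ks0.
move=> V t kt; rewrite IE JE lift_ysym.
rewrite linearZ linearZ /= iotaK pad_symE -!actTM !mulrA.
rewrite !fillM -!scalerAl !fillM -!scalerAl !fillM.
rewrite -[_ * cnu * _]mulrA young_kkey // -scalerAr fillZ !scalerA actTZ scalerA.
rewrite actT_kinv_kkey // scalerA -[RHS]scale1r; congr (_ *: _).
(* Three products of [fill] and two factors [kappa cnu] have accumulated; they cancel against [s]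
   because k is [kappa cnu * kappa_other]. *)
by rewrite /s kE kappa_pad_sym; field; rewrite kc0 k'0 ks0.
Qed.

(** The target is zero, and so is the part of the kernel in shape [la] by [kosm_zero]; hence zero
    maps serve. *)
Lemma slot_pair_zero k : (a < nth 0%N la k)%N -> (forall V, trivial_space (S V)) ->
  exists (I : forall V, 'Hom(S V, TR K R V)) (J : forall V, 'Hom(TR K R V, S V)),
  [/\ natural I, natural J,
      forall V x, kosm (rslot (i0 := i0) V) (I V x),
      forall V x, J V (actT V (lift_AR dd ysym) (I V x)) = kappa ysym *: x &
      forall V t, kosm (rslot (i0 := i0) V) t ->
        I V (J V (actT V (lift_AR dd ysym) t)) = actT V (lift_AR dd ysym) t].
Proof.
move=> ak tS; exists (fun V => 0), (fun V => 0); split.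
- by move=> V W f x; rewrite [LHS]zero_lfunE [in RHS]zero_lfunE linear0.
- by move=> V W f x; apply: tS.
- move=> V x; rewrite zero_lfunE; split=> [i i'|j]; first by rewrite linear0.
  by rewrite big1 ?addr0 // => i _; rewrite linear0.
- by move=> V x; apply: tS.
move=> V t kt; rewrite zero_lfunE lift_ysym [RHS]actT_fill.
rewrite (kosm_zero charK (@rslotM _ _ _ _ _ _) (@rslot1 _ _ _ _ _ _) (parts_sumn (lam i0)) (parts_sorted (lam i0)) ak kt).
by rewrite linear0.
Qed.
End SlotPair.

Section Decomposition.
Variables (K : fieldType) (charK : [pchar K] =i pred0) (n p : nat) (dd : 'I_n -> nat).
Local Notation R := (fun i => (dd i + p)%N).
Local Notation Rp := (fun _ : 'I_n => p).
Local Notation spaces := ('I_n -> vectType K).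
Variables (i0 j0 : 'I_n) (q : int) (b : 'I_n -> int).
Hypothesis dd0 : forall i, i != i0 -> dd i = 0%N.
Hypothesis bE : forall i, b i + q = Posz (dd i).
Hypothesis b0 : b j0 + q = 0.

Local Notation index := {ffun 'I_n -> intpart p}.
Local Notation ys := (fun lam : index => ysym K lam).
Local Notation mult := (block_mult ys (gsign K n p)).

Lemma ysym_complete : complete_family ys.
Proof. exact: (gtens_complete 'I_n (young_complete charK p)). Qed.

Variable Sp : index -> mfunctor K n.
Hypothesis SpP : forall lam : index,
  ((forall k, (nth 0%N (parts (lam i0)) k <= dd i0)%N) /\ splits (Sp lam) (pad_sym K dd i0 lam)) \/
  ((exists k, (dd i0 < nth 0%N (parts (lam i0)) k)%N) /\ forall V, trivial_space (Sp lam V)).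

(** A pair (lam, k) contributes the inclusion [I] followed by [block_basis k], and the projection
    [block_dual k] followed by [J]. The expansion [block_sum] of [gsign] makes the composites sum to
    the identity of the kernel. *)
Lemma koszul_decomposition :
  nat_iso (Koszul K p q b) (big_dsum (fun lam => copies (mult lam) (Sp lam))).
Proof.
have [phi [nphi iphi kphi]] := Koszul_embedding charK p dd0 bE b0.
have eK := gsignK charK n p.
pose Q := Koszul K p q b; pose LA := @lift_AR K n p dd.
have kap0 lam : kappa (ys lam) != 0 := kappa_neq0 charK (ysym_complete.1.1 lam).
have pairs lam : exists (I : forall V, 'Hom(Sp lam V, TR K R V)) (J : forall V, 'Hom(TR K R V, Sp lam V)),
  [/\ natural I, natural J,
      forall V x, kosm (rslot (i0 := i0) V) (I V x),
      forall V x, J V (actT V (LA (ys lam)) (I V x)) = kappa (ys lam) *: x &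
      forall V t, kosm (rslot (i0 := i0) V) t ->
        I V (J V (actT V (LA (ys lam)) t)) = actT V (LA (ys lam)) t].
  have [[laa sS]|[[k ak] tS]] := SpP lam; first exact: (slot_pair charK dd0 laa sS).
  exact: (slot_pair_zero charK ak tS).
pose I lam := projT1 (cid (pairs lam)); pose J lam := projT1 (cid (projT2 (cid (pairs lam)))).
have IJ lam : [/\ natural (I lam), natural (J lam),
      forall V x, kosm (rslot (i0 := i0) V) (I lam V x),
      forall V x, J lam V (actT V (LA (ys lam)) (I lam V x)) = kappa (ys lam) *: x &
      forall V t, kosm (rslot (i0 := i0) V) t ->
        I lam V (J lam V (actT V (LA (ys lam)) t)) = actT V (LA (ys lam)) t].
  exact: (projT2 (cid (projT2 (cid (pairs lam))))).
have nI lam : natural (I lam) by have [] := IJ lam.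
have nJ lam : natural (J lam) by have [] := IJ lam.
have kI lam V x : kosm (rslot (i0 := i0) V) (I lam V x) by have [_ _ + _ _] := IJ lam; apply.
have JI lam V x : J lam V (actT V (LA (ys lam)) (I lam V x)) = kappa (ys lam) *: x.
  by have [_ _ _ + _] := IJ lam; apply.
have II lam V t : kosm (rslot (i0 := i0) V) t ->
    I lam V (J lam V (actT V (LA (ys lam)) t)) = actT V (LA (ys lam)) t.
  by have [_ _ _ _] := IJ lam; apply.
have nact (x : AR K R) : natural (fun V => actT V x : 'Hom(TR K R V, TR K R V)).
  by move=> V W f t; apply: actT_natural.
have lifts lam (k : 'I_(mult lam)) : exists f : forall V, 'Hom(Sp lam V, Q V),
    natural f /\ forall V x, phi V (f V x) = actT V (LA (block_basis k)) (I lam V x).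
  have [|V x|f [nf fE]] := @nat_lift K n Q (TR K R) (Sp lam) phi
    (fun V => actT V (LA (block_basis k)) \o I lam V)%VF nphi iphi.
  - by move=> V W f x; rewrite [LHS]comp_lfunE nI nact [in RHS]comp_lfunE.
  - apply/kphi; rewrite comp_lfunE.
    exact: koszul_tensor_lift (block_right eK (block_basis_mem k)) (kI lam V x).
  by exists f; split=> // V x; rewrite fE comp_lfunE.
pose u lam (k : 'I_(mult lam)) := projT1 (cid (lifts lam k)).
have nu lam k : natural (u lam k) := (projT2 (cid (lifts lam k))).1.
have uE lam k V x : phi V (u lam k V x) = actT V (LA (block_basis k)) (I lam V x) :=
  (projT2 (cid (lifts lam k))).2 V x.
pose v lam (k : 'I_(mult lam)) V : 'Hom(Q V, Sp lam V) := (J lam V \o actT V (LA (block_dual k)) \o phi V)%VF.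
have vE lam k V y : v lam k V y = J lam V (actT V (LA (block_dual k)) (phi V y)) by rewrite !comp_lfunE.
have nv lam k : natural (v lam k) by move=> V W f y; rewrite [LHS]vE [in RHS]vE nphi nact nJ.
have LAM x y V t : actT V (LA y) (actT V (LA x) t) = actT V (LA (x * y)) t.
  by rewrite -actTM -lift_ARM.
apply: (@big_dsum_copies_iso K n Q index Sp mult u v) => //.
- move=> lam k l V x; rewrite vE uE LAM (block_basis_dual charK ysym_complete eK).
  case: eqP => _; last by rewrite /LA linear0 linear0 zero_lfunE linear0.
  by rewrite /LA lift_ARZ actTZ linearZ /= JI scalerA mulVf ?scale1r.
- move=> lam mu k l V x ne; rewrite vE uE LAM (block_basis_dual_neq charK ysym_complete _ _ ne).
  by rewrite /LA linear0 linear0 zero_lfunE linear0.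
move=> V y; apply: iphi; rewrite linear_sum.
have kt : koszul_tensor i0 (phi V y) by apply/kphi; exists y.
transitivity (\sum_lam \sum_(k < mult lam) actT V (LA (block_dual k * block_basis k)) (phi V y)); last first.
  apply: eq_bigr => lam _; rewrite linear_sum; apply: eq_bigr => k _.
  refine (etrans _ (esym (uE _ _ _ _))); rewrite vE -LAM; congr (actT V _ _).
  set s := actT V (LA (block_dual k)) (phi V y).
  have ks : kosm (rslot (i0 := i0) V) s := kosm_lift _ kt.2.
  (* [block_dual k] absorbs [ysym] on the right up to [kappa], so [s] lies in its image, where [I]
     undoes [J]. *)
  have sE : (kappa (ys lam))^-1 *: actT V (LA (ys lam)) s = s.
    by rewrite /s LAM (block_dual_right ysym_complete) /LA lift_ARZ actTZ scalerA mulVf ?scale1r.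
  transitivity ((kappa (ys lam))^-1 *: I lam V (J lam V (actT V (LA (ys lam)) s))).
    by rewrite II // sE.
  refine (etrans (esym (linearZ _ _)) _); congr (I lam V _).
  by refine (etrans (esym (linearZ _ _)) _); congr (J lam V _).
rewrite -{1}(koszul_tensor_gsign charK kt) {1}(block_sum charK ysym_complete (gsign K n p)).
rewrite (linear_sum (lift_AR dd)) (linear_sum (actT V)) sum_lfunE; apply: eq_bigr => lam _.
by rewrite (linear_sum (lift_AR dd)) (linear_sum (actT V)) sum_lfunE.
Qed.

End Decomposition.

Lemma SchurF_splits0 (K : fieldType) (charK : [pchar K] =i pred0) n p sh (i : 'I_n) d :
  d = 0%N -> sumn sh = p -> splits1 (SchurF p sh (ProjF K i)) i (young K (d + p) sh).
Proof. by move=> -> shp; apply: SchurF_splits1. Qed.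

Theorem theorem6p1 (K : fieldType) (charK : [pchar K] =i pred0)
    (n : nat) (hn : (1 < n)%N) (p : nat) (a : int) :
  let B (i : 'I_n) : int := if i == 0%N :> nat then a else 0 in
  let S (lam : {ffun 'I_n -> intpart p}) : mfunctor K n :=
    TensF (fun i => SchurF p (parts (lam i)) (ProjF K i)) in
  let m (lam : {ffun 'I_n -> intpart p}) : nat :=
    multiplicity (S lam) (ExtF p (TensF (@ProjF K n))) in
  let Spad (lam : {ffun 'I_n -> intpart p}) : mfunctor K n :=
    TensF (fun i : 'I_n => if i == 0%N :> nat
                     then SchurPadF p (parts (lam i)) (p%:Z + a) (ProjF K i)
                     else SchurF p (parts (lam i)) (ProjF K i)) in
  nat_iso (Koszul K p 0 B) (big_dsum (fun lam => copies (m lam) (Spad lam)))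
  /\ forall (V : 'I_n -> vectType K) (lam : {ffun 'I_n -> intpart p}),
       gl_irreducible (Spad lam) V.
Proof.
move=> B S m Spad.
(* The degree in [j0] is zero, so the incoming Koszul term has degree -1 there and yields no
   boundaries. *)
pose i0 : 'I_n := Ordinal (ltnW hn); pose j0 : 'I_n := Ordinal hn.
(* For negative [a] the absolute value is a mere placeholder, as every functor involved is then
   zero. *)
pose dd (i : 'I_n) : nat := if i == i0 then `|a|%N else 0%N.
have dd0 i : i != i0 -> dd i = 0%N by rewrite /dd => /negPf ->.
have ddi0 : dd i0 = `|a|%N by rewrite /dd eqxx.
have multE lam : m lam = block_mult (fun lam : {ffun 'I_n -> intpart p} => ysym K lam) (gsign K n p) lam.
  have [phi [nphi iphi phiP]] := Ext_embedding charK n p.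
  apply: (multiplicity_block_mult charK nphi iphi (gsignK charK n p) phiP (ysym_complete charK n p)).
  by apply: TensF_splits => i; apply: SchurF_splits1 => //; apply: parts_sumn.
have Spad_trivial (lam : {ffun 'I_n -> intpart p}) : a < (head 0%N (parts (lam i0)))%:Z ->
    forall V, trivial_space (Spad lam V).
  move=> ah V; apply: (@tens_trivial _ _ _ i0).
  rewrite /SchurPadF /=; have -> : (head 0%N (parts (lam i0)))%:Z <= p%:Z + a - p%:Z = false by lia.
  move=> x y; exact: zero_uniq.
have Spad_splits (lam : {ffun 'I_n -> intpart p}) : (head 0%N (parts (lam i0)))%:Z <= a -> splits (Spad lam) (pad_sym K dd i0 lam).
  move=> ah; apply: TensF_splits => i; rewrite /padded_young.
  have [->|ne] := eqVneq i i0.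
    have aE : a = `|a|%N%:Z by lia.
    rewrite /= ddi0 {1}aE; apply: (SchurPadF_splits1 charK); first exact: parts_sumn.
    by rewrite -lez_nat -aE.
  rewrite -val_eqE /= in ne; rewrite (negPf ne).
  by apply: (SchurF_splits0 charK); rewrite ?parts_sumn ?dd0 // -val_eqE.
split; last first.
  move=> V lam.
  have [ah|ah] := lerP (head 0%N (parts (lam i0)))%:Z a.
    apply: (splits_irreducible charK _ (Spad_splits lam ah)).
    by apply: pad_sym_primitive.
  move=> U _; left; apply/eqP; rewrite -subv0; apply/subvP => x _.
  by rewrite (Spad_trivial lam ah V x 0) mem0v.
have -> : (fun lam => copies (m lam) (Spad lam)) = (fun lam => copies (block_mult (fun lam : {ffun 'I_n -> intpart p} => ysym K lam) (gsign K n p) lam) (Spad lam)).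
  by apply: functional_extensionality_dep => lam; rewrite multE.
(* For negative [a] the sheaf has no sections, and [a] lies below every first row: both sides are
   zero. *)
have [a0|a0] := lerP 0 a; last first.
  apply: nat_iso_trivial => V.
    apply: (@Koszul_trivial K n p 0 B V i0).
    by rewrite /B /= addr0.
  apply: big_dsum_trivial => lam W; apply: copies_trivial => V'; apply: Spad_trivial.
  by lia.
apply: (@koszul_decomposition K charK n p dd i0 j0 0 B dd0).
- move=> i; rewrite addr0 /B /dd -val_eqE /=.
  by case: ifP => //; lia.
- by rewrite addr0 /B.
move=> lam; have [ah|ah] := lerP (head 0%N (parts (lam i0)))%:Z a.
  left; split; last exact: Spad_splits.
  move=> k; apply: leq_trans (sorted_geq_nth (parts_sorted (lam i0)) (leq0n k)) _.
  by rewrite nth0 ddi0; lia.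
right; split; last exact: Spad_trivial.
by exists 0%N; rewrite nth0 ddi0; lia.
Qed.
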